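(* Let $d=1$, let $R$ be an integer with $|R|\ge2$, $B\subset\mathbb{Z}$ finite with $0\in B$, $N:=|B|$, such that $\mu=\mu(R,B)$ has no overlap. Let $L\subset\mathbb{Z}$ be finite with $0\in L$ and $(\alpha_l)_{l\in L}$ complex numbers with $\alpha_0=1$ such that the matrix $\frac{1}{\sqrt N}\left(e^{2\pi i lb/R}\alpha_l\right)_{l\in L,b\in B}$ has orthonormal columns. If the only finite minimal invariant set is $\{0\}$, then the only entire function $h$ on $\mathbb{C}$ with $0\le h\le1$ on $\mathbb{R}$, $h(0)=1$ and $\sum_{l\in L}|\alpha_l|^2|m_B((t-l)/R)|^2h((t-l)/R)=h(t)$ for all $t\in\mathbb{R}$ is the constant $1$, and therefore $$\left\{\Big(\prod_{i=0}^k\alpha_{l_i}\Big)e_{l_0+Rl_1+\dots+R^kl_k}: l_0\dots l_k\in\Omega(L)\right\}$$ is a Parseval frame for $L^2(\mu)$. Conversely, if there is a finite minimal invariant set $M\ne\{0\}$, then for every $c\in M$, $e_c$ is orthogonal in $L^2(\mu)$ to every element of this set (so the set is incomplete).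
   Context: $\tau_b(x)=(x+b)/R$; $\mu(R,B)$ is the unique Borel probability measure with $\mu(E)=\frac1N\sum_b\mu(\tau_b^{-1}(E))$, supported on the attractor $X_B=\bigcup_b\tau_b(X_B)$; no overlap means $\mu(\tau_b(X_B)\cap\tau_{b'}(X_B))=0$ for $b\ne b'$. $e_\lambda(x)=e^{2\pi i\lambda x}$, $m_B(x)=\frac1N\sum_{b\in B}e^{2\pi ibx}$, $g_l(t)=(t-l)/R$. A set $M\subset\mathbb{R}$ is invariant if for all $t\in M$ and $l\in L$ with $\alpha_lm_B(g_l(t))\ne0$ we have $g_l(t)\in M$; a finite minimal invariant set is a nonempty finite invariant set with no proper nonempty invariant subset. $\Omega(L)$: the empty word (giving $e_0$ with weight 1) and all words $l_0\dots l_k$ with $l_i\in L$, $l_k\ne0$. Parseval frame: $\sum_i|\langle v,f_i\rangle|^2=\|v\|^2$ for all $v$. *)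

(* Defs.v *)
From HB Require Import structures.
From mathcomp Require Import all_boot all_order all_algebra.
From mathcomp Require Import all_classical all_reals all_analysis.
From mathcomp.real_closed Require Import complex.
Import Order.TTheory GRing.Theory Num.Theory.
Import numFieldNormedType.Exports.

Set Implicit Arguments.
Unset Strict Implicit.
Unset Printing Implicit Defensive.

Local Open Scope ring_scope.
Local Open Scope classical_set_scope.

Section IFSDefs.
Variable R : realType.
Local Notation C := R[i].

Definition expi2pi (x : R) : C := Complex (cos (2 * pi * x)) (sin (2 * pi * x)).

Definition ee (lam : R) : R -> C := fun x => expi2pi (lam * x).

Definition tau (Rr b : int) (x : R) : R := (x + b%:~R) / Rr%:~R.

Definition gmap (Rr l : int) (t : R) : R := (t - l%:~R) / Rr%:~R.

Definition mB (B : seq int) (x : R) : C :=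
  ((size B)%:R)^-1 * \sum_(b <- B) ee b%:~R x.

(* X is the attractor of the IFS {tau_b}: the (unique, Hutchinson) nonempty
   compact set with X = U_b tau_b(X). *)
Definition is_attractor (Rr : int) (B : seq int) (X : set R) : Prop :=
  [/\ compact X, X !=set0 &
      X = \bigcup_(b in [set b | b \in B]) (tau Rr b @` X)].

Definition is_invariant_measure (Rr : int) (B : seq int)
    (mu : probability R R) : Prop :=
  forall E : set R, measurable E ->
    mu E = ((((size B)%:R : R)^-1)%:E * \sum_(b <- B) mu (tau Rr b @^-1` E))%E.

Definition no_overlap (Rr : int) (B : seq int) (X : set R)
    (mu : probability R R) : Prop :=
  forall b b', b \in B -> b' \in B -> b != b' ->
    mu (tau Rr b @` X `&` tau Rr b' @` X) = 0%E.

Definition hadamard_entry (Rr : int) (B : seq int) (alpha : int -> C)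
    (l b : int) : C :=
  (((Num.sqrt ((size B)%:R : R))^-1)%:C)%C * expi2pi ((l * b)%:~R / Rr%:~R) * alpha l.

Definition orthonormal_columns (Rr : int) (B L : seq int) (alpha : int -> C) : Prop :=
  forall b b', b \in B -> b' \in B ->
    \sum_(l <- L) conjc (hadamard_entry Rr B alpha l b) * hadamard_entry Rr B alpha l b'
      = (b == b')%:R.

Definition invariant_set (Rr : int) (B L : seq int) (alpha : int -> C)
    (M : set R) : Prop :=
  forall t l, M t -> l \in L -> alpha l * mB B (gmap Rr l t) != 0 ->
    M (gmap Rr l t).

Definition finite_minimal_invariant (Rr : int) (B L : seq int) (alpha : int -> C)
    (M : set R) : Prop :=
  [/\ M !=set0, finite_set M, invariant_set Rr B L alpha M &
      forall M' : set R, M' `<=` M -> M' !=set0 ->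
        invariant_set Rr B L alpha M' -> M' = M].

Definition Omega (L : seq int) : set (seq int) :=
  [set w | all (fun l => l \in L) w /\ (w = [::] \/ last 0 w != 0)].

Definition word_freq (Rr : int) (w : seq int) : int :=
  \sum_(i < size w) Rr ^+ i * nth 0 w i.

Definition frame_elt (Rr : int) (alpha : int -> C) (w : seq int) : R -> C :=
  fun x => (\prod_(l <- w) alpha l) * ee (word_freq Rr w)%:~R x.

Definition cintegral (mu : probability R R) (f : R -> C) : C :=
  Complex (Rintegral mu setT (fun x => complex.Re (f x)))
          (Rintegral mu setT (fun x => complex.Im (f x))).

Definition l2inner (mu : probability R R) (f g : R -> C) : C :=
  cintegral mu (fun x => f x * conjc (g x)).

(* v is (a representative of) an element of L^2(mu) *)
Definition in_L2 (mu : probability R R) (v : R -> C) : Prop :=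
  [/\ measurable_fun setT (fun x => complex.Re (v x)),
      measurable_fun setT (fun x => complex.Im (v x)) &
      (\int[mu]_x ((Normc.normc (v x)) ^+ 2)%:E < +oo)%E].

Definition parseval_frame (mu : probability R R) (I : choiceType)
    (Om : set I) (f : I -> R -> C) : Prop :=
  forall v : R -> C, in_L2 mu v ->
    (\esum_(w in Om) ((Normc.normc (l2inner mu v (f w))) ^+ 2)%:E
      = \int[mu]_x ((Normc.normc (v x)) ^+ 2)%:E)%E.

Definition entire (h : C -> C) : Prop :=
  forall z : C, derivable (h : C^o -> C^o) z 1.

End IFSDefs.

(* Main.v *)
Require Import Defs.
From HB Require Import structures.
From mathcomp Require Import all_boot all_order all_algebra.
From mathcomp Require Import all_classical all_reals all_analysis.
From mathcomp.real_closed Require Import complex.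
From mathcomp Require Import measurable_realfun ring lra.
Import Order.TTheory GRing.Theory Num.Theory.
Import numFieldNormedType.Exports.
Set Implicit Arguments.
Unset Strict Implicit.
Unset Printing Implicit Defensive.
Local Open Scope ring_scope.
Local Open Scope classical_set_scope.

                                                                                              
                                                                             
                                                                                              
                                                                                                
                                                                                               
                                

                                                                                                  
                                                                                              
                                                                                                 
                                                                                          
                                                                                            
                                                                                          

                                                                                                   
                                                                                                     
                                                                                                 
                                                                                            
                        

                                                                                                   
                                                                                           
                                      

                        

(** Let T be the transfer operator, T u(t) = sum over l of |alpha_l|^2 |m_B(g_l t)|^2 u(g_l t).
    Orthonormality of the columns makes the weights sum to 1 ([sum_weight]), so T takes averages.

    Uniqueness ([transfer_fixed_eq1]). Some compact interval around 0 is mapped into itself by every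
    g_l. Let u be a fixed point of T with u <= 1 and u(0) = 1, and let Z be the set where u attains
    its minimum over that interval. At a point of Z the minimum is an average of values that are no
    smaller, so Z is invariant. If Z is infinite, analyticity makes u constant. If Z is finite, it
    contains a minimal invariant set, which by hypothesis is {0}, so the minimum is u(0) = 1; then u
    is 1 on the interval, and by analyticity everywhere.

    Frame. The operators [Vop l] peel off the first letter of a word: the inner product of v with
    f_{lw} is that of V_l v with f_w ([l2inner_cons]), and the squared norms of the V_l v add up to
    that of v ([norm2_Vop]). This gives Bessel's inequality for the words of each length n. As V_l
    e_t is a multiple of e_{g_l t}, the frame sums of e_t over words of length n + 1 are T applied
    to those for length n ([qsum_ee]). They increase to a fixed point [hlim] of T with [hlim] <= 1
    and [hlim 0 = 1], which is a limit of entire functions bounded on discs ([hlim_entire]).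
    Uniqueness gives [hlim] = 1, which is the Parseval identity for every e_t. The vectors with
    Parseval identity form a closed subspace; since it contains all exponentials, it is L^2
    ([nul_in_L2]).

    Converse. {0} is invariant, so a minimal M other than {0} misses 0. If the Fourier transform of
    mu did not vanish at some c in M, its refinement equation would put every c / R^k into M, which
    is finite. So it vanishes on M, and iterating T shows that all frame sums of e_c vanish
    ([qsum_ee_eq0]).

    The complex analysis is elementary: Goursat's theorem on squares yields a weak maximum principle
    ([square_bound]), and dividing h^2 by its known zeros turns this into an estimate
    ([zeros_estimate]) that carries the identity theorem, both for entire functions and for their
    limits. *)

Section Goursat.

(** * Goursat's theorem for closed real forms on squares *)

Variable R : realType.
Implicit Types (P Q U V : R -> R -> R) (x y s : R).

Lemma MVT_closed (f df : R -> R) (a b : R) : a < b ->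
  (forall x, a <= x <= b -> is_derive x 1 f (df x)) ->
  exists2 c, a <= c <= b & f b - f a = df c * (b - a).
Proof.
move=> ab fd.
have [||c] := @MVT R f df a b ab.
- move=> x; rewrite in_itv /= => /andP[ax xb]; apply: fd.
  by rewrite !ltW.
- apply: derivable_within_continuous => x; rewrite in_itv /= => xab.
  by have := fd _ xab; case.
- rewrite in_itv /= => /andP[ac cb] fE; exists c => //.
  by rewrite !ltW.
Qed.

(** The line integral of P dx + Q dy, counterclockwise around the square with lower left corner (x,
    y) and side s, where [U y] is a primitive of P(., y) and [V x] a primitive of Q(x, .).
    Differences of primitives stand for the integrals along the sides. *)
Definition circulation U V x y s : R :=
  (U y (x + s) - U y x) + (V (x + s) (y + s) - V (x + s) y)
  - (U (y + s) (x + s) - U (y + s) x) - (V x (y + s) - V x y).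

(** The inner edges of the four subsquares cancel in pairs, so the circulations add up and some
    quarter carries at least a fourth. *)
Lemma circulation_quarter U V x y s :
  exists i j : bool, `|circulation U V x y s| <=
    4 * `|circulation U V (x + i%:R * (s / 2)) (y + j%:R * (s / 2)) (s / 2)|.
Proof.
pose t := s / 2.
have sE : s = t + t by rewrite /t; field.
have E : circulation U V x y s =
  circulation U V (x + 0 * t) (y + 0 * t) t
  + circulation U V (x + 1 * t) (y + 0 * t) t
  + circulation U V (x + 0 * t) (y + 1 * t) t
  + circulation U V (x + 1 * t) (y + 1 * t) t.
  by rewrite sE /circulation !mul0r !addr0 !mul1r !addrA; ring.
apply: contrapT => H.
have {}H (i j : bool) : 4 * `|circulation U V (x + i%:R * t) (y + j%:R * t) t|
    < `|circulation U V x y s|.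
  by rewrite ltNge; apply/negP => ?; apply: H; exists i, j.
have := H false false; have := H false true.
have := H true false; have := H true true.
move: E; rewrite ?mulr0n ?mulr1n /=.
move: (circulation U V x y s) (circulation U V (x + 0 * t) (y + 0 * t) t)
  (circulation U V (x + 1 * t) (y + 0 * t) t)
  (circulation U V (x + 0 * t) (y + 1 * t) t)
  (circulation U V (x + 1 * t) (y + 1 * t) t) => A a b c d ->.
move=> h1 h2 h3 h4.
have := ler_normD (a + b + c) d; have := ler_normD (a + b) c.
have := ler_normD a b; lra.
Qed.

(** The approximating affine form is closed, because the same [b] occurs in both components, so its
    share cancels over the four sides. The mean value theorem, applied to each primitive minus a
    quadratic one, leaves at most [e * s] per side. *)
Lemma circulation_small P Q U V x y s (x1 y1 p q a b c e : R) : 0 < s ->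
  (forall x' y', x <= x' <= x + s -> y <= y' <= y + s ->
     is_derive x' 1 (U y') (P x' y') /\ is_derive y' 1 (V x') (Q x' y')) ->
  (forall x' y', x <= x' <= x + s -> y <= y' <= y + s ->
     `|P x' y' - (p + a * (x' - x1) + b * (y' - y1))| <= e /\
     `|Q x' y' - (q + b * (x' - x1) + c * (y' - y1))| <= e) ->
  `|circulation U V x y s| <= 4 * (e * s).
Proof.
move=> s0 dUV PQ.
have xlt : x < x + s by rewrite ltrDl.
have ylt : y < y + s by rewrite ltrDl.
have ys : y <= y <= y + s by rewrite lexx lerDl ltW.
have yss : y <= y + s <= y + s by rewrite lexx lerDl ltW.
have xs : x <= x <= x + s by rewrite lexx lerDl ltW.
have xss : x <= x + s <= x + s by rewrite lexx lerDl ltW.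
have HU y' : y <= y' <= y + s ->
  `|U y' (x + s) - U y' x - (p * s + a * ((x + s - x1)^+2 - (x - x1)^+2)/2 + b * (y' - y1) * s)|
   <= e * s.
  move=> yy'.
  have dF (t : R) : x <= t <= x + s ->
    is_derive t 1 (fun t => U y' t - (p * t + a / 2 * (t - x1)^+2 + b * (y' - y1) * t))
      (P t y' - (p + a * (t - x1) + b * (y' - y1))).
    move=> xt; have [? _] := dUV _ _ xt yy'.
    by apply: is_derive_eq; rewrite /GRing.scale /=; field.
  have [t xt E] := MVT_closed (f := fun t => U y' t - (p * t + a / 2 * (t - x1)^+2 + b * (y' - y1) * t)) (b := x + s) (a := x) xlt dF.
  rewrite [X in `|X|](_ : _ = (P t y' - (p + a * (t - x1) + b * (y' - y1))) * s).
    rewrite normrM (gtr0_norm s0) ler_pM2r//.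
    by have [] := PQ _ _ xt yy'.
  rewrite [x + s - x](_ : _ = s) in E; last by ring.
  by rewrite -E; field.
have HV x' : x <= x' <= x + s ->
  `|V x' (y + s) - V x' y - (q * s + b * (x' - x1) * s + c * ((y + s - y1)^+2 - (y - y1)^+2)/2)|
   <= e * s.
  move=> xx'.
  have dF (t : R) : y <= t <= y + s ->
    is_derive t 1 (fun t => V x' t - (q * t + b * (x' - x1) * t + c / 2 * (t - y1)^+2))
      (Q x' t - (q + b * (x' - x1) + c * (t - y1))).
    move=> yt; have [_ ?] := dUV _ _ xx' yt.
    by apply: is_derive_eq; rewrite /GRing.scale /=; field.
  have [t yt E] := MVT_closed (f := fun t => V x' t - (q * t + b * (x' - x1) * t + c / 2 * (t - y1)^+2)) (b := y + s) (a := y) ylt dF.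
  rewrite [X in `|X|](_ : _ = (Q x' t - (q + b * (x' - x1) + c * (t - y1))) * s).
    rewrite normrM (gtr0_norm s0) ler_pM2r//.
    by have [] := PQ _ _ xx' yt.
  rewrite [y + s - y](_ : _ = s) in E; last by ring.
  by rewrite -E; field.
move: (HU _ ys) (HU _ yss) (HV _ xs) (HV _ xss); rewrite !ler_norml /circulation.
lra.
Qed.

(** Goursat's bisection: the chosen quarters shrink to a point (x1, y1), where differentiability
    with a symmetric Jacobian makes the circulation of a square of side s an o(s^2). This beats the
    factor 4^n lost after n halvings. *)
Lemma goursat_square P Q U V x0 y0 s0 : 0 < s0 ->
  (forall x y, x0 <= x <= x0 + s0 -> y0 <= y <= y0 + s0 ->
     is_derive x 1 (U y) (P x y) /\ is_derive y 1 (V x) (Q x y)) ->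
  (forall x1 y1, exists a b c, forall e, 0 < e -> exists2 d, 0 < d &
     forall x y, `|x - x1| <= d -> `|y - y1| <= d ->
     `|P x y - (P x1 y1 + a * (x - x1) + b * (y - y1))|
        <= e * (`|x - x1| + `|y - y1|) /\
     `|Q x y - (Q x1 y1 + b * (x - x1) + c * (y - y1))|
        <= e * (`|x - x1| + `|y - y1|)) ->
  circulation U V x0 y0 s0 = 0.
Proof.
move=> s00 dUV dPQ.
pose sd n : R := s0 / 2 ^+ n.
have sd0 n : 0 < sd n by rewrite /sd divr_gt0// exprn_gt0.
have sdS n : sd n.+1 = sd n / 2.
  by rewrite /sd exprS invfM mulrA mulrAC.
pose nxt (n : nat) (z : R * R) (w : bool * bool) : R * R :=
  (z.1 + w.1%:R * sd n.+1, z.2 + w.2%:R * sd n.+1).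
have /choice[ch chP] : forall nz : nat * (R * R), exists w : bool * bool,
   `|circulation U V nz.2.1 nz.2.2 (sd nz.1)| <=
    4 * `|circulation U V (nxt nz.1 nz.2 w).1 (nxt nz.1 nz.2 w).2 (sd nz.1.+1)|.
  move=> [n [x y]] /=.
  have [i [j H]] := circulation_quarter U V x y (sd n).
  by exists (i, j); rewrite /= sdS.
pose fix sq n : R * R := if n is k.+1 then nxt k (sq k) (ch (k, sq k)) else (x0, y0).
have sq_circ n : `|circulation U V x0 y0 s0| <=
    4 ^+ n * `|circulation U V (sq n).1 (sq n).2 (sd n)|.
  elim: n => [|n IH]; first by rewrite expr0 mul1r /= /sd expr0 divr1.
  apply: le_trans IH _; rewrite exprSr -mulrA ler_pM2l ?exprn_gt0//.
  exact: (chP (n, sq n)).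
have sq1 n : (sq n).1 <= (sq n.+1).1 /\ (sq n.+1).1 + sd n.+1 <= (sq n).1 + sd n.
  rewrite /= sdS; have := sd0 n; case: (ch _).1; rewrite /= ?mul1r ?mul0r; lra.
have sq2 n : (sq n).2 <= (sq n.+1).2 /\ (sq n.+1).2 + sd n.+1 <= (sq n).2 + sd n.
  rewrite /= sdS; have := sd0 n; case: (ch _).2; rewrite /= ?mul1r ?mul0r; lra.
have nest (u : nat -> R) : (forall n, u n <= u n.+1 /\ u n.+1 + sd n.+1 <= u n + sd n) ->
    exists l, forall n, u n <= l <= u n + sd n.
  move=> Hu.
  have mono : {homo u : m n / (m <= n)%N >-> m <= n}.
    by apply: homo_leq => //; [exact: le_trans|move=> n; case: (Hu n)].
  have anti m n : (m <= n)%N -> u n + sd n <= u m + sd m.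
    elim: n => [|n IH]; first by rewrite leqn0 => /eqP ->.
    rewrite leq_eqVlt => /predU1P[->//|/IH]; apply: le_trans.
    by case: (Hu n).
  have ub m n : u m <= u n + sd n.
    case: (leqP m n) => [/mono h|/ltnW/anti h].
      by apply: (le_trans h); rewrite lerDl ltW.
    by apply: le_trans h; rewrite lerDl ltW.
  have hs : has_sup (range u).
    split; first by exists (u 0%N), 0%N.
    by exists (u 0%N + sd 0%N) => _ [m _ <-].
  exists (sup (range u)) => n; apply/andP; split.
    by apply: ub_le_sup; [case: hs|exists n].
  by apply: ge_sup; [case: hs|move=> _ [m _ <-]].
have [x1 Hx1] := nest (fun n => (sq n).1) sq1.
have [y1 Hy1] := nest (fun n => (sq n).2) sq2.
have in_sq n : x0 <= (sq n).1 /\ (sq n).1 + sd n <= x0 + s0 /\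
    y0 <= (sq n).2 /\ (sq n).2 + sd n <= y0 + s0.
  elim: n => [|n]; first by rewrite /= /sd expr0 divr1 !lexx.
  have := sq1 n; have := sq2 n; lra.
have [a [b [c H]]] := dPQ x1 y1.
apply/eqP; rewrite -normr_le0; apply/ler_addgt0Pl => e e0; rewrite addr0.
(* The constant 8 balances four sides and two coordinate distances: with side s = s0 / 2^n, the
   bound 4^n * 4 * (e / (8 s0^2)) * 2 s * s equals e. *)
have [|d d0 {}H] := H (e / (8 * s0 ^+ 2)); first by rewrite divr_gt0// mulr_gt0// exprn_gt0.
have [n Hn] : exists n, sd n <= d.
  exists (`|Num.ceil (s0 / d)|)%N.
  rewrite /sd ler_pdivrMr ?exprn_gt0// -ler_pdivrMl//.
  rewrite mulrC; apply: (@le_trans _ _ (`|Num.ceil (s0 / d)|)%:R).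
    rewrite natr_absz; apply: le_trans (Num.Theory.ceil_ge _) _.
    by rewrite ler_int ler_norm.
  by rewrite -natrX ler_nat ltnW// ltn_expl.
apply: le_trans (sq_circ n) _.
have [h1 [h2 [h3 h4]]] := in_sq n.
have /andP[h5 h6] := Hx1 n; have /andP[h7 h8] := Hy1 n.
rewrite (_ : e = 4 ^+ n * (4 * ((e / (4 * s0 ^+ 2) * sd n) * sd n))); last first.
  rewrite /sd (_ : 4 ^+ n = 2 ^+ n * 2 ^+ n :> R); last first.
    by rewrite -exprMn -natrM.
  by field; rewrite ?expf_neq0// ?gt_eqF//.
rewrite ler_pM2l ?exprn_gt0//.
apply: (circulation_small (P := P) (Q := Q) (x1 := x1) (y1 := y1)
  (p := P x1 y1) (q := Q x1 y1) (a := a) (b := b) (c := c)) => // x y Hx Hy.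
  by apply: dUV; lra.
have hx : `|x - x1| <= sd n by rewrite ler_norml; lra.
have hy : `|y - y1| <= sd n by rewrite ler_norml; lra.
have E0 : 0 < e / (8 * s0 ^+ 2) by rewrite divr_gt0// mulr_gt0// exprn_gt0.
have -> : e / (4 * s0 ^+ 2) * sd n = e / (8 * s0 ^+ 2) * (sd n + sd n).
  by field; rewrite gt_eqF.
have [g1 g2] := H x y (le_trans hx Hn) (le_trans hy Hn).
by split; [apply: le_trans g1 _|apply: le_trans g2 _];
  rewrite ler_pM2l// lerD.
Qed.

Lemma continuous_primitive (f : R -> R) (a : R) : continuous f ->
  exists F : R -> R, forall x, a < x -> is_derive x 1 F (f x).
Proof.
move=> cf.
pose F x := (\int[@lebesgue_measure R]_(t in [set` `[a, x]]) (f t))%R.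
exists F => x ax.
have fi : (@lebesgue_measure R).-integrable `[a, x + 1] (EFin \o f).
  apply: continuous_compact_integrable; first exact: segment_compact.
  exact: continuous_subspaceT.
have x1 : x < x + 1 by rewrite ltrDl ltr01.
have [d E] := continuous_FTC1_closed x1 fi ax (cf x).
by rewrite -[f x]E derive1E; split; [exact: d|].
Qed.

End Goursat.

                                  

(** * Complex differentiability through continuous slopes *)

Section ComplexDifferentiability.
Variable R : realType.
Local Notation K := (R[i] : numFieldType).
Local Notation normc := (@Normc.normc R).
Implicit Types (f g h phi : R[i] -> R[i]) (z w a c : R[i]).

Lemma normc_ge0 (z : R[i]) : 0 <= normc z.
Proof. by case: z => x y; exact: sqrtr_ge0. Qed.

Lemma sqr_normcE (z : R[i]) : normc z ^+ 2 = complex.Re z ^+ 2 + complex.Im z ^+ 2.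
Proof. by case: z => x y; rewrite /= sqr_sqrtr// addr_ge0// sqr_ge0. Qed.

Lemma normc_eq0 (z : R[i]) : (normc z == 0) = (z == 0).
Proof.
by apply/eqP/eqP => [/Normc.eq0_normc//|->]; rewrite -[RHS](@Normc.normc0 R).
Qed.

Lemma normc_gt0 (z : R[i]) : (0 < normc z) = (z != 0).
Proof. by rewrite lt_def normc_eq0 normc_ge0 andbT. Qed.

Lemma normc_conjc (z : R[i]) : normc (conjc z) = normc z.
Proof. by case: z => x y; rewrite /= sqrrN. Qed.

Lemma normc_real (x : R) : normc x%:C%C = `|x|.
Proof. by rewrite /= expr0n addr0 sqrtr_sqr. Qed.

Lemma normcX (z : R[i]) n : normc (z ^+ n) = normc z ^+ n.
Proof.
elim: n => [|n IH]; first by rewrite !expr0 -[RHS](@Normc.normc1 R).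
by rewrite !exprS Normc.normcM IH.
Qed.

Lemma normc_prod (T : Type) (s : seq T) (P : pred T) (F : T -> R[i]) :
  normc (\prod_(i <- s | P i) F i) = \prod_(i <- s | P i) normc (F i).
Proof.
elim/big_ind2: _ => // [|x1 x2 y1 y2 <- <-]; last by rewrite Normc.normcM.
exact: (@Normc.normc1 R).
Qed.

Lemma ler_normc_sum (T : Type) (s : seq T) (P : pred T) (F : T -> R[i]) :
  normc (\sum_(i <- s | P i) F i) <= \sum_(i <- s | P i) normc (F i).
Proof.
elim/big_ind2: _ => // [|x1 x2 y1 y2 h1 h2]; first by rewrite (@Normc.normc0 R).
by apply: le_trans (le_normcD _ _) _; exact: lerD.
Qed.

Lemma ler_normc_Re (z : R[i]) : `|complex.Re z| <= normc z.
Proof.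
case: z => x y /=; rewrite -sqrtr_sqr ler_sqrt ?addr_ge0 ?sqr_ge0//.
by rewrite lerDl sqr_ge0.
Qed.

Lemma ler_normc_Im (z : R[i]) : `|complex.Im z| <= normc z.
Proof.
case: z => x y /=; rewrite -[`|y|]sqrtr_sqr ler_sqrt ?addr_ge0 ?sqr_ge0//.
by rewrite lerDr sqr_ge0.
Qed.

Lemma normc_le_ReIm (z : R[i]) : normc z <= `|complex.Re z| + `|complex.Im z|.
Proof.
rewrite -(@ler_pXn2r _ 2)// ?nnegrE ?normc_ge0 ?addr_ge0// sqr_normcE.
rewrite sqrrD !real_normK ?num_real//.
by rewrite addrAC lerDl mulrn_wge0// mulr_ge0.
Qed.

Lemma normcB (z w : R[i]) : normc (z - w) = normc (w - z).
Proof. by rewrite -opprB normcN. Qed.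

Lemma normc_subl (z w : R[i]) : normc z - normc w <= normc (z - w).
Proof. by rewrite lerBlDr; have := le_normcD (z - w) w; rewrite subrK. Qed.

Lemma ltr_normC (z : R[i]) (d : R) : (`|z| < d%:C%C) = (normc z < d).
Proof. exact: ltcR. Qed.

Definition ccont f z := forall e : R, 0 < e -> exists2 d : R, 0 < d &
  forall w, normc (w - z) < d -> normc (f w - f z) < e.

Lemma ball_normcE (z w : K) (d : R) :
  ball_ [eta Num.Def.normr] z d%:C%C w = (normc (w - z) < d) :> Prop.
Proof. by rewrite /= ltr_normC normcB. Qed.

Lemma ccontP f z : {for (z : K), continuous (f : K -> K)} <-> ccont f z.
Proof.
split=> [cf e e0|H].
  have /cvgrPdist_lt := cf.
  move/(_ (e%:C)%C); rewrite ltcR => /(_ e0); rewrite -nbhs_nearE.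
  move/nbhs_ballP => [[d i] /=]; rewrite ltcE /= => /andP[/eqP -> d0] dH.
  by exists d => // w wz; rewrite normcB -ltr_normC; apply: dH; move: wz; rewrite -ball_normcE.
apply/(@cvgrPdist_lt K K K (nbhs (z : K)) _ f (f z)) => -[e i]; rewrite ltcE /= => /andP[/eqP -> e0].
have [d d0 dH] := H _ e0.
rewrite -nbhs_nearE; apply/nbhs_ballP; exists (d%:C)%C => /=; first by rewrite ltcR.
by move=> w; rewrite ball_normcE => /dH; rewrite normcB -ltr_normC.
Qed.

Lemma ccont_cst c z : ccont (fun=> c) z.
Proof. by move=> e e0; exists 1 => // w _; rewrite subrr Normc.normc0. Qed.

Lemma ccont_id z : ccont id z.
Proof. by move=> e e0; exists e. Qed.

Lemma ccontD f g z : ccont f z -> ccont g z -> ccont (fun w => f w + g w) z.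
Proof.
move=> /ccontP cf /ccontP cg; apply/ccontP.
exact: (@cvgD K K K (nbhs (z : K)) _ f g _ _ cf cg).
Qed.

Lemma ccontM f g z : ccont f z -> ccont g z -> ccont (fun w => f w * g w) z.
Proof.
move=> /ccontP cf /ccontP cg; apply/ccontP.
exact: (@cvgM K K (nbhs (z : K)) _ f g _ _ cf cg).
Qed.

Lemma ccontV f z : f z != 0 -> ccont f z -> ccont (fun w => (f w)^-1) z.
Proof.
move=> fz0 /ccontP cf; apply/ccontP.
exact: (@cvgV K K (nbhs (z : K)) _ f _ fz0 cf).
Qed.

Lemma ccont_comp f g z : ccont f (g z) -> ccont g z -> ccont (fun w => f (g w)) z.
Proof.
move=> cf cg e /cf[d /cg[d' d'0 H] H']; exists d' => // w /H; exact: H'.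
Qed.

(** Caratheodory's form of differentiability: [phi] is a slope function continuous at z, and its
    value there is the derivative. Product, quotient and chain rules become algebra on slopes. *)
Definition cdiff f z := exists phi, ccont phi z /\
  forall w, f w = f z + phi w * (w - z).

Lemma cdiff_continuous f z : cdiff f z -> ccont f z.
Proof.
move=> [phi [cphi fE]].
have : ccont (fun w => f z + phi w * (w - z)) z.
  apply: ccontD; first exact: ccont_cst.
  apply: ccontM; first exact: cphi.
  by apply: ccontD; [exact: ccont_id|exact: ccont_cst].
by rewrite (_ : (fun w => _) = f)//; apply/funext => w; rewrite -fE.
Qed.

Lemma cdiff_cst c z : cdiff (fun=> c) z.
Proof.
by exists (fun=> 0); split=> [|w]; [exact: ccont_cst|rewrite mul0r addr0].
Qed.

Lemma cdiff_id z : cdiff id z.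
Proof.
exists (fun=> 1); split=> [|w]; first exact: ccont_cst.
by rewrite mul1r addrC subrK.
Qed.

Lemma cdiffD f g z : cdiff f z -> cdiff g z -> cdiff (fun w => f w + g w) z.
Proof.
move=> [p [cp fE]] [q [cq gE]]; exists (fun w => p w + q w); split.
  exact: (ccontD cp cq).
by move=> w; rewrite (fE w) (gE w) mulrDl addrACA.
Qed.

Lemma cdiffM f g z : cdiff f z -> cdiff g z -> cdiff (fun w => f w * g w) z.
Proof.
move=> [p [cp fE]] dg; have cg := cdiff_continuous dg.
case: dg => [q [cq gE]]; exists (fun w => p w * g w + f z * q w); split.
  apply: ccontD; first exact: (ccontM cp cg).
  by apply: ccontM; [exact: ccont_cst|exact: cq].
by move=> w; rewrite (fE w) mulrDl [in f z * g w](gE w); ring.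
Qed.

Lemma cdiffX f z n : cdiff f z -> cdiff (fun w => f w ^+ n) z.
Proof.
move=> df; elim: n => [|n IH]; first exact: cdiff_cst.
rewrite (_ : (fun w => _) = fun w => f w * f w ^+ n); first exact: cdiffM.
by apply/funext => w; rewrite exprS.
Qed.

Lemma cdiffV f z : f z != 0 -> cdiff f z -> cdiff (fun w => (f w)^-1) z.
Proof.
move=> fz0 df; have cf := cdiff_continuous df.
case: df => [p [cp fE]].
                                                                                                     
(* Where f vanishes, the convention [0^-1 = 0] breaks the usual formula and the slope is the raw
   difference quotient. Such points stay away from z, so continuity at z only concerns the second
   branch. *)
exists (fun w => if f w == 0 then ((f w)^-1 - (f z)^-1) / (w - z)
                 else - p w / (f w * f z)); split; last first.
  move=> w; case: ifPn => [/eqP fw|fw].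
    rewrite divfK; first by rewrite addrCA subrr addr0.
    by rewrite subr_eq0; apply: contraNneq fz0 => <-; rewrite fw.
  have pE : p w * (w - z) = f w - f z by rewrite (fE w) [f z + _]addrC addrK.
  rewrite mulrAC mulNr pE; field; by rewrite fw fz0.
have H : ccont (fun w => - 1 * p w / (f w * f z)) z.
  apply: (ccontM (ccontM (ccont_cst _ _) cp)).
  apply: (@ccontV (fun w => f w * f z)); first by rewrite mulf_neq0.
  exact: (ccontM cf (ccont_cst _ _)).
move=> e /H[d d0 {}H].
have [|d' d'0 H'] := cf (normc (f z)); first by rewrite normc_gt0.
exists (Num.min d d'); first by rewrite lt_min d0.
move=> w; rewrite lt_min => /andP[/H + /H'] fw.
rewrite (negbTE fz0) ifN ?mulN1r//.
by apply: contraTneq fw => ->; rewrite sub0r normcN ltxx.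
Qed.

Lemma cdiff_comp f g z : cdiff f (g z) -> cdiff g z -> cdiff (fun w => f (g w)) z.
Proof.
move=> [p [cp fE]] dg; have cg := cdiff_continuous dg.
case: dg => [q [cq gE]]; exists (fun w => p (g w) * q w); split.
  apply: ccontM; last exact: cq.
  exact: (ccont_comp cp cg).
by move=> w; rewrite (fE (g w)) [in X in _ * X](gE w) [g z + _]addrC addrK mulrA.
Qed.

Lemma cdiff_sum (T : Type) (s : seq T) (P : pred T) (F : T -> R[i] -> R[i]) z :
  (forall i, cdiff (F i) z) -> cdiff (fun w => \sum_(i <- s | P i) F i w) z.
Proof.
move=> dF; elim: s => [|i s IH].
  rewrite (_ : (fun w => _) = fun=> 0); first exact: cdiff_cst.
  by apply/funext => w; rewrite big_nil.
rewrite (_ : (fun w => _) = fun w =>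
   (if P i then F i w else 0) + \sum_(j <- s | P j) F j w).
  by apply: cdiffD => //; case: (P i); [exact: dF|exact: cdiff_cst].
by apply/funext => w; rewrite big_cons; case: ifP => //; rewrite add0r.
Qed.

Lemma cdiff_prod (T : Type) (s : seq T) (P : pred T) (F : T -> R[i] -> R[i]) z :
  (forall i, cdiff (F i) z) -> cdiff (fun w => \prod_(i <- s | P i) F i w) z.
Proof.
move=> dF; elim: s => [|i s IH].
  rewrite (_ : (fun w => _) = fun=> 1); first exact: cdiff_cst.
  by apply/funext => w; rewrite big_nil.
rewrite (_ : (fun w => _) = fun w =>
   (if P i then F i w else 1) * \prod_(j <- s | P j) F j w).
  by apply: cdiffM => //; case: (P i); [exact: dF|exact: cdiff_cst].
by apply/funext => w; rewrite big_cons; case: ifP => //; rewrite mul1r.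
Qed.

                                                                              
(** At [a] the quotient is 0 by the convention on division, and this is the right value: if h = phi
    (w - a), the quotient is phi^2 (w - a). The square matters, since h / (w - a) should take the
    value h'(a) at [a] and would get 0. *)
Lemma cdiff_sqr_div h a : h a = 0 -> cdiff h a ->
  cdiff (fun w => h w ^+ 2 / (w - a)) a.
Proof.
move=> ha [p [cp hE]]; exists (fun w => p w ^+ 2); split.
  by apply: ccontM; exact: cp.
move=> w; rewrite subrr invr0 mulr0 add0r (hE w) ha add0r.
have [->|wa] := eqVneq w a; first by rewrite subrr !mulr0 expr0n mul0r.
by field; rewrite subr_eq0.
Qed.

Lemma derivable_cdiff (h : R[i] -> R[i]) (z : R[i]) :
  derivable (h : (R[i])^o -> (R[i])^o) z 1 -> cdiff h z.
Proof.
move=> /cvg_ex[/= d H].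
exists (fun w => if w == z then d else (h w - h z) / (w - z)); split; last first.
  move=> w; case: eqVneq => [->|wz]; first by rewrite subrr mulr0 addr0.
  by rewrite divfK ?subr_eq0// addrC subrK.
move=> e e0; rewrite eqxx.
have /cvgrPdist_lt/(_ (e%:C)%C) := H; rewrite ltcR => /(_ e0).
move/nbhs_ballP => [[r i] /=]; rewrite ltcE /= => /andP[/eqP -> r0] dH.
exists r => // w wz; case: ifPn => [_|wz0]; first by rewrite subrr Normc.normc0.
have := dH (w - z); move: wz; rewrite -[w - z in X in X -> _]subr0 -ball_normcE => wz /(_ wz).
rewrite subr_eq0 => /(_ wz0); rewrite ltr_normC normcB.
suff -> : (w - z)^-1 *: (h ((w - z)%:A + z) - h z : (R[i])^o) = (h w - h z) / (w - z) by [].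
have -> : (w - z)%:A + z = w by rewrite /GRing.scale /= mulr1 subrK.
by rewrite /GRing.scale /= mulrC.
Qed.

End ComplexDifferentiability.

                            

(** * A weak maximum principle on squares *)

Section MaximumPrinciple.
Variable R : realType.
Local Notation normc := (@Normc.normc R).
Implicit Types (f g h : R[i] -> R[i]) (z w : R[i]).

Lemma cdiff_slope f z : cdiff f z -> exists c : R[i], forall e : R, 0 < e ->
  exists2 d : R, 0 < d & forall w, normc (w - z) < d ->
    normc (f w - f z - c * (w - z)) <= e * normc (w - z).
Proof.
move=> [p [cp fE]]; exists (p z) => e /cp[d d0 H]; exists d => // w /H /ltW wz.
by rewrite (fE w) [f z + _]addrC addrK -mulrBl Normc.normcM ler_wpM2r// normc_ge0.
Qed.

Definition on_square z0 (r : R) w :=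
  (`|complex.Re (w - z0)| <= r /\ `|complex.Im (w - z0)| <= r) /\
  (`|complex.Re (w - z0)| = r \/ `|complex.Im (w - z0)| = r).

Lemma on_square_normc z0 r w : 0 <= r -> on_square z0 r w ->
  r <= normc (w - z0) <= 2 * r.
Proof.
move=> r0 [[h1 h2] h3].
have := ler_normc_Re (w - z0); have := ler_normc_Im (w - z0).
have := normc_le_ReIm (w - z0).
by case: h3 => h; lra.
Qed.

(** Im (f dz) = P dx + Q dy with P = Im f and Q = Re f, and the Cauchy-Riemann equations make its
    Jacobian symmetric. Goursat gives circulation 0, while with these signs each of the four sides
    contributes a positive amount. *)
Lemma cdiff_no_circulation f : (forall z, cdiff f z) ->
  forall x0 y0 s : R, 0 < s ->
  (forall x, x0 <= x <= x0 + s -> 0 < complex.Im (f (Complex x y0))) ->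
  (forall y, y0 <= y <= y0 + s -> 0 < complex.Re (f (Complex (x0 + s) y))) ->
  (forall x, x0 <= x <= x0 + s -> complex.Im (f (Complex x (y0 + s))) < 0) ->
  (forall y, y0 <= y <= y0 + s -> complex.Re (f (Complex x0 y)) < 0) -> False.
Proof.
move=> df x0 y0 s s0 hb hr ht hl.
pose P x y := complex.Im (f (Complex x y)).
pose Q x y := complex.Re (f (Complex x y)).
have subE (x y x' y' : R) : Complex x y - Complex x' y' = Complex (x - x') (y - y') by [].
have dPQ x1 y1 : exists a b c, forall e, 0 < e -> exists2 d, 0 < d &
     forall x y, `|x - x1| <= d -> `|y - y1| <= d ->
     `|P x y - (P x1 y1 + a * (x - x1) + b * (y - y1))|
        <= e * (`|x - x1| + `|y - y1|) /\
     `|Q x y - (Q x1 y1 + b * (x - x1) + c * (y - y1))|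
        <= e * (`|x - x1| + `|y - y1|).
  have [[p q] H] := cdiff_slope (df (Complex x1 y1)).
  (* If f' = p + i q, then dP = q dx + p dy and dQ = p dx - q dy. *)
  exists q, p, (- q) => e e0; have [d d0 {}H] := H _ e0.
  exists (d / 3); first by rewrite divr_gt0.
  move=> x y hx hy.
  have nle : normc (Complex (x - x1) (y - y1)) <= `|x - x1| + `|y - y1|.
    exact: normc_le_ReIm.
  have {}H := H (Complex x y) _; rewrite subE in H.
  have {H} : normc (f (Complex x y) - f (Complex x1 y1) - Complex p q * Complex (x - x1) (y - y1))
      <= e * (`|x - x1| + `|y - y1|).
    apply: le_trans (H _) _; first by apply: le_lt_trans nle _; lra.
    by rewrite ler_pM2l.
  rewrite /P /Q; case: (f (Complex x y)) => u v; case: (f (Complex x1 y1)) => u1 v1.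
  move=> H; split.
    apply: le_trans H; apply: le_trans (ler_normc_Im _) => /=.
    by rewrite le_eqVlt; apply/orP; left; apply/eqP; congr (`|_|); ring.
  apply: le_trans H; apply: le_trans (ler_normc_Re _) => /=.
  by rewrite le_eqVlt; apply/orP; left; apply/eqP; congr (`|_|); ring.
have cP y : continuous (P ^~ y).
  move=> x; apply/cvgrPdist_lt => e e0.
  have [d d0 H] := cdiff_continuous (df (Complex x y)) e0.
  near=> x'; rewrite distrC.
  have := H (Complex x' y) _; rewrite subE subrr => Hx.
  apply: le_lt_trans (Hx _).
    have := ler_normc_Im (f (Complex x' y) - f (Complex x y)); rewrite /P.
    by case: (f (Complex x' y)) => ? ?; case: (f (Complex x y)).
  by rewrite normc_real; near: x'; apply: cvgr_distC_lt.
have cQ x : continuous (Q x).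
  move=> y; apply/cvgrPdist_lt => e e0.
  have [d d0 H] := cdiff_continuous (df (Complex x y)) e0.
  near=> y'; rewrite distrC.
  have := H (Complex x y') _; rewrite subE subrr => Hx.
  apply: le_lt_trans (Hx _).
    have := ler_normc_Re (f (Complex x y') - f (Complex x y)); rewrite /Q.
    by case: (f (Complex x y')) => ? ?; case: (f (Complex x y)).
  rewrite /= expr0n add0r sqrtr_sqr.
  by near: y'; apply: cvgr_distC_lt.
(* The primitives start one unit before the square, so that they are differentiable on its closed
   sides, corners included. *)
have /choice[U UP] : forall y, exists F : R -> R, forall x, x0 - 1 < x -> is_derive x 1 F (P x y).
  by move=> y; exact: continuous_primitive (cP y).
have /choice[V VP] : forall x, exists F : R -> R, forall y, y0 - 1 < y -> is_derive y 1 F (Q x y).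
  by move=> x; exact: continuous_primitive (cQ x).
have xs : x0 < x0 + s by rewrite ltrDl.
have ys : y0 < y0 + s by rewrite ltrDl.
have dUV x y : x0 <= x <= x0 + s -> y0 <= y <= y0 + s ->
    is_derive x 1 (U y) (P x y) /\ is_derive y 1 (V x) (Q x y).
  by move=> hx hy; split; [apply: UP; lra|apply: VP; lra].
have := goursat_square s0 dUV dPQ; rewrite /circulation.
have dU y x : x0 <= x <= x0 + s -> is_derive x 1 (U y) (P x y) by move=> hx; apply: UP; lra.
have dV x y : y0 <= y <= y0 + s -> is_derive y 1 (V x) (Q x y) by move=> hx; apply: VP; lra.
have [c1 /hb h1 ->] := MVT_closed xs (dU y0).
have [c2 /hr h2 ->] := MVT_closed ys (dV (x0 + s)).
have [c3 /ht h3 ->] := MVT_closed xs (dU (y0 + s)).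
have [c4 /hl h4 ->] := MVT_closed ys (dV x0).
rewrite (_ : x0 + s - x0 = s); last by ring.
rewrite (_ : y0 + s - y0 = s); last by ring.
rewrite -mulrDl -2!mulrBl => /eqP; rewrite mulf_eq0 (gt_eqF s0) orbF => /eqP.
by move: h1 h2 h3 h4; rewrite -/(P _ _) -/(Q _ _) -/(P _ _) -/(Q _ _); lra.
Unshelve. all: by end_near.
Qed.

                                                                                               
                                                                                            
                                                                      
(** F = (g - 1)^2 / (w - z0) is entire, because g - 1 vanishes at z0. On the contour it differs from
    1 / (w - z0) by g (g - 2) / (w - z0), of modulus at most (1/5)(11/5) / r = 0.44 / r, while on
    each side the relevant real or imaginary part of 1 / (w - z0) is at least 1 / (2 r) in modulus.
    So F has the sign pattern excluded by [cdiff_no_circulation]. The bound c = 1/5 has to satisfy c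
    (2 + c) < 1/2. *)
Lemma square_not_small g z0 (r : R) : 0 < r -> (forall z, cdiff g z) -> g z0 = 1 ->
  (forall w, on_square z0 r w -> normc (g w) <= 5^-1) -> False.
Proof.
move=> r0 dg g1 H.
pose F w := (g w - 1) ^+ 2 / (w - z0).
have dg1 z : cdiff (fun w => g w - 1) z by apply: cdiffD (dg z) (cdiff_cst _ _).
have dF z : cdiff F z.
  have [->|zz0] := eqVneq z z0.
    by apply: (@cdiff_sqr_div R (fun w => g w - 1)) => //; rewrite g1 subrr.
  apply: cdiffM; first exact: cdiffX.
  apply: cdiffV; first by rewrite subr_eq0.
  by apply: cdiffD; [exact: cdiff_id|exact: cdiff_cst].
have near_inv w : on_square z0 r w -> normc (F w - (w - z0)^-1) <= 44 / 100 / r.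
  move=> /[dup] /(on_square_normc (ltW r0))/andP[rw _] /H gw.
  have -> : F w - (w - z0)^-1 = g w * (g w - 2) * (w - z0)^-1 by rewrite /F; ring.
  rewrite !Normc.normcM Normc.normcV.
  have n2 : normc (g w - 2) <= 5^-1 + 2.
    apply: le_trans (le_normcD _ _) _; rewrite normcN.
    by rewrite (_ : 2 = (2 : R)%:C%C) ?normc_real ?ger0_norm ?lerD2r// rmorph_nat.
  apply: (@le_trans _ _ (5^-1 * (5^-1 + 2) * r^-1)).
    apply: ler_pM; rewrite ?mulr_ge0 ?normc_ge0 ?invr_ge0 ?normc_ge0//.
      by apply: ler_pM; rewrite ?normc_ge0.
    by rewrite lef_pV2 ?posrE//; apply: lt_le_trans rw.
  by rewrite ler_pM2r ?invr_gt0//; lra.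
case: z0 @F g1 H dF near_inv => a b F g1 H dF near_inv.
pose s := r + r.
have s0 : 0 < s by rewrite addr_gt0.
have xE : a - r + s = a + r by rewrite /s; ring.
have yE : b - r + s = b + r by rewrite /s; ring.
have ge_half (t : R) : `|t| <= r -> (2 * r)^-1 <= r / (t ^+ 2 + r ^+ 2).
  move=> tr.
  have t2 : t ^+ 2 <= r ^+ 2 by rewrite -[t ^+ 2]real_normK ?num_real// ler_pXn2r// nnegrE// ltW.
  have p0 : 0 < t ^+ 2 + r ^+ 2 by rewrite ltr_wpDl ?sqr_ge0 ?exprn_gt0.
  rewrite ler_pdivlMr// ler_pdivrMl ?mulr_gt0//; lra.
have c44 : 44 / 100 / r < (2 * r)^-1.
  by rewrite invfM ltr_pM2r ?invr_gt0//; lra.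
apply: (@cdiff_no_circulation F dF (a - r) (b - r) s s0).
- move=> x; rewrite xE => hx.
  have hr : `|x - a| <= r by rewrite ler_norml; lra.
  have := near_inv (Complex x (b - r)) _.
  have E : b - r - b = - r by ring.
  rewrite /on_square /= E.
  rewrite normrN (gtr0_norm r0) => /(_ (conj (conj hr (lexx _)) (or_intror erefl))) /=.
  move/(le_trans (ler_normc_Im _)); case: (F _) => u v /=.
  rewrite ler_norml E sqrrN; have := ge_half _ hr; rewrite ?mulNr; lra.
- move=> y; rewrite xE yE => hy.
  have hr : `|y - b| <= r by rewrite ler_norml; lra.
  have := near_inv (Complex (a + r) y) _.
  have E : a + r - a = r by ring.
  rewrite /on_square /= E.
  rewrite (gtr0_norm r0) => /(_ (conj (conj (lexx _) hr) (or_introl erefl))) /=.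
  move/(le_trans (ler_normc_Re _)); case: (F _) => u v /=.
  rewrite ler_norml E; have := ge_half _ hr; rewrite [r ^+ 2 + _]addrC; lra.
- move=> x; rewrite xE yE => hx.
  have hr : `|x - a| <= r by rewrite ler_norml; lra.
  have := near_inv (Complex x (b + r)) _.
  have E : b + r - b = r by ring.
  rewrite /on_square /= E.
  rewrite (gtr0_norm r0) => /(_ (conj (conj hr (lexx _)) (or_intror erefl))) /=.
  move/(le_trans (ler_normc_Im _)); case: (F _) => u v /=.
  rewrite ler_norml E; have := ge_half _ hr; rewrite ?mulNr; lra.
- move=> y; rewrite yE => hy.
  have hr : `|y - b| <= r by rewrite ler_norml; lra.
  have := near_inv (Complex (a - r) y) _.
  have E : a - r - a = - r by ring.
  rewrite /on_square /= E.
  rewrite normrN (gtr0_norm r0) => /(_ (conj (conj (lexx _) hr) (or_introl erefl))) /=.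
  move/(le_trans (ler_normc_Re _)); case: (F _) => u v /=.
  rewrite ler_norml E sqrrN; have := ge_half _ hr; rewrite [r ^+ 2 + _]addrC ?mulNr; lra.
Qed.

(** The maximum principle up to a factor 5, by normalising g to the value 1 at z0. A fixed constant
    is harmless in the estimates that follow. *)
Lemma square_bound g z0 (r m : R) : 0 < r -> (forall z, cdiff g z) ->
  (forall w, on_square z0 r w -> normc (g w) <= m) -> normc (g z0) <= 5 * m.
Proof.
move=> r0 dg H; rewrite leNgt; apply/negP => lt.
have m0 : 0 <= m.
  have := H (z0 + r%:C%C) _; rewrite /on_square [z0 + _]addrC addrK /= normr0.
  rewrite (gtr0_norm r0) => /(_ (conj (conj (lexx _) (ltW r0)) (or_introl erefl))).
  by apply: le_trans; exact: normc_ge0.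
have A0 : 0 < normc (g z0) by apply: le_lt_trans lt; rewrite mulr_ge0.
apply: (@square_not_small (fun w => g w / g z0) z0 r r0) => [z||w /H gw].
- by apply: cdiffM (dg z) (cdiff_cst _ _).
- by rewrite divff// -normc_gt0.
- rewrite Normc.normcM Normc.normcV ler_pdivrMr//; lra.
Qed.

End MaximumPrinciple.

                                  

(** * Zero estimates and identity theorems *)

Section IdentityTheorem.
Variable R : realType.
Local Notation normc := (@Normc.normc R).
Implicit Types (f g h G : R[i] -> R[i]) (z w : R[i]) (s : seq R[i]) (r rho M : R).

Lemma cdiff_sqr_div_zeros h s : uniq s -> (forall z, cdiff h z) ->
  (forall a, a \in s -> h a = 0) ->
  forall z, cdiff (fun w => h w ^+ 2 / \prod_(a <- s) (w - a)) z.
Proof.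
move=> us dh hs z.
have dB (a : R[i]) : cdiff (fun w => w - a) z.
  by apply: cdiffD; [exact: cdiff_id|exact: cdiff_cst].
have [zs|zs] := boolP (z \in s); last first.
  apply: cdiffM; first exact: cdiffX.
  apply: cdiffV; last exact: cdiff_prod.
  rewrite prodf_seq_neq0; apply/allP => a sa /=.
  by rewrite subr_eq0; apply: contraNneq zs => ->.
rewrite (_ : (fun w => _) = fun w => (h w ^+ 2 / (w - z)) *
    (\prod_(a <- s | a != z) (w - a))^-1); last first.
  by apply/funext => w; rewrite (bigD1_seq z)//= invfM mulrA.
apply: cdiffM; first by apply: cdiff_sqr_div; [exact: hs|exact: dh].
apply: cdiffV; last exact: cdiff_prod.
rewrite prodf_seq_neq0; apply/allP => a sa /=.
by rewrite subr_eq0 eq_sym implybb.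
Qed.

Lemma prod_le_expr (T : eqType) (s : seq T) (F : T -> R) (c : R) :
  (forall a, a \in s -> 0 <= F a <= c) -> \prod_(a <- s) F a <= c ^+ size s.
Proof.
elim: s => [|x s IH] H; first by rewrite big_nil expr0.
have H' a : a \in s -> 0 <= F a <= c by move=> sa; apply: H; rewrite in_cons sa orbT.
have /andP[h1 h2] := H x (mem_head _ _).
rewrite big_cons exprS; apply: ler_pM => //; last exact: IH.
by rewrite big_seq prodr_ge0// => a /H'/andP[].
Qed.

Lemma prod_ge_expr (T : eqType) (s : seq T) (F : T -> R) (c : R) : 0 <= c ->
  (forall a, a \in s -> c <= F a) -> c ^+ size s <= \prod_(a <- s) F a.
Proof.
move=> c0; elim: s => [|x s IH] H; first by rewrite big_nil expr0.
rewrite big_cons exprS; apply: ler_pM => //.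
- exact: exprn_ge0.
- by apply: H; rewrite mem_head.
- by apply: IH => a sa; apply: H; rewrite in_cons sa orbT.
Qed.

(** A Jensen-type bound: [square_bound] is applied to h^2 / prod (w - a), where the square keeps the
    quotient entire. Each factor is at least r - rho on the contour and at most rho at z0, so every
    zero gains a factor rho / (r - rho). *)
Lemma zeros_estimate h s z0 r rho M : uniq s -> (forall z, cdiff h z) ->
  (forall a, a \in s -> h a = 0 /\ normc (z0 - a) <= rho) -> 0 < r -> rho < r ->
  (forall w, on_square z0 r w -> normc (h w) <= M) ->
  normc (h z0) ^+ 2 <= 5 * M ^+ 2 * (rho / (r - rho)) ^+ size s.
Proof.
move=> us dh hs r0 rr hM.
have rr0 : 0 < r - rho by rewrite subr_gt0.
have [zs|zs] := boolP (z0 \in s).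
  have [-> rho0] := hs _ zs; rewrite Normc.normc0 expr0n /=.
  apply: mulr_ge0; first by apply: mulr_ge0 => //; exact: sqr_ge0.
  rewrite exprn_ge0// divr_ge0 ?(ltW rr0)//.
  by apply: le_trans rho0; exact: normc_ge0.
have hs0 a : a \in s -> h a = 0 by case/hs.
have P0 : 0 < \prod_(a <- s) normc (z0 - a).
  rewrite big_seq prodr_gt0// => a sa.
  by rewrite normc_gt0 subr_eq0; apply: contraNneq zs => ->.
have lo w : on_square z0 r w -> (r - rho) ^+ size s <= \prod_(a <- s) normc (w - a).
  move=> /(on_square_normc (ltW r0))/andP[rw _].
  apply: prod_ge_expr => [|a sa]; first exact: ltW.
  have [_ ha] := hs _ sa.
  have := normc_subl (w - z0) (a - z0).
  by rewrite (normcB a) opprB addrA subrK; lra.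
have E (w : R[i]) : normc (h w ^+ 2 / \prod_(a <- s) (w - a)) =
    normc (h w) ^+ 2 / \prod_(a <- s) normc (w - a).
  by rewrite Normc.normcM Normc.normcV normcX normc_prod.
have : normc (h z0) ^+ 2 / \prod_(a <- s) normc (z0 - a)
     <= 5 * (M ^+ 2 / (r - rho) ^+ size s).
  rewrite -E; apply: (square_bound r0 (cdiff_sqr_div_zeros us dh hs0)) => w sw.
  rewrite E.
  have M0 : 0 <= M by apply: le_trans (hM _ sw); exact: normc_ge0.
  apply: ler_pM; rewrite ?sqr_ge0 ?invr_ge0 ?prodr_ge0//.
  - by move=> a _; exact: normc_ge0.
  - by rewrite ler_pXn2r// ?nnegrE ?normc_ge0// hM.
  - rewrite lef_pV2 ?posrE ?lo ?exprn_gt0//.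
    by apply: lt_le_trans (lo _ sw); rewrite exprn_gt0.
rewrite ler_pdivrMr// => /le_trans; apply.
set p := \prod_(a <- s) _; rewrite expr_div_n.
rewrite (_ : _ * p = 5 * M ^+ 2 * (p / (r - rho) ^+ size s)); last by ring.
apply: ler_wpM2l; first by apply: mulr_ge0 => //; exact: sqr_ge0.
apply: ler_wpM2r; first by rewrite invr_ge0 exprn_ge0// ltW.
apply: prod_le_expr => a sa.
by rewrite normc_ge0; case: (hs _ sa).
Qed.

Lemma cdiff_bounded h r : (forall z, cdiff h z) ->
  exists M, forall z, normc z <= r -> normc (h z) <= M.
Proof.
move=> dh.
have [r0|r0] := ltP r 0.
  by exists 0 => z zr; have := normc_ge0 z; lra.
pose K := (`[- r, r] `*` `[- r, r])%classic.
have cK : compact K by apply: compact_setX; exact: segment_compact.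
have K0 : K !=set0 by exists (0, 0); split => /=; rewrite in_itv /= oppr_le0 r0.
pose N (p : R * R) : R := - normc (h (Complex p.1 p.2)).
have cN : continuous N.
  move=> [p1 p2]; apply/cvgrPdist_lt => e e0.
  have [d d0 H] := cdiff_continuous (dh (Complex p1 p2)) e0.
  have d20 : 0 < d / 2 by rewrite divr_gt0.
  near=> q.
  rewrite /N opprK addrC.
  apply: (@le_lt_trans _ _ (normc (h (Complex q.1 q.2) - h (Complex p1 p2)))).
    rewrite ler_norml normc_subl andbT lerNl opprB normcB.
    exact: normc_subl.
  apply: H; apply: le_lt_trans (normc_le_ReIm _) _ => /=.
  rewrite (_ : d = d / 2 + d / 2); last by field.
  apply: ltrD.
    near: q; apply: (@cvgr_distC_lt R R _ (nbhs (p1, p2)) _ fst p1 _ _ d20).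
    exact: cvg_fst.
  near: q; apply: (@cvgr_distC_lt R R _ (nbhs (p1, p2)) _ snd p2 _ _ d20).
  exact: cvg_snd.
have [c _ Hc] := compact_EVT_min K0 cK (continuous_subspaceT cN).
exists (- N c) => -[x y] zr.
rewrite lerNr; apply: (Hc (x, y)); rewrite inE /K /=; split => /=.
  by rewrite in_itv /= -ler_norml; apply: le_trans zr; exact: ler_normc_Re (Complex x y).
by rewrite in_itv /= -ler_norml; apply: le_trans zr; exact: ler_normc_Im (Complex x y).
Unshelve. all: by end_near.
Qed.

Lemma half_geometric_small (c e : R) : 0 < e -> exists n, c * (1 / 2) ^+ n <= e.
Proof.
move=> e0; exists (`|Num.ceil (c / e)|)%N.
rewrite expr_div_n expr1n mul1r ler_pdivrMr ?exprn_gt0// -ler_pdivrMl// mulrC.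
apply: (@le_trans _ _ (`|Num.ceil (c / e)|)%:R).
  rewrite natr_absz; apply: le_trans (Num.Theory.ceil_ge _) _.
  by rewrite ler_int ler_norm.
by rewrite -natrX ler_nat ltnW// ltn_expl.
Qed.

Lemma infinite_real_points (S : set R) n : infinite_set S ->
  exists s : seq R[i], [/\ uniq s, size s = n & forall a, a \in s -> exists2 t, S t & a = t%:C%C].
Proof.
move=> /(infinite_set_fset n)[B BS nB].
exists (take n [seq t%:C%C | t <- finmap.enum_fset B]); split.
- by rewrite take_uniq// map_inj_uniq; [exact: finmap.fset_uniq|exact: complexI].
- by rewrite size_take size_map; case: ltngtP nB.
- by move=> a /mem_take/mapP[t tB ->]; exists t => //; exact: BS.
Qed.

(** With r = 3 rho' + 1 the ratio in [zeros_estimate] is at most 1/2, and S supplies n zeros for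
    every n while M stays the same. *)
Lemma entire_zeros h (S : set R) rho : (forall z, cdiff h z) -> infinite_set S ->
  (forall t, S t -> `|t| <= rho /\ h t%:C%C = 0) -> forall z, h z = 0.
Proof.
move=> dh iS hS z0.
pose rho' := `|rho| + normc z0.
have rho'0 : 0 <= rho' by rewrite addr_ge0 ?normc_ge0.
pose r := 3 * rho' + 1.
have r0 : 0 < r by rewrite /r; lra.
have [M hM] := cdiff_bounded (normc z0 + 2 * r) dh.
suff : normc (h z0) ^+ 2 <= 0.
  by rewrite le_eqVlt ltNge sqr_ge0 orbF sqrf_eq0 normc_eq0 => /eqP.
apply/ler_addgt0Pl => e e0; rewrite addr0.
have [n Hn] := half_geometric_small (5 * M ^+ 2) e0.
have [s [us sn sS]] := infinite_real_points n iS.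
apply: le_trans Hn.
apply: le_trans (@zeros_estimate h s z0 r rho' M us dh _ r0 _ _) _.
- move=> a /sS[t St ->]; have [tr ->] := hS _ St; split=> //.
  apply: le_trans (le_normcD _ _) _; rewrite normcN normc_real addrC lerD2r.
  by apply: le_trans tr _; exact: ler_norm.
- by rewrite /r; lra.
- move=> w /(on_square_normc (ltW r0))/andP[_ wr]; apply: hM.
  have := normc_subl w z0; lra.
rewrite sn; apply: ler_wpM2l; first by rewrite mulr_ge0 ?sqr_ge0.
have q0 : 0 <= rho' / (r - rho') by rewrite divr_ge0//; rewrite /r; lra.
have q1 : rho' / (r - rho') <= 1 / 2 by rewrite ler_pdivrMr; rewrite /r; lra.
by apply: lerXn2r; rewrite ?nnegrE.
Qed.

(** Lagrange's interpolant of G at the nodes s; subtracting it turns approximate zeros into exact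
    ones. *)
Definition lagrange G s z : R[i] :=
  \sum_(a <- s) G a * \prod_(b <- s | b != a) ((z - b) / (a - b)).

Lemma lagrange_at G s z : uniq s -> z \in s -> lagrange G s z = G z.
Proof.
move=> us zs; rewrite /lagrange (bigD1_seq z)//= [X in _ * X]big1 ?mulr1.
  rewrite big1_seq ?addr0// => a /andP[az sa].
  apply/eqP; rewrite mulf_eq0 prodf_seq_eq0; apply/orP; right.
  by apply/hasP; exists z; rewrite // eq_sym az subrr mul0r eqxx.
by move=> b bz; rewrite divff// subr_eq0 eq_sym.
Qed.

Lemma cdiff_lagrange G s z : cdiff (lagrange G s) z.
Proof.
apply: cdiff_sum => a; apply: cdiffM; first exact: cdiff_cst.
apply: cdiff_prod => b; apply: cdiffM; last exact: cdiff_cst.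
by apply: cdiffD; [exact: cdiff_id|exact: cdiff_cst].
Qed.

Lemma lagrange_bound s r : exists2 K : R, 0 <= K & forall G (d : R) z, normc z <= r ->
  (forall a, a \in s -> normc (G a) <= d) -> normc (lagrange G s z) <= K * d.
Proof.
exists (\sum_(a <- s) \prod_(b <- s | b != a) ((`|r| + normc b) / normc (a - b))).
  apply: sumr_ge0 => a _; apply: prodr_ge0 => b _.
  by rewrite divr_ge0 ?addr_ge0 ?normc_ge0.
move=> G d z zr Gd; rewrite mulr_suml; apply: le_trans (ler_normc_sum _ _ _) _.
rewrite big_seq [leRHS]big_seq; apply: ler_sum => a sa.
rewrite Normc.normcM mulrC; apply: ler_pM; rewrite ?normc_ge0 ?Gd//.
rewrite normc_prod; apply: ler_prod => b _; rewrite normc_ge0/=.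
rewrite Normc.normcM Normc.normcV ler_wpM2r ?invr_ge0 ?normc_ge0//.
apply: le_trans (le_normcD _ _) _; rewrite normcN lerD2r.
by apply: le_trans zr _; exact: ler_norm.
Qed.

                                                                                                
                                     
(** On the reals u is a pointwise limit of entire functions whose bound on each disc does not depend
    on the precision. Approximation on finite sets [F] follows from pointwise convergence, and it
    spares a normal family argument: no limit function on the complex plane has to be built. *)
Definition entire_limit (u : R -> R) := forall r, exists M, forall (F : seq R) (e : R), 0 < e ->
  exists G, [/\ forall z, cdiff G z, forall z, normc z <= r -> normc (G z) <= M &
    forall t, t \in F -> normc (G t%:C%C - (u t)%:C%C) <= e].

(** An approximant G minus m is small, not zero, at n chosen points of S. Subtracting its Lagrange
    interpolant, which is small too, creates exact zeros, and [zeros_estimate] bounds the result at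
    t by a multiple of 2^-n that is independent of G. *)
Lemma entire_limit_eqcst (u : R -> R) (S : set R) rho m : entire_limit u ->
  infinite_set S -> (forall t, S t -> `|t| <= rho /\ u t = m) -> forall t, u t = m.
Proof.
move=> uL iS hS t.
pose rho' := `|rho| + `|t|.
have rho'0 : 0 <= rho' by rewrite addr_ge0.
pose r := 3 * rho' + 1.
have r0 : 0 < r by rewrite /r; lra.
pose r' := `|t| + 2 * r.
have [M hM] := uL r'.
pose M' := M + `|m| + 1.
apply/eqP; rewrite -subr_eq0 -normr_le0; apply/ler_addgt0Pl => e e0; rewrite addr0.
have e20 : 0 < (e / 2) ^+ 2 by rewrite exprn_gt0// divr_gt0.
have [n Hn] := half_geometric_small (5 * M' ^+ 2) e20.
have [s [us sn sS]] := infinite_real_points n iS.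
have [K K0 HK] := lagrange_bound s r'.
(* K depends on the nodes and the disc, not on G, so the precision d may be chosen after it:
   [(K + 1) * d <= 1] keeps the function below [M'], and [(K + 1) * d <= e / 2] bounds the
   interpolant and the error at t together. *)
pose d := Num.min 1 (e / 2) / (K + 1).
have K1 : 0 < K + 1 by lra.
have d0 : 0 < d by rewrite divr_gt0// lt_min ltr01 divr_gt0.
have dK : (K + 1) * d = Num.min 1 (e / 2) by rewrite /d mulrC divfK// gt_eqF.
have dK1 : (K + 1) * d <= 1 by rewrite dK ge_min lexx.
have dK2 : (K + 1) * d <= e / 2 by rewrite dK ge_min lexx orbT.
have Kd : K * d <= (K + 1) * d by rewrite ler_wpM2r ?(ltW d0)// lerDl.
have [G [dG GM Gd]] := hM (t :: [seq complex.Re a | a <- s]) d d0.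
pose G1 z := G z - m%:C%C.
have dG1 z : cdiff G1 z by apply: cdiffD; [exact: dG|exact: cdiff_cst].
have G1s a : a \in s -> normc (G1 a) <= d.
  move=> sa; have [x Sx aE] := sS _ sa.
  have := Gd x; rewrite in_cons (_ : x \in map _ _) ?orbT; last first.
    by apply/mapP; exists a => //; rewrite aE.
  by move=> /(_ isT); have [_ ->] := hS _ Sx; rewrite /G1 aE.
have t'r : normc t%:C%C <= r' by rewrite normc_real /r'; lra.
pose h z := G1 z - lagrange G1 s z.
have dh z : cdiff h z.
  rewrite (_ : h = fun w => G1 w + (-1) * lagrange G1 s w); last first.
    by apply/funext => w; rewrite mulN1r.
  apply: cdiffD => //; apply: cdiffM; first exact: cdiff_cst.
  exact: cdiff_lagrange.
have : normc (h t%:C%C) ^+ 2 <= 5 * M' ^+ 2 * (rho' / (r - rho')) ^+ size s.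
  apply: (zeros_estimate us dh _ r0); first 2 last.
  - move=> w /(on_square_normc (ltW r0))/andP[_ wr].
    have wr' : normc w <= r'.
      by have := normc_subl w t%:C%C; rewrite normc_real /r'; lra.
    apply: le_trans (le_normcD _ _) _; rewrite normcN.
    have h1 : normc (G1 w) <= M + `|m|.
      by apply: le_trans (le_normcD _ _) _; rewrite normcN normc_real lerD2r GM.
    have h2 := HK G1 d w wr' G1s.
    by rewrite /M'; lra.
  - move=> a sa; rewrite /h lagrange_at// subrr; split=> //.
    have [x Sx ->] := sS _ sa; have [xr _] := hS _ Sx.
    apply: le_trans (le_normcD _ _) _; rewrite normcN !normc_real addrC lerD2r.
    by apply: le_trans xr _; exact: ler_norm.
  - by rewrite /r; lra.
move=> /le_trans H; have {H} : normc (h t%:C%C) ^+ 2 <= (e / 2) ^+ 2.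
  apply: H; rewrite sn.
  apply: le_trans Hn; apply: ler_wpM2l; first by apply: mulr_ge0 => //; exact: sqr_ge0.
  have q0 : 0 <= rho' / (r - rho') by rewrite divr_ge0//; rewrite /r; lra.
  have q1 : rho' / (r - rho') <= 1 / 2 by rewrite ler_pdivrMr; rewrite /r; lra.
  by apply: lerXn2r; rewrite ?nnegrE.
rewrite ler_pXn2r ?nnegrE ?normc_ge0 ?divr_ge0 ?(ltW e0)// => hE.
have h2 := HK G1 d _ t'r G1s.
have h3 := Gd t (mem_head _ _).
have -> : `|u t - m| = normc ((u t)%:C%C - G t%:C%C + (h t%:C%C + lagrange G1 s t%:C%C)).
  rewrite -normc_real; congr normc; rewrite /h /G1 rmorphB /=; ring.
apply: le_trans (le_normcD _ _) _; rewrite normcB.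
have := le_normcD (h t%:C%C) (lagrange G1 s t%:C%C); lra.
Qed.

(** [zeros_estimate] with the single zero t of G - G(t) gives |u t' - u t|^2 <= 40 M^2 |t' - t| for
    t' near t, a bound in which the approximant G no longer occurs. *)
Lemma entire_limit_continuous (u : R -> R) : entire_limit u -> continuous u.
Proof.
move=> uL t.
have [M hM] := uL (`|t| + 3).
have M0 : 0 <= M.
  have [G [_ H _]] := hM [::] 1 ltr01.
  by apply: le_trans (H 0 _); [exact: normc_ge0|rewrite Normc.normc0 addr_ge0].
have key t' : `|t' - t| <= 1 / 2 -> `|u t' - u t| ^+ 2 <= 40 * M ^+ 2 * `|t' - t|.
  move=> tt'.
  pose q := Num.sqrt (40 * M ^+ 2 * `|t' - t|).
  have q2 : q ^+ 2 = 40 * M ^+ 2 * `|t' - t|.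
    by rewrite sqr_sqrtr// mulr_ge0// mulr_ge0// sqr_ge0.
  rewrite -q2 ler_pXn2r ?nnegrE// ?sqrtr_ge0//.
  apply/ler_addgt0Pl => e e0.
  have e20 : 0 < e / 2 by rewrite divr_gt0.
  have [G [dG GM Gd]] := hM [:: t; t'] _ e20.
  pose h z := G z - G t%:C%C.
  have dh z : cdiff h z by apply: cdiffD; [exact: dG|exact: cdiff_cst].
  have : normc (h t'%:C%C) ^+ 2 <= 5 * (2 * M) ^+ 2 * (`|t' - t| / (1 - `|t' - t|)) ^+ 1.
    apply: (@zeros_estimate h [:: t%:C%C] t'%:C%C 1 `|t' - t|) => //.
    - by move=> a; rewrite inE => /eqP ->; rewrite /h subrr -rmorphB normc_real.
    - lra.
    - move=> w /(on_square_normc ler01)/andP[_ wr].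
      have t't : `|t'| <= `|t| + 1 / 2.
        by have := ler_normD t (t' - t); rewrite addrC subrK; lra.
      apply: le_trans (le_normcD _ _) _; rewrite normcN mulr_natl mulr2n lerD// GM//.
        by have := normc_subl w t'%:C%C; rewrite normc_real; lra.
      by rewrite normc_real; lra.
  move=> /le_trans H; have {H} : normc (h t'%:C%C) ^+ 2 <= q ^+ 2.
    apply: H; rewrite expr1 q2 (_ : 40 * M ^+ 2 * `|t' - t| = 5 * (2 * M) ^+ 2 * (2 * `|t' - t|)); last by ring.
    apply: ler_wpM2l; first by apply: mulr_ge0 => //; exact: sqr_ge0.
    rewrite ler_pdivrMr; last lra.
    by rewrite -[leLHS]mul1r mulrAC; apply: ler_wpM2r => //; lra.
  rewrite ler_pXn2r ?nnegrE ?normc_ge0 ?sqrtr_ge0// => hq.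
  have h1 := Gd t (mem_head _ _).
  have h2 : normc (G t'%:C%C - (u t')%:C%C) <= e / 2.
    by apply: Gd; rewrite !inE eqxx orbT.
  have -> : `|u t' - u t| = normc ((u t')%:C%C - G t'%:C%C + (h t'%:C%C + (G t%:C%C - (u t)%:C%C))).
    rewrite -normc_real; congr normc; rewrite /h rmorphB /=; ring.
  apply: le_trans (le_normcD _ _) _; rewrite normcB.
  have := le_normcD (h t'%:C%C) (G t%:C%C - (u t)%:C%C); lra.
apply/cvgrPdist_lt => e e0; near=> t'; rewrite distrC.
have d1 : `|t' - t| < 1 / 2 by near: t'; apply: cvgr_distC_lt => //; lra.
have d2 : `|t' - t| < e ^+ 2 / (40 * M ^+ 2 + 1).
  near: t'; apply: cvgr_distC_lt => //; rewrite divr_gt0 ?exprn_gt0//.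
  by rewrite ltr_wpDl// mulr_ge0// sqr_ge0.
rewrite -(@ltr_pXn2r _ 2)// ?nnegrE ?(ltW e0)//.
apply: le_lt_trans (key _ (ltW d1)) _.
have c0 : 0 <= 40 * M ^+ 2 by rewrite mulr_ge0// sqr_ge0.
move: d2; rewrite ltr_pdivlMr; last lra.
by apply: le_lt_trans; rewrite mulrC ler_wpM2l//; lra.
Unshelve. all: by end_near.
Qed.

Lemma entire_limit_entire h (u : R -> R) : (forall z, cdiff h z) ->
  (forall t, h t%:C%C = (u t)%:C%C) -> entire_limit u.
Proof.
move=> dh hu r; have [M hM] := cdiff_bounded r dh.
exists M => F e e0; exists h; split => // t _.
by rewrite hu subrr Normc.normc0 ltW.
Qed.

End IdentityTheorem.

                              

(** * The transfer operator and its minimum principle *)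

Section TransferOperator.
Variable R : realType.
Local Notation normc := (@Normc.normc R).
Local Notation expi := (@expi2pi R).

Lemma conjcM (z w : R[i]) : conjc (z * w) = conjc z * conjc w.
Proof. exact: rmorphM. Qed.

Lemma expi2piD (x y : R) : expi (x + y) = expi x * expi y.
Proof. by rewrite /expi2pi mulrDr cosD sinD; congr Complex; rewrite addrC. Qed.

Lemma expi2pi0 : expi 0 = 1.
Proof. by rewrite /expi2pi mulr0 cos0 sin0. Qed.

Lemma conjc_expi2pi (x : R) : conjc (expi x) = expi (- x).
Proof. by rewrite /expi2pi mulrN cosN sinN. Qed.

Lemma normc_expi2pi (x : R) : normc (expi x) = 1.
Proof. by rewrite /= cos2Dsin2 sqrtr1. Qed.

Lemma expi2pi_int (n : int) : expi n%:~R = 1.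
Proof.
have e1 : expi 1 = 1 by rewrite /expi2pi mulr1 mulr_natl mulr2n cosDpi sinDpi cospi sinpi opprK oppr0.
have en (k : nat) : expi k%:R = 1.
  by elim: k => [|k IH]; rewrite ?expi2pi0// -natr1 expi2piD IH e1 mulr1.
case: n => n; first exact: en.
by rewrite NegzE mulrNz -conjc_expi2pi en conjc1.
Qed.

Variables (Rr : int) (B L : seq int) (alpha : int -> R[i]).
Hypothesis Rr2 : 2 <= `|Rr|.
Hypothesis B0 : 0 \in B.
Hypothesis uB : uniq B.
Hypothesis uL : uniq L.
Hypothesis ortho : orthonormal_columns Rr B L alpha.

Local Notation Rz := (Rr%:~R : R).
Local Notation N := ((size B)%:R : R).

Lemma normr_base : 2 <= `|Rz|.
Proof. by rewrite -intr_norm -[2]/(2%:~R) ler_int. Qed.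

Lemma base_neq0 : Rz != 0.
Proof. by rewrite -normr_gt0; have := normr_base; lra. Qed.

Lemma size_digits_gt0 : 0 < N.
Proof. by rewrite ltr0n; case: B B0. Qed.

(** Orthonormal columns make the matrix, conjugated or not, an isometry from functions on B to
    functions on L. Both [sum_weight] and [Vop_parseval] are instances. *)
Lemma columns_parseval (a : int -> R[i]) :
  \sum_(l <- L) normc (\sum_(b <- B) a b * conjc (hadamard_entry Rr B alpha l b)) ^+ 2 =
  \sum_(b <- B) normc (a b) ^+ 2.
Proof.
apply: (@complexI R); rewrite !rmorph_sum /=.
have nE (z : R[i]) : ((normc z ^+ 2)%:C)%C = z * conjc z.
  by rewrite rmorphXn /= -sqr_normc.
have cM (x y : R[i]) : conjc (x * conjc y) = conjc x * y by rewrite rmorphM /= conjcK.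
under eq_bigr do rewrite nE rmorph_sum /= big_distrlr /=.
rewrite exchange_big /=; under eq_bigr do rewrite exchange_big /=.
under [RHS]eq_bigr do rewrite nE.
apply: eq_big_seq => b bB; rewrite (bigD1_seq b)//= [X in _ + X]big1_seq ?addr0.
  rewrite -[RHS]mulr1 -(_ : \sum_(l <- L) conjc (hadamard_entry Rr B alpha l b) * hadamard_entry Rr B alpha l b = 1).
    rewrite mulr_sumr; apply: eq_bigr => l _; by rewrite cM mulrACA.
  by rewrite ortho// eqxx.
move=> b' /andP[b'b b'B].
have := ortho bB b'B; rewrite eq_sym (negbTE b'b) mulr0n => E.
rewrite -[RHS](mulr0 (a b * conjc (a b'))) -[X in _ = _ * X]E mulr_sumr; apply: eq_bigr => l _.
by rewrite cM mulrACA.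
Qed.

Definition weight (l : int) (t : R) : R := normc (alpha l) ^+ 2 * normc (mB B (gmap Rr l t)) ^+ 2.

Lemma weight_ge0 l t : 0 <= weight l t.
Proof. by rewrite mulr_ge0// sqr_ge0. Qed.

(** The entire function e^{2 pi i z}, written as modulus times phase. *)
Definition cexpi (z : R[i]) : R[i] := (expR (- (2 * pi * complex.Im z)))%:C%C * expi (complex.Re z).

Lemma cexpi_real (t : R) : cexpi t%:C%C = expi t.
Proof. by rewrite /cexpi /= mulr0 oppr0 expR0 mul1r. Qed.

Lemma cexpiD z w : cexpi (z + w) = cexpi z * cexpi w.
Proof.
case: z w => x y [x' y'] /=; rewrite /cexpi /= expi2piD mulrDr opprD expRD rmorphM /=.
by rewrite mulrACA.
Qed.

Lemma conjc_cexpi z : conjc (cexpi z) = cexpi (- conjc z).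
Proof. by rewrite /cexpi conjcM conjc_expi2pi conjc_real; case: z => x y; rewrite /= opprK. Qed.

Lemma normc_cexpi z : normc (cexpi z) = expR (- (2 * pi * complex.Im z)).
Proof. by rewrite Normc.normcM normc_expi2pi mulr1 normc_real ger0_norm// expR_ge0. Qed.

Lemma is_derive_small (f : R -> R) (x d : R) : is_derive x 1 f d ->
  forall e, 0 < e -> exists2 r, 0 < r & forall y, `|y| < r ->
    `|f (y + x) - f x - d * y| <= e * `|y|.
Proof.
move=> [df dE] e e0.
have := df; rewrite /derivable => H.
have {}H : (fun h => h^-1 *: (f (h *: 1 + x) - f x)) @ 0^' --> d by rewrite -dE; exact: H.
have /cvgrPdist_lt/(_ _ e0)/nbhs_ballP[r /= r0 rH] := H.
exists r => // y yr.
have [->|y0] := eqVneq y 0; first by rewrite add0r subrr mulr0 subrr normr0 mulr0.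
have := rH y; rewrite /ball /= sub0r normrN => /(_ yr y0) /ltW.
rewrite /GRing.scale /= mulr1 => h.
rewrite (_ : f (y + x) - f x - d * y = - (d - y^-1 * (f (y + x) - f x)) * y); last by field.
by rewrite normrM normrN ler_wpM2r.
Qed.

(** The first-order expansion at 0 is assembled from those of the real exponential, sine and cosine;
    the addition formula then moves it to every point. *)
Lemma cdiff_cexpi0 : exists phi, ccont phi 0 /\ forall w, cexpi w = 1 + phi w * w.
Proof.
pose c : R[i] := Complex 0 (2 * pi).
exists (fun w => if w == 0 then c else (cexpi w - 1) / w); split; last first.
  move=> w; case: ifPn => [/eqP ->|w0]; last by rewrite divfK// addrC subrK.
  by rewrite -[0]/(0%:C)%C cexpi_real expi2pi0 mulr0 addr0.
have expd : is_derive (0 : R) 1 expR 1 by have := is_derive_expR (0 : R); rewrite expR0.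
have sind : is_derive (0 : R) 1 sin 1 by have := is_derive_sin (0 : R); rewrite cos0.
have cosd : is_derive (0 : R) 1 cos 0 by have := is_derive_cos (0 : R); rewrite sin0 oppr0.
move=> e e0; rewrite eqxx.
have p0 : 0 < 2 * pi :> R by rewrite mulr_gt0// pi_gt0.
(* k is the relative error allowed in each of the three real expansions. The total error is at most
   8 k (2 pi |w|), and 16 k (2 pi) <= e makes the final inequality strict. *)
pose k := Num.min 1 (e / (32 * pi)).
have k0 : 0 < k by rewrite lt_min ltr01 divr_gt0// mulr_gt0// pi_gt0.
have k1 : k <= 1 by rewrite ge_min lexx.
have ke : 16 * (k * (2 * pi)) <= e.
  have : k <= e / (32 * pi) by rewrite ge_min lexx orbT.
  by rewrite ler_pdivlMr ?mulr_gt0 ?pi_gt0//; lra.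
have [r1 r10 H1] := is_derive_small expd k0.
have [r2 r20 H2] := is_derive_small sind k0.
have [r3 r30 H3] := is_derive_small cosd k0.
pose r := Num.min (Num.min r1 r2) (Num.min r3 (k / 2)).
have r0 : 0 < r by rewrite !lt_min r10 r20 r30 divr_gt0.
exists (r / (2 * pi)); first by rewrite divr_gt0.
move=> w; rewrite subr0 ltr_pdivlMr// => wr.
case: ifPn => [_|w0]; first by rewrite subrr Normc.normc0.
have nw : 0 < normc w by rewrite normc_gt0.
rewrite (_ : (cexpi w - 1) / w - c = (cexpi w - 1 - c * w) / w); last by field.
rewrite Normc.normcM Normc.normcV ltr_pdivrMr//.
suff : normc (cexpi w - 1 - c * w) <= 8 * k * (2 * pi) * normc w.
  move/le_lt_trans; apply; rewrite ltr_pM2r//.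
  have : 0 < k * (2 * pi) by rewrite mulr_gt0. 
  lra.
have hy := ler_normc_Im w; have hx := ler_normc_Re w.
pose n := normc w; pose x := complex.Re w; pose y := complex.Im w.
rewrite -/n -/x -/y in nw wr hx hy *.
pose a := 2 * pi * x; pose b := - (2 * pi * y).
have ha : `|a| <= 2 * pi * n by rewrite normrM (gtr0_norm p0) ler_pM2l.
have hb : `|b| <= 2 * pi * n by rewrite normrN normrM (gtr0_norm p0) ler_pM2l.
have nr : 2 * pi * n < r by rewrite mulrC.
have := H1 b; have := H2 a; have := H3 a; rewrite !addr0 cos0 sin0 expR0 !mul1r mul0r !subr0.
move: nr; rewrite !lt_min => /andP[/andP[n1 n2] /andP[n3 n4]].
move=> /(_ (le_lt_trans ha n3)) h3 /(_ (le_lt_trans ha n2)) h2 /(_ (le_lt_trans hb n1)) h1.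
apply: le_trans (normc_le_ReIm _) _.
have -> : complex.Re (cexpi w - 1 - c * w) = expR b * cos a - 1 - b.
  by rewrite /a /b /x /y; case: (w) => ? ?; rewrite /= mul0r !subr0 mul0r sub0r opprK; ring.
have -> : complex.Im (cexpi w - 1 - c * w) = expR b * sin a - a.
  by rewrite /a /b /x /y; case: (w) => ? ?; rewrite /=; ring.
set m := 2 * pi * n in ha hb n1 n2 n3 n4 *.
have m0 : 0 < m by rewrite mulr_gt0.
have E2 : `|expR b| <= 2.
  have := ler_normD (expR b - 1 - b) (1 + b); rewrite (_ : expR b - 1 - b + (1 + b) = expR b); last by ring.
  have := ler_normD 1 b; rewrite normr1.
  have : k * `|b| <= 1 * `|b| by rewrite ler_wpM2r.
  lra.
have kab (t : R) : `|t| <= m -> k * `|t| <= k * m by move=> ?; rewrite ler_pM2l.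
have ka := kab _ ha; have kb := kab _ hb.
have re : `|expR b * cos a - 1 - b| <= 3 * (k * m).
  rewrite (_ : _ - b = expR b * (cos a - 1) + (expR b - 1 - b)); last by ring.
  apply: le_trans (ler_normD _ _) _; rewrite normrM.
  have : `|expR b| * `|cos a - 1| <= 2 * (k * m) by apply: ler_pM => //; lra.
  lra.
have im : `|expR b * sin a - a| <= 3 * (k * m).
  rewrite (_ : _ - a = expR b * (sin a - a) + (expR b - 1) * a); last by ring.
  apply: le_trans (ler_normD _ _) _; rewrite 2!normrM.
  have h4 : `|expR b| * `|sin a - a| <= 2 * (k * m) by apply: ler_pM => //; lra.
  have h5 : `|expR b - 1| <= 2 * m.
    have := ler_normD (expR b - 1 - b) b; rewrite subrK.
    have : k * m <= 1 * m by rewrite ler_pM2r.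
    lra.
  have h6 : `|expR b - 1| * `|a| <= k * m.
    rewrite (_ : k * m = 2 * m * (k / 2)); last by field.
    by apply: ler_pM => //; apply: le_trans ha _; lra.
  apply: le_trans (lerD h4 h6) _; by rewrite le_eqVlt; apply/orP; left; apply/eqP; ring.
rewrite (_ : 8 * k * (2 * pi) * n = 8 * (k * m)); last by rewrite /m; ring.
have : 0 < k * m by rewrite mulr_gt0.
lra.
Qed.

Lemma cdiff_cexpi z : cdiff cexpi z.
Proof.
have [phi [cphi H]] := cdiff_cexpi0.
exists (fun w => cexpi z * phi (w - z)); split.
  apply: ccontM; first exact: ccont_cst.
  apply: (@ccont_comp R phi (fun w => w - z)); first by rewrite subrr.
  by apply: ccontD; [exact: ccont_id|exact: ccont_cst].
move=> w; have {1}-> : w = z + (w - z) by rewrite addrC subrK.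
by rewrite cexpiD (H (w - z)) mulrDr mulr1 mulrA.
Qed.

Definition mBC (z : R[i]) : R[i] := ((size B)%:R)^-1 * \sum_(b <- B) cexpi (b%:~R * z).

Definition gmapC (l : int) (z : R[i]) : R[i] := (z - l%:~R) / Rr%:~R.

Lemma mBC_real (t : R) : mBC t%:C%C = mB B t.
Proof.
rewrite /mBC /mB; congr (_ * _); apply: eq_bigr => b _.
by rewrite -(rmorph_int (real_complex R)) -rmorphM cexpi_real.
Qed.

Lemma gmapC_real l (t : R) : gmapC l t%:C%C = (gmap Rr l t)%:C%C.
Proof. by rewrite /gmapC /gmap rmorphM rmorphB fmorphV !rmorph_int. Qed.

(** This exhibits the left side as coordinate l of the conjugated matrix applied to the vector with
    entries e^{2 pi i b z / R} / sqrt N. Summing squared moduli over l by [columns_parseval] gives 1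
    on the real axis and a growth bound off it. *)
Lemma mBC_gmapC l z : conjc (alpha l) * mBC (gmapC l z) =
  \sum_(b <- B) ((Num.sqrt N)^-1)%:C%C * cexpi (b%:~R * z / Rr%:~R)
      * conjc (hadamard_entry Rr B alpha l b).
Proof.
rewrite /mBC /gmapC mulrCA mulrA mulr_sumr; apply: eq_bigr => b _.
have -> : b%:~R * ((z - l%:~R) / Rr%:~R) =
    b%:~R * z / Rr%:~R + (- ((l * b)%:~R / Rz))%:C%C.
  rewrite rmorphN rmorphM fmorphV !rmorph_int rmorphM /=; ring.
rewrite cexpiD cexpi_real /hadamard_entry !conjcM conjc_expi2pi conjc_real.
have -> : ((size B)%:R)^-1 = ((Num.sqrt N)^-1)%:C%C * ((Num.sqrt N)^-1)%:C%C :> R[i].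
  rewrite -rmorphM /= -invfM -expr2 sqr_sqrtr ?ler0n//.
  by rewrite fmorphV rmorph_nat.
ring.
Qed.

Lemma sum_mBC z : \sum_(l <- L) normc (alpha l) ^+ 2 * normc (mBC (gmapC l z)) ^+ 2 =
  N^-1 * \sum_(b <- B) expR (- (2 * pi * complex.Im (b%:~R * z / Rr%:~R))) ^+ 2.
Proof.
under eq_bigr do rewrite -exprMn -(normc_conjc (alpha _)) -Normc.normcM mBC_gmapC.
rewrite columns_parseval mulr_sumr; apply: eq_bigr => b _.
rewrite Normc.normcM normc_cexpi normc_real exprMn; congr (_ * _).
by rewrite real_normK ?num_real// exprVn sqr_sqrtr ?ler0n.
Qed.

Lemma sum_weight t : \sum_(l <- L) weight l t = 1.
Proof.
rewrite /weight; under eq_bigr do rewrite -mBC_real -gmapC_real.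
rewrite sum_mBC (eq_bigr (fun=> 1)) => [|b _]; last first.
  rewrite -!(rmorph_int (real_complex R)) -fmorphV -!rmorphM /=.
  by rewrite mulr0 oppr0 expR0 expr1n.
by rewrite big_const_seq count_predT iter_addr_0 mulVf// gt_eqF// size_digits_gt0.
Qed.

(** Descent on the length of a list covering the set: a set that is not minimal has a smaller
    invariant subset, which misses some point, and this point is removed from the list. *)
Lemma minimal_invariant_sub (Z : set R) : finite_set Z -> Z !=set0 ->
  invariant_set Rr B L alpha Z ->
  exists2 M, M `<=` Z & finite_minimal_invariant Rr B L alpha M.
Proof.
move=> fZ.
have [s sZ] : exists s : seq R, forall x, Z x -> x \in s.
  by move/finite_seqP: fZ => [s ->]; exists s.
elim: {s}(size s) {-2}s (leqnn (size s)) Z fZ sZ => [|n IH] s sn Z fZ sZ Z0 iZ.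
  case: Z0 => x /sZ; case: s sn sZ => //.
have [min|] := pselect (forall M' : set R, M' `<=` Z -> M' !=set0 ->
    invariant_set Rr B L alpha M' -> M' = Z); first by exists Z.
move/existsNP => [M /not_implyP[MZ /not_implyP[M0 /not_implyP[iM MneZ]]]].
have [x [Zx Mx]] : exists x, Z x /\ ~ M x.
  apply: contrapT => H; apply: MneZ; apply/seteqP; split => // x Zx.
  by apply: contrapT => Mx; apply: H; exists x.
have xs := sZ _ Zx.
have s'n : (size (seq.filter (predC1 x) s) <= n)%N.
  rewrite size_filter -ltnS; apply: leq_trans sn.
  rewrite -(count_predC (pred1 x) s) -add1n leq_add2r.
  by rewrite -has_count; apply/hasP; exists x => /=.
have s'M y : M y -> y \in seq.filter (predC1 x) s.
  move=> My; rewrite mem_filter sZ ?andbT /=; last exact: MZ.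
  by apply/eqP => yx; apply: Mx; rewrite -yx.
have [M1 M1M ?] := IH _ s'n M (sub_finite_set MZ fZ) s'M M0 iM.
by exists M1 => // y /M1M /MZ.
Qed.

Lemma infinite_segment (r : R) : 1 <= r -> infinite_set [set t : R | `|t| <= r].
Proof.
move=> r1 fI; apply: infinite_nat.
pose f (n : nat) : R := n.+1%:R^-1.
have -> : [set: nat] = f @^-1` [set t : R | `|t| <= r].
  apply/seteqP; split => // n _ /=; rewrite /f ger0_norm ?invr_ge0//.
  by apply: le_trans r1; rewrite invf_le1// ler1n.
apply: finite_preimage fI => m n _ _ /invr_inj/eqP.
by rewrite eqr_nat => /eqP[].
Qed.

Definition transfer_fixed (u : R -> R) :=
  forall t, \sum_(l <- L) weight l t * u (gmap Rr l t) = u t.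

(** Any r >= max |l| gives an interval stable under all g_l, since (r + |l|) / |R| <= r when |R| >=
    2. The added 1 keeps the interval nondegenerate. *)
Definition attr_radius : R := 1 + \sum_(l <- L) `|l%:~R|.

Lemma attr_radius_ge1 : 1 <= attr_radius.
Proof. by rewrite lerDl sumr_ge0. Qed.

Lemma gmap_attr l t : l \in L -> `|t| <= attr_radius -> `|gmap Rr l t| <= attr_radius.
Proof.
move=> lL tr; rewrite /gmap normrM normfV.
have R2 := normr_base.
rewrite ler_pdivrMr; last lra.
have l1 : `|l%:~R : R| <= attr_radius.
  rewrite /attr_radius (bigD1_seq l)//= addrCA lerDl addr_ge0// sumr_ge0//.
apply: le_trans (ler_normB _ _) _.
have : attr_radius * 2 <= attr_radius * `|Rz|.
  by rewrite ler_pM2l//; have := attr_radius_ge1; lra.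
lra.
Qed.

                                                                                   
(** The minimum principle. Assuming [entire_limit] instead of analyticity of u itself lets it serve
    both for the entire h of the theorem and for the limit of the frame sums. *)
Lemma transfer_fixed_eq1 (u : R -> R) :
  (forall M : set R, finite_minimal_invariant Rr B L alpha M -> M = [set 0]) ->
  entire_limit u -> transfer_fixed u -> u 0 = 1 -> (forall t, u t <= 1) ->
  forall t, u t = 1.
Proof.
move=> minM uL' uT u0 u1.
have cu := entire_limit_continuous uL'.
have r1 := attr_radius_ge1.
pose I := `[- attr_radius, attr_radius]%classic.
have inI t : I t <-> `|t| <= attr_radius by rewrite /I /= in_itv /= ler_norml.
have [|c cI cmin] := @EVT_min R u (- attr_radius) attr_radius _ (continuous_subspaceT cu).
  lra.
have iI : infinite_set I.
  have -> : I = [set t | `|t| <= attr_radius] by apply/seteqP; split=> t /inI.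
  exact: infinite_segment.
pose Z := [set t | I t /\ u t = u c].
have iZ : invariant_set Rr B L alpha Z.
  move=> t l [It ut] lL nz.
  have Igl k : k \in L -> I (gmap Rr k t).
    by move=> kL; apply/inI; apply: gmap_attr => //; apply/inI.
  split; first exact: Igl.
  (* The terms are nonnegative and add up to u t - u c = 0, so each one vanishes: a letter of
     nonzero weight leads to another minimum point. *)
  have : \sum_(k <- L) weight k t * (u (gmap Rr k t) - u c) == 0.
    under eq_bigr do rewrite mulrBr.
    by rewrite sumrB uT -mulr_suml sum_weight mul1r ut subrr.
  rewrite big_seq psumr_eq0; last first.
    by move=> k kL; rewrite mulr_ge0 ?weight_ge0// subr_ge0 cmin//; exact: Igl.
  move/allP/(_ _ lL); rewrite lL /= mulf_eq0 => /orP[|]; last first.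
    by rewrite subr_eq0 => /eqP.
  rewrite /weight -exprMn -Normc.normcM sqrf_eq0 normc_eq0.
  by rewrite (negbTE nz).
have [fZ|infZ] := pselect (finite_set Z); last first.
  have H := entire_limit_eqcst (m := u c) uL' infZ (rho := attr_radius) _.
  have {}H t : u t = u c by apply: H => x [/inI].
  by move=> t; rewrite H -(H 0).
have [|M MZ mM] := minimal_invariant_sub fZ _ iZ; first by exists c.
have M0 : M 0 by rewrite (minM _ mM).
have [_ u0c] := MZ _ M0.
apply: (entire_limit_eqcst uL' iI (rho := attr_radius)) => t It.
split; first exact/inI.
apply/eqP; rewrite eq_le u1 /= -u0 u0c; apply: cmin.
by move: It; rewrite /I /=.
Qed.

End TransferOperator.

                                                    

(** * Entire approximants with a uniform exponential bound *)

Section EntireApproximation.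
Variable R : realType.
Local Notation normc := (@Normc.normc R).
Variables (Rr : int) (B L : seq int) (alpha : int -> R[i]).
Hypothesis Rr2 : 2 <= `|Rr|.
Hypothesis B0 : 0 \in B.
Hypothesis uB : uniq B.
Hypothesis ortho : orthonormal_columns Rr B L alpha.

Local Notation Rz := (Rr%:~R : R).
Local Notation N := ((size B)%:R : R).
Local Notation mC := (@mBC R B).
Local Notation gC := (@gmapC R Rr).
Local Notation wt := (@weight R Rr B alpha).

Lemma intCE (n : int) : n%:~R = (n%:~R : R)%:C%C.
Proof. by rewrite rmorph_int. Qed.

Lemma Im_mulr_real (x : R) (z : R[i]) : complex.Im (x%:C%C * z) = x * complex.Im z.
Proof. by case: z => a b; rewrite /= mul0r addr0. Qed.

Lemma Im_div_int (n : int) (z : R[i]) : complex.Im (z / n%:~R) = complex.Im z / n%:~R.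
Proof. by rewrite mulrC intCE -fmorphV Im_mulr_real mulrC. Qed.

Lemma Im_gmapC l z : complex.Im (gC l z) = complex.Im z / Rz.
Proof.
rewrite /gmapC Im_div_int intCE; congr (_ / _).
by case: z => a b; rewrite /= subr0.
Qed.

Lemma conjc_gmapC l z : conjc (gC l z) = gC l (conjc z).
Proof.
rewrite /gmapC conjcM conjc_inv -[conjc (_ - _)]/(conjc (_ + _)) rmorphB /=.
by rewrite !intCE !conjc_real.
Qed.

(** Chosen so that |e^{2 pi i b z}|^2 <= e^{growth |Im z|} for all b in B. *)
Definition growth : R := 4 * pi * \sum_(b <- B) `|b%:~R|.

Lemma growth_ge0 : 0 <= growth.
Proof. by rewrite mulr_ge0 ?mulr_ge0 ?pi_ge0// sumr_ge0. Qed.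

Lemma digit_growth b (y : R) : b \in B ->
  2 * - (2 * pi * (b%:~R * y)) <= growth * `|y|.
Proof.
move=> bB; rewrite /growth.
have bs : `|b%:~R : R| <= \sum_(b <- B) `|b%:~R|.
  by rewrite (bigD1_seq b)//= lerDl sumr_ge0.
rewrite [leLHS](_ : _ = 4 * pi * (- (b%:~R * y))); last by ring.
rewrite -!mulrA ler_pM2l// ler_pM2l ?pi_gt0//.
apply: le_trans (ler_norm _) _; rewrite normrN normrM.
by rewrite ler_wpM2r.
Qed.

Lemma mean_le (T : eqType) (s : seq T) (F : T -> R) (c : R) : (0 < size s)%N ->
  (forall b, b \in s -> F b <= c) -> (size s)%:R^-1 * \sum_(b <- s) F b <= c.
Proof.
move=> s0 Fc; rewrite ler_pdivrMl ?ltr0n// mulr_natl.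
rewrite -[in leRHS](count_predT s) -iter_addr_0 -big_const_seq.
by rewrite big_seq [leRHS]big_seq ler_sum.
Qed.

Lemma size_B_gt0 : (0 < size B)%N.
Proof. by case: B B0. Qed.

Lemma normc_mBC_opp z : normc (mC (- z)) = normc (mC (conjc z)).
Proof.
rewrite -normc_conjc; congr normc; rewrite /mBC conjcM; congr (_ * _).
  by rewrite conjc_inv conjc_nat.
rewrite rmorph_sum; apply: eq_bigr => b _.
rewrite -[LHS]/(conjc (cexpi _)) conjc_cexpi; congr cexpi.
by rewrite conjcM rmorphN /= mulrN opprK intCE conjc_real.
Qed.

Lemma normc_mBC_le z : normc (mC z) ^+ 2 <= expR (growth * `|complex.Im z|).
Proof.
have -> : expR (growth * `|complex.Im z|) = expR (growth * `|complex.Im z| / 2) ^+ 2.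
  by rewrite expr2 -expRD; congr expR; field.
rewrite ler_pXn2r ?nnegrE ?normc_ge0 ?expR_ge0//.
rewrite Normc.normcM Normc.normcV -(rmorph_nat (real_complex R)) normc_real ger0_norm//.
apply: le_trans (mean_le (F := fun b => normc (cexpi (b%:~R * z))) size_B_gt0 _).
  by rewrite ler_wpM2l ?invr_ge0// ler_normc_sum.
move=> b bB; rewrite normc_cexpi ler_expR intCE Im_mulr_real.
by have := digit_growth (complex.Im z) bB; lra.
Qed.

(** The entire extension of |m_B|^2: for real t, m_B(-t) is the conjugate of m_B(t). *)
Definition WC z := mC z * mC (- z).

Lemma WC_real (t : R) : WC t%:C%C = (normc (mB B t) ^+ 2)%:C%C.
Proof.
rewrite /WC -rmorphN !mBC_real rmorphXn /= -[RHS]/(`|mB B t| ^+ 2) sqr_normc; congr (_ * _).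
rewrite /mB conjcM conjc_inv conjc_nat; congr (_ * _).
rewrite rmorph_sum; apply: eq_bigr => b _.
by rewrite -[RHS]/(conjc (expi2pi _)) conjc_expi2pi /ee mulrN.
Qed.

Lemma normc_WC z : normc (WC z) = normc (mC z) * normc (mC (conjc z)).
Proof. by rewrite -normc_mBC_opp -Normc.normcM. Qed.

Lemma normc_WC_le z : normc (WC z) <= expR (growth * `|complex.Im z|).
Proof.
have h1 := normc_mBC_le z; have h2 := normc_mBC_le (conjc z).
rewrite normc_WC.
have -> : `|complex.Im z| = `|complex.Im (conjc z)| by case: z {h1 h2} => a b; rewrite /= normrN.
have E : `|complex.Im z| = `|complex.Im (conjc z)| by case: z {h1 h2} => a b; rewrite /= normrN.
rewrite E in h1; move: h1 h2; move: (normc _) (normc _) (expR _) => x y e.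
have := sqr_ge0 (x - y); rewrite sqrrB; lra.
Qed.

Lemma cdiff_mBC z : cdiff mC z.
Proof.
apply: cdiffM; first exact: cdiff_cst.
apply: cdiff_sum => b.
apply: (@cdiff_comp R (@cexpi R) (fun w => b%:~R * w)); first exact: cdiff_cexpi.
by apply: cdiffM; [exact: cdiff_cst|exact: cdiff_id].
Qed.

Lemma cdiff_WC z : cdiff WC z.
Proof.
apply: cdiffM; first exact: cdiff_mBC.
apply: (@cdiff_comp R mC (fun w => - w)); first exact: cdiff_mBC.
rewrite (_ : (fun w => - w) = fun w : R[i] => -1 * w); last by apply/funext => w; rewrite mulN1r.
by apply: cdiffM; [exact: cdiff_cst|exact: cdiff_id].
Qed.

Lemma cdiff_gmapC l z : cdiff (gC l) z.
Proof.
apply: cdiffM; last exact: cdiff_cst.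
by apply: cdiffD; [exact: cdiff_id|exact: cdiff_cst].
Qed.

Definition transferC (f : R[i] -> R[i]) z :=
  \sum_(l <- L) (normc (alpha l) ^+ 2)%:C%C * WC (gC l z) * f (gC l z).

(** One step of the refinement equation phi(t) = |m_B(t/R)|^2 phi(t/R). Iterated from 1 it produces
    the partial products of the |m_B(t/R^j)|^2. *)
Definition shrink (f : R[i] -> R[i]) z := WC (gC 0 z) * f (gC 0 z).

Lemma cdiff_transferC f : (forall z, cdiff f z) -> forall z, cdiff (transferC f) z.
Proof.
move=> df z; apply: cdiff_sum => l; apply: cdiffM.
  apply: cdiffM; first exact: cdiff_cst.
  exact: (cdiff_comp (cdiff_WC _) (cdiff_gmapC _ _)).
exact: (cdiff_comp (df _) (cdiff_gmapC _ _)).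
Qed.

Lemma cdiff_shrink f : (forall z, cdiff f z) -> forall z, cdiff (shrink f) z.
Proof.
move=> df z; apply: cdiffM.
  exact: (cdiff_comp (cdiff_WC _) (cdiff_gmapC _ _)).
exact: (cdiff_comp (df _) (cdiff_gmapC _ _)).
Qed.

Definition exp_bounded (f : R[i] -> R[i]) :=
  forall z, normc (f z) <= expR (growth * `|complex.Im z|).

(** The maps g_l divide the imaginary part by R, and |R| >= 2. So a bound for the weight and one for
    the function, both taken at Im z / R, multiply to the same bound at Im z, which therefore
    survives any number of steps. *)
Lemma exp_halving (y : R) : expR (growth * `|y / Rz|) * expR (growth * `|y / Rz|)
  <= expR (growth * `|y|).
Proof.
rewrite -expRD ler_expR -mulrDr ler_wpM2l ?growth_ge0// normrM normfV -mulrDr.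
have h : `|Rz|^-1 <= 1 / 2 by have := normr_base R Rr2; rewrite -div1r => ?; rewrite ler_pdivrMr; lra.
by rewrite -[leRHS]mulr1 ler_wpM2l//; lra.
Qed.

Lemma exp_bounded_shrink f : exp_bounded f -> exp_bounded (shrink f).
Proof.
move=> bf z; rewrite /shrink Normc.normcM; apply: le_trans (exp_halving _).
by apply: ler_pM; rewrite ?normc_ge0// -(Im_gmapC 0); [exact: normc_WC_le|exact: bf].
Qed.

Lemma sum_mBC_le z : \sum_(l <- L) normc (alpha l) ^+ 2 * normc (mC (gC l z)) ^+ 2
  <= expR (growth * `|complex.Im z / Rz|).
Proof.
rewrite (sum_mBC uB ortho); apply: mean_le; first exact: size_B_gt0.
move=> b bB; rewrite expr2 -expRD ler_expR Im_div_int intCE Im_mulr_real.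
have := digit_growth (complex.Im z / Rz) bB.
by rewrite mulrA; lra.
Qed.

(** |m_B(w) m_B(-w)| is at most the mean of |m_B(w)|^2 and |m_B(conj w)|^2. Summed over l with the
    weights |alpha_l|^2, both are controlled by [sum_mBC_le], so no factor depending on L
    appears. *)
Lemma exp_bounded_transferC f : exp_bounded f -> exp_bounded (transferC f).
Proof.
move=> bf z; apply: le_trans (exp_halving _).
apply: le_trans (ler_normc_sum _ _ _) _.
apply: (@le_trans _ _ (\sum_(l <- L)
   (normc (alpha l) ^+ 2 * normc (mC (gC l z)) ^+ 2 / 2 +
    normc (alpha l) ^+ 2 * normc (mC (gC l (conjc z))) ^+ 2 / 2)
     * expR (growth * `|complex.Im z / Rz|))).
  apply: ler_sum => l _; rewrite 2!Normc.normcM normc_WC normc_real ger0_norm ?sqr_ge0//.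
  apply: ler_pM; rewrite ?mulr_ge0 ?sqr_ge0 ?normc_ge0//; last first.
    by rewrite -(Im_gmapC l).
  rewrite conjc_gmapC.
  move: (normc (mC _)) (normc (mC _)) => x y.
  rewrite [leRHS](_ : _ = normc (alpha l) ^+ 2 * ((x ^+ 2 + y ^+ 2) / 2)); last by field.
  rewrite ler_wpM2l ?sqr_ge0//.
  have := sqr_ge0 (x - y); rewrite sqrrB; lra.
rewrite -mulr_suml ler_pM2r ?expR_gt0// big_split /= -!mulr_suml.
have h1 := sum_mBC_le z; have := sum_mBC_le (conjc z).
have -> : `|complex.Im (conjc z) / Rz| = `|complex.Im z / Rz|.
  by case: (z) => a b; rewrite /= mulNr normrN.
lra.
Qed.

Variables (phi : R -> R) (u_ : nat -> R -> R) (u : R -> R).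
Hypothesis phi_refine : forall t, phi t = normc (mB B (t / Rz)) ^+ 2 * phi (t / Rz).
Hypothesis phi_cvg : forall t, phi (t / Rz ^+ k) @[k --> \oo] --> (1 : R).
Hypothesis u_0 : forall t, u_ 0%N t = phi t.
Hypothesis u_S : forall n t, u_ n.+1 t = \sum_(l <- L) wt l t * u_ n (gmap Rr l t).
Hypothesis u_cvg : forall t, u_ n t @[n --> \oo] --> u t.

(** On the real axis this tends to [u_ n] as k grows, and [u_ n] tends to [u]. In the application
    phi is the squared modulus of the Fourier transform of mu, and [u_ n t] is the frame sum of e_t
    over words of length n. *)
Definition approx n k := iter n transferC (iter k shrink (fun=> 1)).

Lemma cdiff_approx n k z : cdiff (approx n k) z.
Proof.
rewrite /approx; elim: n z => [|n IH] z /=; last exact: cdiff_transferC.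
by elim: k z => [|k IH] z /=; [exact: cdiff_cst|exact: cdiff_shrink].
Qed.

Lemma exp_bounded_approx n k : exp_bounded (approx n k).
Proof.
rewrite /approx; elim: n => [|n IH] /=; last exact: exp_bounded_transferC.
elim: k => [|k IH] /=; last exact: exp_bounded_shrink.
move=> z; rewrite (@Normc.normc1 R) -[leLHS](@expR0 R) ler_expR mulr_ge0 ?growth_ge0//.
Qed.

Definition approxR n k (t : R) := complex.Re (approx n k t%:C%C).

Lemma approxR_real n k (t : R) : approx n k t%:C%C = (approxR n k t)%:C%C.
Proof.
rewrite /approxR; suff [x ->] : exists x, approx n k t%:C%C = x%:C%C by [].
rewrite /approx; elim: n t => [|n IH] t /=.
  elim: k t => [|k IH] t /=; first by exists 1.
  rewrite /shrink gmapC_real WC_real; have [x ->] := IH (gmap Rr 0 t).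
  by rewrite -rmorphM; eexists.
have /choice[y yE] := fun l => IH (gmap Rr l t).
rewrite /transferC; under eq_bigr do rewrite gmapC_real WC_real yE -!rmorphM.
by rewrite -rmorph_sum; eexists.
Qed.

Lemma approxR0 t : approxR 0 0 t = 1.
Proof. by []. Qed.

Lemma gmap0 t : gmap Rr 0 t = t / Rz.
Proof. by rewrite /gmap subr0. Qed.

Lemma approxR0S k t : approxR 0 k.+1 t = normc (mB B (t / Rz)) ^+ 2 * approxR 0 k (t / Rz).
Proof.
apply: (@complexI R); rewrite -approxR_real rmorphM /= -approxR_real.
by rewrite /approx /= /shrink gmapC_real WC_real gmap0.
Qed.

Lemma approxRS n k t : approxR n.+1 k t = \sum_(l <- L) wt l t * approxR n k (gmap Rr l t).
Proof.
apply: (@complexI R); rewrite -approxR_real rmorph_sum.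
rewrite -[LHS]/(transferC (approx n k) t%:C%C); apply: eq_bigr => l _.
by rewrite gmapC_real WC_real approxR_real -!rmorphM.
Qed.

Lemma normc_mB_le1 (t : R) : normc (mB B t) ^+ 2 <= 1.
Proof.
rewrite -mBC_real; apply: le_trans (normc_mBC_le _) _.
by rewrite /= normr0 mulr0 expR0.
Qed.

Lemma approxR0_bounds k t : 0 <= approxR 0 k t <= 1.
Proof.
elim: k t => [|k IH] t; first by rewrite approxR0 ler01 lexx.
rewrite approxR0S; have /andP[h1 h2] := IH (t / Rz).
by rewrite mulr_ge0 ?sqr_ge0//= mulr_ile1// ?sqr_ge0// normc_mB_le1.
Qed.

Lemma phi_approxR0 k t : phi t = approxR 0 k t * phi (t / Rz ^+ k).
Proof.
elim: k t => [|k IH] t; first by rewrite approxR0 mul1r expr0 divr1.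
by rewrite (phi_refine t) (IH (t / Rz)) approxR0S [Rz ^+ k.+1]exprS invfM !mulrA.
Qed.

Lemma approxR_cvg n t : approxR n k t @[k --> \oo] --> u_ n t.
Proof.
elim: n t => [|n IH] t.
  rewrite u_0; apply/cvgrPdist_le => e e0.
  have /cvgrPdist_le/(_ _ e0) := phi_cvg t; apply: filterS => k.
  (* phi is its k-th partial product times phi(t / R^k), which tends to 1, and the partial products
     are at most 1. *)
  rewrite (phi_approxR0 k t) -{2}[approxR 0 k t]mulr1 -mulrBr normrM distrC => h.
  have /andP[h1 h2] := approxR0_bounds k t.
  by rewrite (ger0_norm h1); apply: le_trans h; rewrite ler_piMl.
rewrite u_S (_ : (fun k => _) = (fun k => \sum_(l <- L) wt l t * approxR n k (gmap Rr l t))).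
  apply: cvg_big => [|l _]; [exact: add_continuous|].
  by apply: cvgM; [exact: cvg_cst|exact: IH].
by apply/funext => k; rewrite approxRS.
Qed.

Lemma eventually_all (T : eqType) (s : seq T) (a : nat -> T -> R) (b : T -> R) (e : R) :
  (forall t, a n t @[n --> \oo] --> b t) -> 0 < e ->
  exists n, forall t, t \in s -> `|a n t - b t| <= e.
Proof.
move=> ab e0.
have : \forall n \near \oo, forall t, t \in s -> `|a n t - b t| <= e.
  elim: s => [|x s IH]; first exact: nearW.
  have /cvgrPdist_le/(_ _ e0) H := ab x.
  near=> n => t; rewrite in_cons => /predU1P[->|].
    by rewrite distrC; near: n.
  by move: t; near: n.
by move=> [n _ H]; exists n; apply: H => /=.
Unshelve. all: by end_near.
Qed.

Lemma entire_limit_transfer : entire_limit u.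
Proof.
move=> r; exists (expR (growth * `|r|)) => F e e0.
have e20 : 0 < e / 2 by rewrite divr_gt0.
have [n Hn] := eventually_all F u_cvg e20.
have ac t : approxR n k t @[k --> \oo] --> u_ n t by exact: approxR_cvg.
have [k Hk] := eventually_all F ac e20.
exists (approx n k); split.
- exact: cdiff_approx.
- move=> z zr; apply: le_trans (exp_bounded_approx n k z) _.
  rewrite ler_expR ler_wpM2l ?growth_ge0//.
  apply: le_trans (ler_normc_Im _) _; apply: le_trans zr _; exact: ler_norm.
- move=> t tF; rewrite approxR_real -rmorphB normc_real.
  have := ler_normD (approxR n k t - u_ n t) (u_ n t - u t).
  rewrite addrA subrK; have := Hn _ tF; have := Hk _ tF; lra.
Qed.

End EntireApproximation.

                                            

(** * Square-integrable complex functions *)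

Section ComplexIntegration.
Variables (R : realType) (mu : probability R R).
Local Notation normc := (@Normc.normc R).
Local Notation Re := (@complex.Re R).
Local Notation Im := (@complex.Im R).
Implicit Types u v f g : R -> R[i].

Definition cmeas f := measurable_fun setT (fun x => Re (f x)) /\
  measurable_fun setT (fun x => Im (f x)).

Lemma cmeas_cst c : cmeas (fun=> c).
Proof. by split; exact: measurable_cst. Qed.

Lemma cmeasD f g : cmeas f -> cmeas g -> cmeas (fun x => f x + g x).
Proof.
move=> [f1 f2] [g1 g2]; split.
  rewrite (_ : (fun x => _) = (fun x => Re (f x)) \+ (fun x => Re (g x))).
    exact: measurable_funD.
  by apply/funext => x /=; case: (f x) (g x) => ? ? [].
rewrite (_ : (fun x => _) = (fun x => Im (f x)) \+ (fun x => Im (g x))).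
  exact: measurable_funD.
by apply/funext => x /=; case: (f x) (g x) => ? ? [].
Qed.

Lemma cmeasM f g : cmeas f -> cmeas g -> cmeas (fun x => f x * g x).
Proof.
move=> [f1 f2] [g1 g2]; split.
  rewrite (_ : (fun x => _) = (fun x => Re (f x)) \* (fun x => Re (g x)) \-
     (fun x => Im (f x)) \* (fun x => Im (g x))).
    by apply: measurable_funB; exact: measurable_funM.
  by apply/funext => x /=; case: (f x) (g x) => ? ? [].
rewrite (_ : (fun x => _) = (fun x => Re (f x)) \* (fun x => Im (g x)) \+
   (fun x => Im (f x)) \* (fun x => Re (g x))).
  by apply: measurable_funD; exact: measurable_funM.
by apply/funext => x /=; case: (f x) (g x) => ? ? [].
Qed.

Lemma cmeas_conj f : cmeas f -> cmeas (fun x => conjc (f x)).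
Proof.
move=> [f1 f2]; split.
  by rewrite (_ : (fun x => _) = (fun x => Re (f x)))//; apply/funext => x; case: (f x).
rewrite (_ : (fun x => _) = \- (fun x => Im (f x))); first exact: measurable_funN.
by apply/funext => x /=; case: (f x).
Qed.

Lemma cmeas_comp f (g : R -> R) : measurable_fun setT g -> cmeas f -> cmeas (fun x => f (g x)).
Proof. by move=> mg [f1 f2]; split; apply: (measurableT_comp (f := fun x => _ (f x))). Qed.

Lemma measurable_normc2 f : cmeas f -> measurable_fun setT (fun x => normc (f x) ^+ 2).
Proof.
move=> [f1 f2].
rewrite (_ : (fun x => _) = (fun x => Re (f x)) \* (fun x => Re (f x)) \+
   (fun x => Im (f x)) \* (fun x => Im (f x))).
  by apply: measurable_funD; exact: measurable_funM.
by apply/funext => x /=; rewrite sqr_normcE !expr2.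
Qed.

Definition norm2 v : R := fine (\int[mu]_x (normc (v x) ^+ 2)%:E)%E.

Lemma norm2E v : in_L2 mu v -> ((norm2 v)%:E = \int[mu]_x (normc (v x) ^+ 2)%:E)%E.
Proof.
move=> vL; rewrite fineK// ge0_fin_numE; first by case: vL.
by apply: integral_ge0 => x _; rewrite lee_fin sqr_ge0.
Qed.

Lemma in_L2_cmeas v : in_L2 mu v -> cmeas v.
Proof. by case. Qed.

Lemma in_L2_le v f (K : R) : cmeas f -> in_L2 mu v ->
  (forall x, normc (f x) ^+ 2 <= K * normc (v x) ^+ 2) -> in_L2 mu f.
Proof.
move=> mf [v1 v2 voo] fv; case: (mf) => f1 f2; split => //.
apply: (@le_lt_trans _ _ (\int[mu]_x (`|K|%:E * (normc (v x) ^+ 2)%:E))%E).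
  apply: ge0_le_integral => //.
  - by move=> x _; rewrite lee_fin sqr_ge0.
  - by apply/measurable_EFinP; exact: measurable_normc2.
  - apply: emeasurable_funM => //; apply/measurable_EFinP; exact: measurable_normc2.
  - move=> x _; rewrite -EFinM lee_fin; apply: le_trans (fv x) _.
    by rewrite ler_wpM2r ?sqr_ge0// ler_norm.
rewrite ge0_integralZl//.
- by rewrite lte_mul_pinfty.
- by apply/measurable_EFinP; exact: measurable_normc2.
- by move=> x _; rewrite lee_fin sqr_ge0.
Qed.

Lemma in_L2_bounded f (K : R) : cmeas f -> (forall x, normc (f x) <= K) -> in_L2 mu f.
Proof.
move=> mf fK; case: (mf) => f1 f2; split => //.
apply: (@le_lt_trans _ _ (\int[mu]_x (K ^+ 2)%:E)%E).
  apply: ge0_le_integral => //.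
  - by move=> x _; rewrite lee_fin sqr_ge0.
  - by apply/measurable_EFinP; exact: measurable_normc2.
  - move=> x _; rewrite lee_fin ler_pXn2r ?nnegrE ?normc_ge0//.
    by apply: le_trans (fK x); exact: normc_ge0.
by rewrite integral_cst// [X in (_ * X)%E]probability_setT mule1 ltry.
Qed.

Lemma normc_sqrD (z w : R[i]) : normc (z + w) ^+ 2 <= 2 * normc z ^+ 2 + 2 * normc w ^+ 2.
Proof.
rewrite !sqr_normcE; case: z w => a b [c d] /=.
have := sqr_ge0 (a - c); have := sqr_ge0 (b - d); rewrite !sqrrD !sqrrN; lra.
Qed.

Lemma normc_parallelogram (z w : R[i]) :
  normc (z + w) ^+ 2 + normc (z - w) ^+ 2 = 2 * normc z ^+ 2 + 2 * normc w ^+ 2.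
Proof. by rewrite !sqr_normcE; case: z w => a b [c d] /=; ring. Qed.

Lemma in_L2D u v : in_L2 mu u -> in_L2 mu v -> in_L2 mu (fun x => u x + v x).
Proof.
move=> uL vL; have mu' := in_L2_cmeas uL; have mv := in_L2_cmeas vL.
have [m1 m2] := cmeasD mu' mv; split => //.
apply: (@le_lt_trans _ _ (\int[mu]_x (2%:E * (normc (u x) ^+ 2)%:E + 2%:E * (normc (v x) ^+ 2)%:E))%E).
  apply: ge0_le_integral => //.
  - by move=> x _; rewrite lee_fin sqr_ge0.
  - by apply/measurable_EFinP; exact: measurable_normc2 (cmeasD mu' mv).
  - apply: emeasurable_funD; apply: emeasurable_funM => //;
      apply/measurable_EFinP; exact: measurable_normc2.
  - by move=> x _; rewrite -!EFinM -EFinD lee_fin normc_sqrD.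
rewrite ge0_integralD//.
- rewrite !ge0_integralZl// ?lte_add_pinfty// ?lte_mul_pinfty//.
  + by case: uL.
  + by case: vL.
  + by apply/measurable_EFinP; exact: measurable_normc2.
  + by move=> x _; rewrite lee_fin sqr_ge0.
  + by apply/measurable_EFinP; exact: measurable_normc2.
  + by move=> x _; rewrite lee_fin sqr_ge0.
- by move=> x _; rewrite -EFinM lee_fin mulr_ge0// sqr_ge0.
- by apply: emeasurable_funM => //; apply/measurable_EFinP; exact: measurable_normc2.
- by move=> x _; rewrite -EFinM lee_fin mulr_ge0// sqr_ge0.
- by apply: emeasurable_funM => //; apply/measurable_EFinP; exact: measurable_normc2.
Qed.

Lemma in_L2_mul_bounded v g (K : R) : in_L2 mu v -> cmeas g ->
  (forall x, normc (g x) <= K) -> in_L2 mu (fun x => v x * g x).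
Proof.
move=> vL mg gK; apply: (@in_L2_le v _ (K ^+ 2)) => //.
  exact: cmeasM (in_L2_cmeas vL) mg.
move=> x; rewrite Normc.normcM exprMn mulrC ler_wpM2r ?sqr_ge0//.
by rewrite ler_pXn2r ?nnegrE ?normc_ge0//; apply: le_trans (gK x); exact: normc_ge0.
Qed.

Lemma in_L2Z v c : in_L2 mu v -> in_L2 mu (fun x => c * v x).
Proof.
move=> vL; rewrite (_ : (fun x => _) = fun x => v x * c); last first.
  by apply/funext => x; rewrite mulrC.
exact: (in_L2_mul_bounded (K := normc c) vL (cmeas_cst c)).
Qed.

Lemma in_L2_integrable v : in_L2 mu v ->
  mu.-integrable setT (EFin \o (fun x => Re (v x))) /\
  mu.-integrable setT (EFin \o (fun x => Im (v x))).
Proof.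
move=> vL; have [m1 m2] := in_L2_cmeas vL.
have i1 : mu.-integrable setT (fun x => (normc (v x) ^+ 2)%:E).
  apply/integrableP; split.
    by apply/measurable_EFinP; exact: measurable_normc2 (in_L2_cmeas vL).
  under eq_integral do rewrite gee0_abs ?lee_fin ?sqr_ge0//.
  by case: vL.
have i2 : mu.-integrable setT (fun x => 1%:E + (normc (v x) ^+ 2)%:E)%E.
  apply: integrableD => //.
  exact: (@finite_measure_integrable_cst _ _ _ mu setT 1).
have bd (a : R) n : `|a| <= n -> `|a| <= 1 + n ^+ 2.
  move=> an; have := sqr_ge0 (n - 1); rewrite sqrrB; have := sqr_ge0 n; lra.
split; apply: le_integrable i2 => //; first exact/measurable_EFinP.
- move=> x _ /=; rewrite lee_fin [leRHS]ger0_norm ?addr_ge0 ?sqr_ge0//.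
  by apply: bd; exact: ler_normc_Re.
- exact/measurable_EFinP.
- move=> x _ /=; rewrite lee_fin [leRHS]ger0_norm ?addr_ge0 ?sqr_ge0//.
  by apply: bd; exact: ler_normc_Im.
Qed.

Lemma cintegralD u v : in_L2 mu u -> in_L2 mu v ->
  cintegral mu (fun x => u x + v x) = cintegral mu u + cintegral mu v.
Proof.
move=> /in_L2_integrable[u1 u2] /in_L2_integrable[v1 v2].
rewrite /cintegral -[RHS]/(Complex (_ + _) (_ + _)) -!RintegralD//.
congr Complex; apply: eq_Rintegral => x _; by case: (u x) (v x) => ? ? [].
Qed.

Lemma cintegralZ v c : in_L2 mu v ->
  cintegral mu (fun x => c * v x) = c * cintegral mu v.
Proof.
move=> /in_L2_integrable[v1 v2]; case: c => a b.
have iZ (k : R) (f : R -> R) : mu.-integrable setT (EFin \o f) ->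
    mu.-integrable setT (EFin \o (fun x => k * f x)).
  by move=> fi; have := integrableZl measurableT k fi.
rewrite /cintegral -[RHS]/(Complex (_ - _) (_ + _)) -!RintegralZl// -RintegralB ?iZ//.
rewrite -RintegralD ?iZ//.
by congr Complex; apply: eq_Rintegral => x _; case: (v x).
Qed.

Lemma in_L2_sum (T : eqType) (s : seq T) (F : T -> R -> R[i]) :
  (forall i, i \in s -> in_L2 mu (F i)) ->
  in_L2 mu (fun x => \sum_(i <- s) F i x) /\
  cintegral mu (fun x => \sum_(i <- s) F i x) = \sum_(i <- s) cintegral mu (F i).
Proof.
elim: s => [|i s IH] FL.
  rewrite big_nil (_ : (fun x => _) = fun=> 0); last by apply/funext => x; rewrite big_nil.
  split; last by rewrite /cintegral /= !Rintegral_cst// !mul0r.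
  by apply: (@in_L2_bounded _ 0) => [|x]; [exact: cmeas_cst|rewrite Normc.normc0].
rewrite big_cons (_ : (fun x => _) = fun x => F i x + \sum_(j <- s) F j x); last first.
  by apply/funext => x; rewrite big_cons.
have [IH1 IH2] := IH (fun j js => FL j (mem_behead (s := i :: s) js)).
have Fi := FL i (mem_head _ _).
by rewrite -IH2; split; [exact: in_L2D|exact: cintegralD].
Qed.

(** The variance of f under the probability mu is nonnegative. *)
Lemma sqr_Rintegral_le (f : R -> R) : mu.-integrable setT (EFin \o f) ->
  mu.-integrable setT (EFin \o (fun x => f x ^+ 2)) ->
  Rintegral mu setT f ^+ 2 <= Rintegral mu setT (fun x => f x ^+ 2).
Proof.
move=> fi f2i; set m := Rintegral mu setT f.
have i1 : mu.-integrable setT (EFin \o (fun x => (2 * m) * f x)).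
  by have := integrableZl measurableT (2 * m) fi.
have i2 : mu.-integrable setT (EFin \o (fun x => f x ^+ 2 - 2 * m * f x)).
  by have := integrableB measurableT f2i i1.
have i3 : mu.-integrable setT (EFin \o (fun=> m ^+ 2)).
  exact: finite_measure_integrable_cst.
have : 0 <= Rintegral mu setT (fun x => (f x ^+ 2 - 2 * m * f x) + m ^+ 2).
  apply: Rintegral_ge0 => x _.
  by rewrite (_ : _ + _ = (f x - m) ^+ 2) ?sqr_ge0//; ring.
rewrite RintegralD// RintegralB// RintegralZl// -/m Rintegral_cst// [X in fine X]probability_setT mulr1.
by rewrite expr2; lra.
Qed.

Lemma normc_cintegral_le v : in_L2 mu v -> normc (cintegral mu v) ^+ 2 <= norm2 v.
Proof.
move=> vL; have [i1 i2] := in_L2_integrable vL; have [m1 m2] := in_L2_cmeas vL.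
have sqi (f : R -> R) : measurable_fun setT f -> (forall x, f x ^+ 2 <= normc (v x) ^+ 2) ->
    mu.-integrable setT (EFin \o (fun x => f x ^+ 2)).
  move=> mf fv; apply/integrableP; split.
    by apply/measurable_EFinP; exact: measurable_funX.
  case: vL => _ _; apply: le_lt_trans; apply: ge0_le_integral => //.
  - by apply: measurableT_comp => //; apply/measurable_EFinP; exact: measurable_funX.
  - by apply/measurable_EFinP; exact: measurable_normc2.
  - by move=> x _ /=; rewrite ger0_norm ?sqr_ge0// lee_fin.
have h1 := sqi _ m1 _; have h2 := sqi _ m2 _.
rewrite sqr_normcE /=; apply: le_trans (lerD (sqr_Rintegral_le i1 (h1 _)) (sqr_Rintegral_le i2 (h2 _))) _.
- by move=> x; rewrite sqr_normcE lerDl sqr_ge0.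
- by move=> x; rewrite sqr_normcE lerDr sqr_ge0.
rewrite -RintegralD//; last 2 first.
- by apply: h1 => x; rewrite sqr_normcE lerDl sqr_ge0.
- by apply: h2 => x; rewrite sqr_normcE lerDr sqr_ge0.
by rewrite le_eqVlt; apply/orP; left; apply/eqP; congr fine; apply: eq_integral => x _; rewrite sqr_normcE.
Qed.

Lemma norm2_parallelogram u v : in_L2 mu u -> in_L2 mu v ->
  norm2 (fun x => u x + v x) + norm2 (fun x => u x - v x) = 2 * norm2 u + 2 * norm2 v.
Proof.
move=> uL vL.
have vNL : in_L2 mu (fun x => -1 * v x) by exact: in_L2Z.
rewrite (_ : (fun x => u x - v x) = fun x => u x + -1 * v x); last first.
  by apply/funext => x; rewrite mulN1r.
apply: EFin_inj; rewrite !EFinD !EFinM !norm2E//; [|exact: in_L2D..].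
have m2 w : in_L2 mu w -> measurable_fun setT (fun x => (normc (w x) ^+ 2)%:E).
  by move=> /in_L2_cmeas mw; apply/measurable_EFinP; exact: measurable_normc2.
have p2 (w : R -> R[i]) x : [set: R] x -> (0 <= (normc (w x) ^+ 2)%:E)%E by rewrite lee_fin sqr_ge0.
rewrite -!ge0_integralZl//; [|exact: m2|exact: p2|exact: m2|exact: p2].
rewrite -!ge0_integralD//;
  try (by apply: m2; exact: in_L2D);
  try (by apply: emeasurable_funM => //; exact: m2);
  try (by move=> x _; rewrite -EFinM lee_fin mulr_ge0// sqr_ge0);
  try (by move=> x _; rewrite lee_fin sqr_ge0).
by apply: eq_integral => x _; rewrite mulN1r -!EFinM -!EFinD normc_parallelogram.
Qed.

Lemma norm2Z v c : in_L2 mu v -> norm2 (fun x => c * v x) = normc c ^+ 2 * norm2 v.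
Proof.
move=> vL; apply: EFin_inj; rewrite EFinM !norm2E//; last exact: in_L2Z.
rewrite -ge0_integralZl//.
- by apply: eq_integral => x _; rewrite Normc.normcM exprMn.
- by apply/measurable_EFinP; apply: measurable_normc2 (in_L2_cmeas vL).
- by move=> x _; rewrite lee_fin sqr_ge0.
- by rewrite lee_fin sqr_ge0.
Qed.

Lemma cmeas_ee (c : R) : cmeas (ee c).
Proof.
have cc : continuous (fun x : R => 2 * pi * (c * x)).
  by move=> x; apply: cvgM; [exact: cvg_cst|apply: cvgM; [exact: cvg_cst|exact: cvg_id]].
split.
  rewrite (_ : (fun x => _) = cos \o (fun x => 2 * pi * (c * x)))//.
  by apply: continuous_measurable_fun => x; apply: continuous_comp; [exact: cc|exact: continuous_cos].
rewrite (_ : (fun x => _) = sin \o (fun x => 2 * pi * (c * x)))//.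
by apply: continuous_measurable_fun => x; apply: continuous_comp; [exact: cc|exact: continuous_sin].
Qed.

Lemma normc_ee (c x : R) : normc (ee c x) = 1.
Proof. exact: normc_expi2pi. Qed.

Lemma in_L2_ee (c : R) : in_L2 mu (ee c).
Proof. by apply: (in_L2_bounded (K := 1)) => [|x]; [exact: cmeas_ee|rewrite normc_ee]. Qed.

End ComplexIntegration.

                           

(** * The letter operators, frame sums and Bessel's inequality *)

Section AnalysisOperators.
Variables (R : realType) (Rr : int) (B L : seq int) (mu : probability R R) (alpha : int -> R[i]).
Local Notation normc := (@Normc.normc R).
Hypothesis Rr2 : 2 <= `|Rr|.
Hypothesis uB : uniq B.
Hypothesis B0 : 0 \in B.
Hypothesis muI : is_invariant_measure Rr B mu.
Hypothesis uL : uniq L.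
Hypothesis L0 : 0 \in L.
Hypothesis alpha0 : alpha 0 = 1.
Hypothesis ortho : orthonormal_columns Rr B L alpha.

Local Notation Rz := (Rr%:~R : R).
Local Notation N := ((size B)%:R : R).
Local Notation frame := (frame_elt Rr alpha).
Local Notation wt := (@weight R Rr B alpha).

Lemma measurable_tau b : measurable_fun [set: R] (tau Rr b : R -> R).
Proof.
apply: continuous_measurable_fun => x.
apply: cvgM; last exact: cvg_cst.
by apply: cvgD; [exact: cvg_id|exact: cvg_cst].
Qed.

Lemma ge0_integral_invariant (f : R -> \bar R) : measurable_fun setT f -> (forall x, 0 <= f x)%E ->
  (\int[mu]_x f x = (N^-1)%:E * \sum_(b <- B) \int[mu]_x f (tau Rr b x))%E.
Proof.
move=> mf f0.
have N0 : 0 <= N^-1 by rewrite invr_ge0.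
pose m_ (i : nat) : {measure set R -> \bar R} :=
  measure_function_pushforward__canonical__measure_function_Measure mu (measurable_tau (nth 0 B i)).
pose m2 : {measure set R -> \bar R} := mscale (NngNum N0) (msum m_ (size B)).
rewrite (@eq_measure_integral _ _ _ _ m2); last first.
  move=> A mA _; apply: (eq_trans (muI mA)); rewrite /= /mscale /= /msum; congr (_ * _)%E.
  by rewrite (big_nth 0) big_mkord.
rewrite /m2 ge0_integral_mscale//; congr (_ * _)%E.
rewrite ge0_integral_measure_sum// (big_nth 0) big_mkord; apply: eq_bigr => i _.
by have -> := ge0_integral_pushforward (measurable_tau (nth 0 B i)) mu measurableT mf (fun x _ => f0 x).
Qed.

Lemma integrable_comp_tau (f : R -> R) b : b \in B ->
  mu.-integrable setT (EFin \o f) -> mu.-integrable setT (EFin \o (fun x => f (tau Rr b x))).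
Proof.
move=> bB /integrableP[mf foo].
have mabs : measurable_fun setT (fun x => `|(EFin \o f) x|%E) by exact: measurableT_comp.
move: foo; rewrite (ge0_integral_invariant mabs)// (bigD1_seq b)//= => foo.
apply/integrableP; split; first exact: (measurableT_comp mf (measurable_tau b)).
rewrite ltey; apply/eqP => E; move: foo; rewrite E addye.
  by rewrite gt0_muley ?ltxx// lte_fin invr_gt0 ltr0n; case: (B) B0.
by rewrite gt_eqF// (lt_le_trans (ltNyr 0))// sume_ge0// => b' _; exact: integral_ge0.
Qed.

Lemma Rintegral_invariant (f : R -> R) : mu.-integrable setT (EFin \o f) ->
  Rintegral mu setT f = N^-1 * \sum_(b <- B) Rintegral mu setT (fun x => f (tau Rr b x)).
Proof.
move=> fi.
have mf : measurable_fun setT f by have /integrableP[/measurable_EFinP] := fi.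
have key (g : R -> R) : (forall x, 0 <= g x) -> (forall x, g x <= `|f x|) -> measurable_fun setT g ->
    mu.-integrable setT (EFin \o g) /\
    Rintegral mu setT g = N^-1 * \sum_(b <- B) Rintegral mu setT (fun x => g (tau Rr b x)).
  move=> g0 gf mg.
  have ig : mu.-integrable setT (EFin \o g).
    apply: le_integrable fi => //; first exact/measurable_EFinP.
    by move=> x _ /=; rewrite lee_fin ger0_norm.
  split=> //; apply: EFin_inj.
  have finE (k : R -> R) : mu.-integrable setT (EFin \o k) ->
      ((Rintegral mu setT k)%:E = \int[mu]_x (k x)%:E)%E.
    by move=> ki; rewrite /Rintegral fineK//; exact: integrable_fin_num.
  rewrite finE// ge0_integral_invariant//; last exact/measurable_EFinP.
  rewrite EFinM; congr (_ * _)%E; rewrite -sumEFin; apply: eq_big_seq => b bB.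
  by rewrite finE//; exact: integrable_comp_tau.
pose p x := (`|f x| + f x) / 2; pose n x := (`|f x| - f x) / 2.
have mabs : measurable_fun setT (fun x => `|f x|) by exact: measurableT_comp.
have [ip pE] : mu.-integrable setT (EFin \o p) /\
    Rintegral mu setT p = N^-1 * \sum_(b <- B) Rintegral mu setT (fun x => p (tau Rr b x)).
  apply: key => [x|x|]; rewrite /p.
  - by have := ler_norm (- f x); rewrite normrN; lra.
  - by have := ler_norm (f x); lra.
  - by apply: measurable_funM => //; exact: measurable_funD.
have [ing nE] : mu.-integrable setT (EFin \o n) /\
    Rintegral mu setT n = N^-1 * \sum_(b <- B) Rintegral mu setT (fun x => n (tau Rr b x)).
  apply: key => [x|x|]; rewrite /n.
  - by have := ler_norm (f x); lra.
  - by have := ler_norm (- f x); rewrite normrN; lra.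
  - by apply: measurable_funM => //; exact: measurable_funB.
have fE (k : R -> R) : Rintegral mu setT (fun x => f (k x)) = Rintegral mu setT (fun x => p (k x) - n (k x)).
  by apply: eq_Rintegral => x _; rewrite /p /n; field.
rewrite (fE id) RintegralB// pE nE -mulrBr -sumrB; congr (_ * _).
apply: eq_big_seq => b bB; rewrite fE RintegralB//; exact: integrable_comp_tau.
Qed.

Lemma in_L2_comp_tau v b : b \in B -> in_L2 mu v -> in_L2 mu (fun x => v (tau Rr b x)).
Proof.
move=> bB vL; have mv := in_L2_cmeas vL.
have [m1 m2] := cmeas_comp (measurable_tau b) mv; split => //.
have i1 : mu.-integrable setT (EFin \o (fun x => normc (v x) ^+ 2)).
  apply/integrableP; split; first by apply/measurable_EFinP; exact: measurable_normc2.
  under eq_integral do rewrite /= ger0_norm ?sqr_ge0//.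
  by case: vL.
have /integrableP[_] := integrable_comp_tau bB i1.
by under eq_integral do rewrite /= ger0_norm ?sqr_ge0//.
Qed.

Lemma cintegral_invariant v : in_L2 mu v ->
  cintegral mu v = (N^-1)%:C%C * \sum_(b <- B) cintegral mu (fun x => v (tau Rr b x)).
Proof.
move=> /in_L2_integrable[i1 i2].
rewrite {1}/cintegral (Rintegral_invariant i1) (Rintegral_invariant i2).
have -> (s : seq int) : \sum_(b <- s) cintegral mu (fun x => v (tau Rr b x)) =
   Complex (\sum_(b <- s) Rintegral mu setT (fun x => complex.Re (v (tau Rr b x))))
           (\sum_(b <- s) Rintegral mu setT (fun x => complex.Im (v (tau Rr b x)))).
  elim: s => [|b s IH]; first by rewrite !big_nil.
  by rewrite !big_cons IH.
by rewrite /=; congr Complex; rewrite mul0r ?subr0 ?addr0.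
Qed.

(** The adjoint of prefixing the letter l: read through tau_b, prefixing multiplies a frame element
    by alpha_l e_l ([frame_cons]), and invariance of mu moves this factor onto v as an average over
    b. *)
Definition Vop (l : int) (v : R -> R[i]) (x : R) : R[i] :=
  (N^-1)%:C%C * \sum_(b <- B) v (tau Rr b x) * conjc (alpha l * ee l%:~R (tau Rr b x)).

Lemma cmeas_scaled_ee (c : R[i]) (t : R) (g : R -> R) : measurable_fun setT g ->
  cmeas (fun x => conjc (c * ee t (g x))).
Proof.
move=> mg; apply: cmeas_conj; apply: cmeasM; first exact: cmeas_cst.
exact: cmeas_comp mg (cmeas_ee t).
Qed.

Lemma normc_scaled_ee (c : R[i]) (t x : R) : normc (conjc (c * ee t x)) <= normc c.
Proof. by rewrite normc_conjc Normc.normcM normc_ee mulr1. Qed.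

Lemma in_L2_mul_ee v (c : R[i]) (t : R) (g : R -> R) : in_L2 mu v -> measurable_fun setT g ->
  in_L2 mu (fun x => v x * conjc (c * ee t (g x))).
Proof.
move=> vL mg; apply: (in_L2_mul_bounded (K := normc c) vL (cmeas_scaled_ee _ _ mg)).
by move=> x; exact: normc_scaled_ee.
Qed.

Lemma Vop_in_L2 l v : in_L2 mu v -> in_L2 mu (Vop l v).
Proof.
move=> vL; apply: in_L2Z.
have H b : b \in B -> in_L2 mu (fun x => v (tau Rr b x) * conjc (alpha l * ee l%:~R (tau Rr b x))).
  by move=> bB; apply: in_L2_mul_ee; [exact: in_L2_comp_tau|exact: measurable_tau].
by have [] := in_L2_sum H.
Qed.

Lemma ee_period (n b : int) (x : R) : ee n%:~R (x + b%:~R) = ee n%:~R x.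
Proof. by rewrite /ee mulrDr expi2piD -intrM expi2pi_int mulr1. Qed.

Lemma word_freq_cons l w : word_freq Rr (l :: w) = l + Rr * word_freq Rr w.
Proof.
rewrite /word_freq /= big_ord_recl expr0 mul1r /=; congr (_ + _).
rewrite mulr_sumr; apply: eq_bigr => i _; rewrite /bump /= add1n exprS mulrA.
by [].
Qed.

(** The tail has frequency R n, and e_{R n}(tau_b x) = e_n(x + b) = e_n(x), because n and b are
    integers. *)
Lemma frame_cons l w b x : frame (l :: w) (tau Rr b x) =
  alpha l * ee l%:~R (tau Rr b x) * frame w x.
Proof.
rewrite /frame_elt big_cons word_freq_cons.
have -> : ee (l + Rr * word_freq Rr w)%:~R (tau Rr b x) =
   ee l%:~R (tau Rr b x) * ee (word_freq Rr w)%:~R x.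
  rewrite {1}/ee intrD mulrDl expi2piD -/(ee _ _); congr (_ * _).
  rewrite -(ee_period _ b) /ee /tau intrM; congr expi2pi.
  by field; exact: base_neq0.
ring.
Qed.

Lemma l2inner_frame_in_L2 v w : in_L2 mu v -> in_L2 mu (fun x => v x * conjc (frame w x)).
Proof. by move=> vL; apply: in_L2_mul_ee => //; exact: measurable_id. Qed.

Lemma l2inner_cons v l w : in_L2 mu v ->
  l2inner mu v (frame (l :: w)) = l2inner mu (Vop l v) (frame w).
Proof.
move=> vL; rewrite /l2inner cintegral_invariant; last exact: l2inner_frame_in_L2.
pose F b x := v (tau Rr b x) * conjc (frame (l :: w) (tau Rr b x)).
have FL b : b \in B -> in_L2 mu (F b).
  move=> bB; apply: (in_L2_comp_tau (v := fun x => v x * conjc (frame (l :: w) x)) bB).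
  exact: l2inner_frame_in_L2.
have [sL sE] := in_L2_sum FL.
rewrite -[X in _ * X]sE -cintegralZ//; congr cintegral; apply/funext => x.
rewrite /Vop -mulrA; congr (_ * _); rewrite mulr_suml; apply: eq_bigr => b _.
by rewrite /F frame_cons (conjcM (alpha l * _)) mulrA.
Qed.

(** For fixed x, up to a phase depending on l, [Vop l v x] is coordinate l of the conjugated matrix
    at the vector with entries v(tau_b x) / sqrt N. *)
Lemma Vop_parseval v x : \sum_(l <- L) normc (Vop l v x) ^+ 2 =
  N^-1 * \sum_(b <- B) normc (v (tau Rr b x)) ^+ 2.
Proof.
have := columns_parseval uB ortho (fun b => ((Num.sqrt N)^-1)%:C%C * v (tau Rr b x)).
have sq : (Num.sqrt N)^-1 * (Num.sqrt N)^-1 = N^-1.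
  by rewrite -invfM -expr2 sqr_sqrtr.
under [X in _ = X -> _]eq_bigr do rewrite Normc.normcM normc_real exprMn
  real_normK ?num_real// expr2 sq.
rewrite -mulr_sumr => <-; apply: eq_bigr => l _; congr (_ ^+ 2).
rewrite -[RHS]mul1r -[X in _ = X * _](normc_expi2pi (- (l%:~R * x / Rz))) -Normc.normcM; congr normc.
rewrite /Vop !mulr_sumr; apply: eq_bigr => b _.
rewrite /hadamard_entry !conjcM !conjc_expi2pi conjc_real -sq rmorphM /=.
have -> : - (l%:~R * tau Rr b x) = - (l%:~R * x / Rz) + - ((l * b)%:~R / Rz).
  by rewrite /tau intrM; ring.
rewrite expi2piD; ring.
Qed.

Lemma norm2_Vop v : in_L2 mu v -> \sum_(l <- L) norm2 mu (Vop l v) = norm2 mu v.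
Proof.
move=> vL; apply: EFin_inj; rewrite -sumEFin.
under eq_bigr do rewrite (norm2E (Vop_in_L2 _ vL)).
have m2 w : in_L2 mu w -> measurable_fun setT (fun x => (normc (w x) ^+ 2)%:E).
  by move=> /in_L2_cmeas mw; apply/measurable_EFinP; exact: measurable_normc2.
rewrite -ge0_integral_sum//; last 2 first.
- by move=> l; exact: m2 (Vop_in_L2 l vL).
- by move=> l x _; rewrite lee_fin sqr_ge0.
rewrite norm2E// ge0_integral_invariant; last 2 first.
- exact: m2.
- by move=> x; rewrite lee_fin sqr_ge0.
transitivity (\int[mu]_x ((N^-1)%:E * (\sum_(b <- B) normc (v (tau Rr b x)) ^+ 2)%:E))%E.
  by apply: eq_integral => x _; rewrite sumEFin Vop_parseval EFinM.
have mS : measurable_fun setT (fun x => (\sum_(b <- B) normc (v (tau Rr b x)) ^+ 2)%:E).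
  apply/measurable_EFinP; apply: (@measurable_sum _ _ _ _ _ _ (fun b x => normc (v (tau Rr b x)) ^+ 2)) => b.
  apply: measurable_normc2.
  exact: cmeas_comp (measurable_tau b) (in_L2_cmeas vL).
have S0 x : [set: R] x -> (0 <= (\sum_(b <- B) normc (v (tau Rr b x)) ^+ 2)%:E)%E.
  by move=> _; rewrite lee_fin sumr_ge0// => b _; rewrite sqr_ge0.
have N0 : (0 <= (N^-1)%:E)%E by rewrite lee_fin invr_ge0.
rewrite (ge0_integralZl mu measurableT mS S0 N0).
congr (_ * _)%E; under eq_integral do rewrite -sumEFin.
rewrite ge0_integral_sum// => [b|b x _]; last by rewrite lee_fin sqr_ge0.
apply/measurable_EFinP; apply: measurable_normc2.
exact: cmeas_comp (measurable_tau b) (in_L2_cmeas vL).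
Qed.

Fixpoint words (n : nat) : seq (seq int) :=
  if n is k.+1 then [seq l :: w | l <- L, w <- words k] else [:: [::]].

(** All words of length n are taken, trailing zeros included, since the recursion [qsumS] works on
    first letters. The passage to Omega comes in [esum_frame]. *)
Definition qsum n (v : R -> R[i]) : R := \sum_(w <- words n) normc (l2inner mu v (frame w)) ^+ 2.

Lemma qsumS n v : in_L2 mu v -> qsum n.+1 v = \sum_(l <- L) qsum n (Vop l v).
Proof.
move=> vL; rewrite /qsum [words n.+1]/= big_allpairs_dep; apply: eq_bigr => l _.
by apply: eq_bigr => w _; rewrite l2inner_cons.
Qed.

Lemma qsum0 v : qsum 0 v = normc (cintegral mu v) ^+ 2.
Proof.
rewrite /qsum /= big_seq1 /l2inner; congr (normc (cintegral _ _) ^+ 2).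
apply/funext => x; rewrite /frame_elt big_nil mul1r /word_freq big_ord0 /ee mul0r.
by rewrite expi2pi0 conjc1 mulr1.
Qed.

Lemma bessel n v : in_L2 mu v -> qsum n v <= norm2 mu v.
Proof.
elim: n v => [|n IH] v vL; first by rewrite qsum0 normc_cintegral_le.
rewrite qsumS// -norm2_Vop//; apply: ler_sum => l _; apply: IH; exact: Vop_in_L2.
Qed.

Lemma cintegral_Vop0 v : in_L2 mu v -> cintegral mu (Vop 0 v) = cintegral mu v.
Proof.
move=> vL; have one w : cintegral mu w = l2inner mu w (frame [::]).
  rewrite /l2inner; congr cintegral; apply/funext => x.
  rewrite /frame_elt big_nil mul1r /word_freq big_ord0 /ee mul0r.
  by rewrite expi2pi0 conjc1 mulr1.
rewrite one -l2inner_cons// /l2inner; congr cintegral; apply/funext => x.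
rewrite /frame_elt big_seq1 alpha0 mul1r word_freq_cons /word_freq big_ord0 mulr0 addr0.
by rewrite /ee mul0r expi2pi0 conjc1 mulr1.
Qed.

Lemma qsum_ge0 n v : 0 <= qsum n v.
Proof. by apply: sumr_ge0 => w _; rewrite sqr_ge0. Qed.

(** A trailing 0 does not change the frame element. The recursion reduces this to the empty word,
    where the term of the letter 0 already gives the same integral. *)
Lemma qsum_mono n v : in_L2 mu v -> qsum n v <= qsum n.+1 v.
Proof.
elim: n v => [|n IH] v vL; last first.
  by rewrite qsumS// [leRHS]qsumS//; apply: ler_sum => l _; apply: IH; exact: Vop_in_L2.
rewrite qsumS// (bigD1_seq 0)//= !qsum0 cintegral_Vop0// lerDl.
by apply: sumr_ge0 => l _; exact: qsum_ge0.
Qed.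

Lemma Vop_ee l t x : Vop l (ee t) x = conjc (alpha l) * mB B (gmap Rr l t) * ee (gmap Rr l t) x.
Proof.
have NE : (N^-1)%:C%C = ((size B)%:R)^-1 :> R[i] by rewrite fmorphV rmorph_nat.
rewrite /Vop /mB NE [RHS](_ : _ = (size B)%:R^-1 * ((\sum_(b <- B) ee b%:~R (gmap Rr l t))
   * (conjc (alpha l) * ee (gmap Rr l t) x))); last by ring.
congr (_ * _); rewrite mulr_suml; apply: eq_bigr => b _.
rewrite (conjcM (alpha l)) mulrCA [RHS]mulrCA; congr (_ * _).
rewrite /ee conjc_expi2pi -!expi2piD; congr expi2pi.
by rewrite /tau /gmap; field; exact: base_neq0.
Qed.

Lemma qsumZ n v c : in_L2 mu v -> qsum n (fun x => c * v x) = normc c ^+ 2 * qsum n v.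
Proof.
move=> vL; rewrite /qsum mulr_sumr; apply: eq_bigr => w _.
rewrite -exprMn -Normc.normcM /l2inner -cintegralZ; last exact: l2inner_frame_in_L2.
by congr (normc (cintegral _ _) ^+ 2); apply/funext => x; rewrite mulrA.
Qed.

(** [Vop l] sends e_t to a multiple of e_{g_l t}, so on exponentials the recursion for frame sums is
    the transfer operator. *)
Lemma qsum_ee n t : qsum n.+1 (ee t) = \sum_(l <- L) wt l t * qsum n (ee (gmap Rr l t)).
Proof.
rewrite qsumS; last exact: in_L2_ee.
apply: eq_bigr => l _; rewrite /weight -exprMn -(normc_conjc (alpha l)) -Normc.normcM.
rewrite -qsumZ; last exact: in_L2_ee.
by congr qsum; apply/funext => x; exact: Vop_ee.
Qed.

Lemma qsum_parallelogram n u v : in_L2 mu u -> in_L2 mu v ->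
  qsum n (fun x => u x + v x) + qsum n (fun x => u x - v x) = 2 * qsum n u + 2 * qsum n v.
Proof.
move=> uL' vL; rewrite /qsum -big_split !mulr_sumr -big_split; apply: eq_bigr => w _.
have D : l2inner mu (fun x => u x + v x) (frame w) = l2inner mu u (frame w) + l2inner mu v (frame w).
  rewrite /l2inner -cintegralD; try exact: l2inner_frame_in_L2.
  by congr cintegral; apply/funext => x; rewrite mulrDl.
have S : l2inner mu (fun x => u x - v x) (frame w) = l2inner mu u (frame w) - l2inner mu v (frame w).
  rewrite -mulN1r /l2inner -cintegralZ; last exact: l2inner_frame_in_L2.
  rewrite -cintegralD; [|exact: l2inner_frame_in_L2|apply: in_L2Z; exact: l2inner_frame_in_L2].
  by congr cintegral; apply/funext => x; rewrite mulN1r mulrBl.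
have := normc_parallelogram (l2inner mu u (frame w)) (l2inner mu v (frame w)).
by rewrite -D -S.
Qed.

Definition defect n v : R := norm2 mu v - qsum n v.

Lemma defect_ge0 n v : in_L2 mu v -> 0 <= defect n v.
Proof. by move=> vL; rewrite subr_ge0 bessel. Qed.

Lemma defect_le n v : defect n v <= norm2 mu v.
Proof. by rewrite gerBl qsum_ge0. Qed.

(** The defect obeys the parallelogram law, since the norm and the frame sum both do; its value at u
    - v is nonnegative by Bessel and is dropped. *)
Lemma defectD n u v : in_L2 mu u -> in_L2 mu v ->
  defect n (fun x => u x + v x) <= 2 * defect n u + 2 * defect n v.
Proof.
move=> uL' vL.
have wL : in_L2 mu (fun x => u x - v x).
  rewrite (_ : (fun x => _) = fun x => u x + -1 * v x); first by apply: in_L2D => //; exact: in_L2Z.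
  by apply/funext => x; rewrite mulN1r.
have := defect_ge0 n wL; rewrite /defect.
have := norm2_parallelogram uL' vL; have := qsum_parallelogram n uL' vL; lra.
Qed.

Lemma defectZ n v c : in_L2 mu v -> defect n (fun x => c * v x) = normc c ^+ 2 * defect n v.
Proof. by move=> vL; rewrite /defect norm2Z// qsumZ// mulrBr. Qed.

End AnalysisOperators.

                                             

(** * The closed subspace of vectors with vanishing defect *)

Section Density.
Variables (R : realType) (mu : probability R R).
Local Notation normc := (@Normc.normc R).
Implicit Types u v p g : R -> R[i].

Lemma in_L2B u v : in_L2 mu u -> in_L2 mu v -> in_L2 mu (fun x => u x - v x).
Proof.
move=> uL vL; rewrite (_ : (fun x => _) = fun x => u x + -1 * v x).
  by apply: in_L2D => //; exact: in_L2Z.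
by apply/funext => x; rewrite mulN1r.
Qed.

Lemma norm2_dominated (p : nat -> R -> R[i]) v g : (forall k, in_L2 mu (p k)) -> in_L2 mu v ->
  in_L2 mu g -> (forall k x, normc (p k x) <= normc (g x)) -> (forall x, normc (v x) <= normc (g x)) ->
  (forall x, normc (v x - p k x) ^+ 2 @[k --> \oo] --> (0 : R)) ->
  norm2 mu (fun x => v x - p k x) @[k --> \oo] --> (0 : R).
Proof.
move=> pL vL gL pg vg pv.
have m2 w : in_L2 mu w -> measurable_fun setT (fun x => (normc (w x) ^+ 2)%:E).
  by move=> /in_L2_cmeas mw; apply/measurable_EFinP; exact: measurable_normc2.
have ig : mu.-integrable setT (fun x => 4%:E * (normc (g x) ^+ 2)%:E)%E.
  apply: integrableZl => //; apply/integrableP; split; first exact: m2.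
  under eq_integral do rewrite gee0_abs ?lee_fin ?sqr_ge0//.
  by case: gL.
have [||||_ _ H] := @dominated_convergence _ _ R mu setT measurableT
  (fun k x => (normc (v x - p k x) ^+ 2)%:E) (fun=> 0%E) _ _ _ _ ig.
- by move=> k; apply: m2; exact: in_L2B.
- exact: measurable_cst.
- by apply/aeW => x _; apply/fine_cvgP; split; [exact: nearW|exact: pv].
- apply/aeW => x k _; rewrite gee0_abs ?lee_fin ?sqr_ge0//.
  rewrite (_ : 4 * normc (g x) ^+ 2 = (normc (g x) + normc (g x)) ^+ 2); last by ring.
  rewrite ler_pXn2r ?nnegrE ?normc_ge0 ?addr_ge0 ?normc_ge0//.
  by apply: le_trans (le_normcD _ _) _; rewrite normcN lerD.
by move: H; rewrite integral0 => /fine_cvg.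
Qed.

Variable D : nat -> (R -> R[i]) -> R.
Hypothesis D_ge0 : forall n v, in_L2 mu v -> 0 <= D n v.
Hypothesis D_le : forall n v, D n v <= norm2 mu v.
Hypothesis D_add : forall n u v, in_L2 mu u -> in_L2 mu v ->
  D n (fun x => u x + v x) <= 2 * D n u + 2 * D n v.
Hypothesis D_scale : forall n v c, in_L2 mu v -> D n (fun x => c * v x) = normc c ^+ 2 * D n v.

(** [D] abstracts the Bessel defect. The four hypotheses on it make these vectors a norm-closed
    linear subspace. *)
Definition nul v := in_L2 mu v /\ D n v @[n --> \oo] --> (0 : R).

Lemma nulP v : nul v <-> in_L2 mu v /\ forall e, 0 < e -> \forall n \near \oo, D n v <= e.
Proof.
split=> -[vL H]; split => //.
  move=> e e0; have /cvgrPdist_le/(_ _ e0) := H; apply: filterS => n.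
  by rewrite sub0r normrN; apply: le_trans; exact: ler_norm.
apply/cvgrPdist_le => e e0; have := H _ e0; apply: filterS => n.
by rewrite sub0r normrN ger0_norm// D_ge0.
Qed.

Lemma nulD u v : nul u -> nul v -> nul (fun x => u x + v x).
Proof.
move=> /nulP[uL uH] /nulP[vL vH]; apply/nulP; split; first exact: in_L2D.
move=> e e0; have e4 : 0 < e / 4 by rewrite divr_gt0.
near=> n.
have h1 : D n u <= e / 4 by near: n; exact: uH.
have h2 : D n v <= e / 4 by near: n; exact: vH.
have := D_add n uL vL; lra.
Unshelve. all: by end_near.
Qed.

Lemma nulZ v c : nul v -> nul (fun x => c * v x).
Proof.
move=> [vL vH]; split; first exact: in_L2Z.
rewrite (_ : (fun n => _) = fun n => normc c ^+ 2 * D n v).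
  by rewrite -[X in _ --> X](mulr0 (normc c ^+ 2)); apply: cvgM => //; exact: cvg_cst.
by apply/funext => n; rewrite D_scale.
Qed.

Lemma nul_lim v : in_L2 mu v ->
  (forall e, 0 < e -> exists2 p, nul p & norm2 mu (fun x => v x - p x) <= e) -> nul v.
Proof.
move=> vL H; apply/nulP; split => // e e0; have e4 : 0 < e / 4 by rewrite divr_gt0.
have [p /nulP[pL pH] vp] := H _ e4.
near=> n.
have h1 : D n p <= e / 4 by near: n; exact: pH.
have := D_add n pL (in_L2B vL pL); have := D_le n (fun x => v x - p x).
rewrite (_ : (fun x => p x + (v x - p x)) = v); last by apply/funext => x; rewrite addrC subrK.
lra.
Unshelve. all: by end_near.
Qed.

Lemma nul_dominated (p : nat -> R -> R[i]) v g : (forall k, nul (p k)) -> in_L2 mu v ->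
  in_L2 mu g -> (forall k x, normc (p k x) <= normc (g x)) -> (forall x, normc (v x) <= normc (g x)) ->
  (forall x, normc (v x - p k x) ^+ 2 @[k --> \oo] --> (0 : R)) -> nul v.
Proof.
move=> pN vL gL pg vg pv; apply: nul_lim => // e e0.
have pL k : in_L2 mu (p k) by case: (pN k).
have /cvgrPdist_le/(_ _ e0)[k _ H] := norm2_dominated pL vL gL pg vg pv.
exists (p k) => //; have := H k (leqnn k).
by rewrite /= sub0r normrN; apply: le_trans; exact: ler_norm.
Qed.

Definition cR (f : R -> R) : R -> R[i] := fun x => (f x)%:C%C.

Lemma cmeas_cR f : measurable_fun setT f -> cmeas (cR f).
Proof. by move=> mf; split => //; exact: measurable_cst. Qed.

Lemma sqr_diff_cvg0 (a : nat -> R) (l : R) : a k @[k --> \oo] --> l ->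
  (l - a k) * (l - a k) @[k --> \oo] --> (0 : R).
Proof.
move=> al; have h : l - a k @[k --> \oo] --> l - l by apply: cvgB => //; exact: cvg_cst.
by rewrite subrr in h; rewrite -[X in _ --> X](mulr0 (0 : R)); exact: (cvgM h h).
Qed.

Lemma nul_bounded (f_ : nat -> R -> R) (f : R -> R) :
  (forall k, nul (cR (f_ k))) -> (forall k x, 0 <= f_ k x <= 1) ->
  (forall x, f_ k x @[k --> \oo] --> f x) -> nul (cR f).
Proof.
move=> fN f01 ff.
have mf_ k : measurable_fun setT (f_ k) by have [[]] := fN k.
have mf : measurable_fun setT f.
  by apply: (measurable_fun_cvg mf_) => x _; exact: ff.
have f1 x : 0 <= f x <= 1.
  apply/andP; split.
    by apply: (cvgr_to_ge (ff x)); apply: nearW => k; have /andP[] := f01 k x.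
  by apply: (cvgr_to_le (ff x)); apply: nearW => k; have /andP[] := f01 k x.
have le1 (y : R) : 0 <= y <= 1 -> normc y%:C%C <= normc (1 : R[i]).
  by move=> /andP[y0 y1]; rewrite (@Normc.normc1 R) normc_real ger0_norm.
have oneL : in_L2 mu (fun=> 1).
  by apply: (@in_L2_bounded R mu _ 1) => [|x]; [exact: cmeas_cst|rewrite (@Normc.normc1 R)].
apply: (nul_dominated fN _ oneL) => [|k x|x|x].
- apply: (@in_L2_bounded R mu _ 1 (cmeas_cR mf)) => x.
  by rewrite -(@Normc.normc1 R); exact: le1.
- exact: le1.
- exact: le1.
- rewrite (_ : (fun k => _) = fun k => (f x - f_ k x) * (f x - f_ k x)); last first.
    by apply/funext => k; rewrite /cR -rmorphB normc_real real_normK ?num_real.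
  exact: sqr_diff_cvg0.
Qed.

(** * From exponentials to all of L^2 *)

Inductive trig : (R -> R[i]) -> Prop :=
| trig_ee t : trig (ee t)
| trig_add p q : trig p -> trig q -> trig (fun x => p x + q x)
| trig_scale c p : trig p -> trig (fun x => c * p x).

Lemma trig_mul p q : trig p -> trig q -> trig (fun x => p x * q x).
Proof.
move=> tp tq; elim: tp => {p} [t|p p' _ IH _ IH'|c p _ IH].
- elim: tq => {q} [t'|p p' _ IH _ IH'|c p _ IH].
  + rewrite (_ : (fun x => _) = ee (t + t')); first exact: trig_ee.
    by apply/funext => x; rewrite /ee mulrDl expi2piD.
  + rewrite (_ : (fun x => _) = fun x => ee t x * p x + ee t x * p' x); first exact: trig_add.
    by apply/funext => x; rewrite mulrDr.
  + rewrite (_ : (fun x => _) = fun x => c * (ee t x * p x)); first exact: trig_scale.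
    by apply/funext => x; rewrite mulrCA.
- rewrite (_ : (fun x => _) = fun x => p x * q x + p' x * q x); first exact: trig_add.
  by apply/funext => x; rewrite mulrDl.
- rewrite (_ : (fun x => _) = fun x => c * (p x * q x)); first exact: trig_scale.
  by apply/funext => x; rewrite mulrA.
Qed.

Lemma trig_cst c : trig (fun=> c).
Proof.
rewrite (_ : (fun=> c) = fun x => c * ee 0 x); first by apply: trig_scale; exact: trig_ee.
by apply/funext => x; rewrite /ee mul0r expi2pi0 mulr1.
Qed.

Lemma trig_exp p n : trig p -> trig (fun x => p x ^+ n).
Proof.
move=> tp; elim: n => [|n IH]; first exact: trig_cst.
rewrite (_ : (fun x => _) = fun x => p x * p x ^+ n); first exact: trig_mul.
by apply/funext => x; rewrite exprS.
Qed.

(** A trigonometric polynomial with values in [0, 1] that is below 1/2 exactly where the sine is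
    negative; [step_cvg] sharpens it to an indicator function. *)
Definition bump (t a x : R) : R := (1 + sin (2 * pi * (t * (x - a)))) / 2.

Lemma bump_bounds t a x : 0 <= bump t a x <= 1.
Proof.
rewrite /bump; have := sin_le1 (2 * pi * (t * (x - a))).
have := sin_geN1 (2 * pi * (t * (x - a))); lra.
Qed.

Lemma trig_bump t a : trig (cR (bump t a)).
Proof.
pose c : R[i] := Complex 0 (- (1 / 4)).
rewrite (_ : cR (bump t a) = fun x => (1 / 2) +
   (c * expi2pi (- (t * a)) * ee t x + (- c) * expi2pi (t * a) * ee (- t) x)).
  apply: trig_add; first exact: trig_cst.
  by apply: trig_add; apply: trig_scale; exact: trig_ee.
apply/funext => x; rewrite /ee -!mulrA -!expi2piD.
rewrite (_ : - (t * a) + t * x = t * (x - a)); last by ring.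
rewrite (_ : t * a + - t * x = - (t * (x - a))); last by ring.
rewrite -conjc_expi2pi /cR /bump /c.
rewrite (_ : 1 / 2 = ((1 / 2 : R)%:C)%C); last first.
  by rewrite rmorphM rmorph1 fmorphV rmorph_nat.
by rewrite /expi2pi /=; congr Complex; field.
Qed.

Lemma bernoulli_sub (y : R) m : 0 <= y <= 1 -> 1 - m%:R * y <= (1 - y) ^+ m.
Proof.
move=> /andP[y0 y1]; elim: m => [|m IH]; first by rewrite mul0r subr0 expr0.
rewrite exprS; apply: (@le_trans _ _ ((1 - y) * (1 - m%:R * y))); last first.
  by apply: ler_wpM2l => //; lra.
have : 0 <= m%:R * y * y by rewrite !mulr_ge0.
rewrite -natr1; lra.
Qed.

Lemma bernoulli_inv (y : R) m : 0 <= y <= 1 -> (1 - y) ^+ m <= (1 + m%:R * y)^-1.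
Proof.
move=> /andP[y0 y1].
have b : 1 + m%:R * y <= (1 + y) ^+ m.
  elim: m => [|m IH]; first by rewrite mul0r addr0 expr0.
  rewrite exprS; apply: (@le_trans _ _ ((1 + y) * (1 + m%:R * y))); last first.
    by apply: ler_wpM2l => //; lra.
  have : 0 <= m%:R * y * y by rewrite !mulr_ge0.
  rewrite -natr1; lra.
have p : 0 < 1 + m%:R * y by rewrite ltr_pwDl// mulr_ge0.
rewrite -[leRHS]mul1r ler_pdivlMr//.
apply: (@le_trans _ _ ((1 - y) ^+ m * (1 + y) ^+ m)).
  by apply: ler_wpM2l => //; rewrite exprn_ge0//; lra.
rewrite -exprMn exprn_ile1//; first by rewrite mulr_ge0; lra.
by have := mulr_ge0 y0 y0; lra.
Qed.

Lemma natr_expr_cvg0 (q : R) : 0 <= q < 1 -> n%:R * q ^+ n @[n --> \oo] --> (0 : R).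
Proof.
move=> /andP[q0 q1].
pose r := Num.sqrt q.
have r0 : 0 <= r by exact: sqrtr_ge0.
have rq : r * r = q by rewrite -expr2 sqr_sqrtr.
have r1 : r < 1 by rewrite -(@ltr_pXn2r _ 2)// ?nnegrE// expr2 rq expr1n.
have key n : n%:R * r ^+ n * (1 - r) <= 1 - r ^+ n.
  elim: n => [|n IH]; first by rewrite !mul0r expr0 subrr.
  have x0 : 0 <= r ^+ n by rewrite exprn_ge0.
  have x1 : r ^+ n.+1 <= 1 by rewrite exprn_ile1// ltW.
  have : r * (n%:R * r ^+ n * (1 - r)) <= r * (1 - r ^+ n) by rewrite ler_wpM2l.
  have : 0 <= (1 - r) * (1 - r ^+ n.+1) by rewrite mulr_ge0; lra.
  rewrite -natr1 exprS.
  move: (r ^+ n) x0 => y y0; move: (n%:R) => c.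
  rewrite (_ : (c + 1) * (r * y) * (1 - r) = r * (c * y * (1 - r)) + r * y * (1 - r)); last by ring.
  lra.
apply: (@squeeze_cvgr _ _ _ _ (cst 0) (fun n => (1 - r)^-1 * r ^+ n)).
- apply: nearW => n; rewrite mulr_ge0 ?exprn_ge0//=.
  rewrite -rq exprMn mulrA ler_wpM2r ?exprn_ge0//.
  rewrite -[leRHS]mul1r ler_pdivlMr; last lra.
  by apply: le_trans (key n) _; rewrite gerBl exprn_ge0.
- exact: cvg_cst.
- rewrite -[X in _ --> X](mulr0 (1 - r)^-1); apply: cvgM; first exact: cvg_cst.
  by apply: cvg_expr; rewrite ger0_norm.
Qed.

(** Step polynomials as in elementary proofs of the Stone-Weierstrass theorem. Bernoulli's
    inequality gives the lower bound 1 - n (2 y)^n for y < 1/2 and the upper bound 1 / (1 + n) for y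
    >= 1/2. The factor n in the exponent settles the borderline y = 1/2. *)
Lemma step_cvg (y : R) : 0 <= y <= 1 ->
  (1 - y ^+ n) ^+ (n * 2 ^ n) @[n --> \oo] --> ((y < 1 / 2)%R%:R : R).
Proof.
move=> /andP[y0 y1].
have yn n : 0 <= y ^+ n <= 1 by rewrite exprn_ge0// exprn_ile1.
have [ylt|yge] := ltP y (1 / 2).
  have H : n%:R * (2 * y) ^+ n @[n --> \oo] --> (0 : R) by apply: natr_expr_cvg0; lra.
  apply: (@squeeze_cvgr _ _ _ _ (fun n => 1 - n%:R * (2 * y) ^+ n) (cst 1)).
  - apply: nearW => n; apply/andP; split.
      apply: le_trans (bernoulli_sub _ (yn n)); rewrite exprMn natrM natrX mulrA.
      exact: lexx.
    by have /andP[h1 h2] := yn n; rewrite exprn_ile1//; lra.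
  - by rewrite -[X in _ --> X](subr0 (1 : R)); apply: cvgB => //; exact: cvg_cst.
  - exact: cvg_cst.
apply: (@squeeze_cvgr _ _ _ _ (cst 0) (@harmonic R)).
- apply: nearW => n; apply/andP; split.
    by have /andP[h1 h2] := yn n; rewrite exprn_ge0//; lra.
  apply: le_trans (bernoulli_inv _ (yn n)) _.
  have h : 1 <= 2 ^+ n * y ^+ n by rewrite -exprMn exprn_ege1//; lra.
  have n0 : n%:R <= (n * 2 ^ n)%:R * y ^+ n.
    by rewrite natrM natrX -mulrA ler_peMr.
  rewrite /harmonic lef_pV2 ?posrE//; first by rewrite -natr1 addrC lerD2l.
  by rewrite ltr_pwDl// mulr_ge0// exprn_ge0.
- exact: cvg_cst.
- exact: cvg_harmonic.
Qed.

Hypothesis nul_ee : forall t, nul (ee t).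

Lemma nul_trig p : trig p -> nul p.
Proof.
by elim => [t|p1 p2 _ h1 _ h2|c p1 _ h]; [exact: nul_ee|exact: nulD|exact: nulZ].
Qed.

Lemma nul_sin_neg t a : nul (cR (fun x => (sin (2 * pi * (t * (x - a))) < 0)%R%:R)).
Proof.
apply: (@nul_bounded (fun n x => (1 - bump t a x ^+ n) ^+ (n * 2 ^ n))) => [n|n x|x].
- apply: nul_trig.
  rewrite (_ : cR _ = fun x => (1 + -1 * cR (bump t a) x ^+ n) ^+ (n * 2 ^ n)).
    apply: trig_exp; apply: trig_add; first exact: trig_cst.
    by apply: trig_scale; apply: trig_exp; exact: trig_bump.
  by apply/funext => x; rewrite /cR mulN1r rmorphXn rmorphB rmorph1 rmorphXn.
- have /andP[h1 h2] := bump_bounds t a x.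
  have h3 : 0 <= bump t a x ^+ n by rewrite exprn_ge0.
  have h4 : bump t a x ^+ n <= 1 by rewrite exprn_ile1.
  by rewrite exprn_ge0 ?exprn_ile1//; lra.
- rewrite (_ : (sin _ < 0) = (bump t a x < 1 / 2)); first exact: step_cvg (bump_bounds t a x).
  by rewrite /bump ltr_pM2r// gtrDl.
Qed.

(** For fixed x and large n the argument 2 pi (x - a) / (n + 1) lies strictly between -pi and pi,
    where the sine has the sign of x - a. So the half-line is a pointwise limit of the sets where a
    sine of growing period is negative. *)
Lemma nul_ray a : nul (cR (fun x => (x < a)%R%:R)).
Proof.
apply: (@nul_bounded (fun n x => (sin (2 * pi * (n.+1%:R^-1 * (x - a))) < 0)%R%:R)) => [n|n x|x].
- exact: nul_sin_neg.
- by case: (_ < 0) => /=; rewrite ?lexx ?ler01.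
- apply: cvg_near_cst.
  have small : \forall n \near \oo, n.+1%:R^-1 * (2 * `|x - a|) < 1 :> R.
    have H : n.+1%:R^-1 * (2 * `|x - a|) @[n --> \oo] --> (0 : R).
      rewrite -[X in _ --> X](mul0r (2 * `|x - a|)); apply: cvgM; last exact: cvg_cst.
      exact: cvg_harmonic.
    exact: (cvgr_lt _ H).
  apply: filterS small => n hn.
  have p0 : 0 < pi :> R by exact: pi_gt0.
  have n0 : 0 < n.+1%:R^-1 :> R by rewrite invr_gt0.
  move: hn n0; move: (n.+1%:R^-1 : R) => k hn n0.
  have [xa|xa|xa] := ltgtP x a.
  + have : 0 < sin (2 * pi * (k * (a - x))).
      apply: sin_gt0_pi; apply/andP; split; first by rewrite !mulr_gt0// subr_gt0.
      rewrite -[ltRHS]mulr1 (_ : 2 * pi * (k * (a - x)) = pi * (k * (2 * (a - x)))); last by ring.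
      by rewrite ltr_pM2l//; move: hn; rewrite distrC gtr0_norm// subr_gt0.
    rewrite (_ : 2 * pi * (k * (x - a)) = - (2 * pi * (k * (a - x)))); last by ring.
    by rewrite sinN oppr_lt0 => ->.
  + have : 0 < sin (2 * pi * (k * (x - a))).
      apply: sin_gt0_pi; apply/andP; split; first by rewrite !mulr_gt0// subr_gt0.
      rewrite -[ltRHS]mulr1 (_ : 2 * pi * (k * (x - a)) = pi * (k * (2 * (x - a)))); last by ring.
      by rewrite ltr_pM2l//; move: hn; rewrite gtr0_norm// subr_gt0.
    by move/ltW; rewrite leNgt => /negbTE ->.
  + by rewrite xa subrr !mulr0 sin0 ltxx.
Qed.

(** Dynkin's pi-lambda theorem, starting from open half-lines; disjoint unions are bounded limits of
    their partial sums. *)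
Lemma nul_indic (E : set R) : measurable E -> nul (cR (\1_E : R -> R)).
Proof.
move=> mE.
have GE : @measurable _ R = <<s @RGenInftyO.G R >> by exact: RGenInftyO.measurableE.
have mE' : (<<s @RGenInftyO.G R >>) E by rewrite -GE.
apply: (@dynkin_induction _ R (@RGenInftyO.G R) (fun E => nul (cR (\1_E : R -> R)))) mE' => //.
- move=> _ _ [a ->] [b ->]; exists (Num.min a b).
  by apply/seteqP; split => x /=; rewrite !in_itv /= lt_min => /andP.
- rewrite (_ : cR _ = ee 0); first exact: nul_ee.
  by apply/funext => x; rewrite /cR indicT /ee mul0r expi2pi0.
- move=> _ [a ->]; rewrite (_ : cR _ = cR (fun x => (x < a)%R%:R)); first exact: nul_ray.
  apply/funext => x; rewrite /cR indicE; congr (_%:R%:C)%C.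
  by rewrite mem_setE in_itv.
- move=> S mS nS; rewrite (_ : cR _ = fun x => ee 0 x + -1 * cR (\1_S : R -> R) x).
    by apply: nulD => //; exact: nulZ.
  apply/funext => x; rewrite /cR !indicE in_setC /ee mul0r expi2pi0.
  by case: (x \in S); rewrite /= ?mulr1 ?subrr// mulr0 addr0.
- move=> F mF tF nF.
  have part n : nul (cR (fun x => \sum_(k < n) \1_(F k) x)).
    elim: n => [|n IH].
      rewrite (_ : cR _ = fun x => 0 * ee 0 x); first exact: nulZ.
      by apply/funext => x; rewrite /cR big_ord0 mul0r.
    rewrite (_ : cR _ = fun x => cR (fun x => \sum_(k < n) \1_(F k) x) x + cR (\1_(F n) : R -> R) x).
      exact: nulD.
    by apply/funext => x; rewrite /cR big_ord_recr rmorphD.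
  have val0 n x : (forall k, (k < n)%N -> ~ F k x) -> \sum_(k < n) \1_(F k) x = 0 :> R.
    by move=> H; apply: big1 => k _; rewrite indicE memNset//; exact: H.
  have val1 n x k : (k < n)%N -> F k x -> \sum_(k < n) \1_(F k) x = 1 :> R.
    move=> kn Fkx; rewrite (bigD1 (Ordinal kn))//= indicE mem_set// big1 ?addr0// => j jk.
    rewrite indicE memNset// => Fjx; move/eqP: jk; apply; apply: val_inj => /=.
    by apply: tF => //; exists x.
  apply: (@nul_bounded (fun n x => \sum_(k < n) \1_(F k) x)) => // [n x|x].
    have [[k kn Fkx]|nF'] := pselect (exists2 k, (k < n)%N & F k x).
      by rewrite (val1 _ _ _ kn Fkx) lexx ler01.
    by rewrite val0 ?lexx ?ler01// => k kn Fkx; apply: nF'; exists k.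
  apply: cvg_near_cst; rewrite indicE.
  have [[k Fkx]|nF'] := pselect (exists k, F k x).
    rewrite mem_set; last by exists k.
    near=> n; apply: (val1 _ _ k) => //.
    by near: n; exact: nbhs_infty_gt.
  rewrite memNset; last by move=> [k _ Fkx]; apply: nF'; exists k.
  by apply: nearW => n; apply: val0 => k _ Fkx; apply: nF'; exists k.
Unshelve. all: by end_near.
Qed.

Import HBNNSimple.

Lemma nul_nnsfun (f : {nnsfun R >-> R}) : nul (cR f).
Proof.
rewrite (_ : cR f = fun x => \sum_(y <- finmap.enum_fset (fset_set (range f))) y%:C%C * cR (\1_(f @^-1` [set y]) : R -> R) x).
  elim: (finmap.enum_fset _) => [|y s IH].
    rewrite (_ : (fun x => _) = fun x => 0 * ee 0 x); first exact: nulZ.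
    by apply/funext => x; rewrite big_nil mul0r.
  rewrite (_ : (fun x => _) = fun x => y%:C%C * cR (\1_(f @^-1` [set y]) : R -> R) x +
     \sum_(y <- s) y%:C%C * cR (\1_(f @^-1` [set y]) : R -> R) x).
    by apply: nulD => //; apply: nulZ; apply: nul_indic.
  by apply/funext => x; rewrite big_cons.
apply/funext => x; rewrite /cR {1}fimfunE fsbig_finite//= rmorph_sum.
by apply: eq_bigr => y _; rewrite rmorphM.
Qed.

Lemma nul_nonneg (f : R -> R) : (forall x, 0 <= f x) -> in_L2 mu (cR f) -> nul (cR f).
Proof.
move=> f0 fL.
have mf : measurable_fun setT (EFin \o f) by apply/measurable_EFinP; case: fL.
pose a n : R -> R := nnsfun_approx measurableT mf n.
have ac x : a n x @[n --> \oo] --> f x.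
  have := cvg_nnsfun_approx measurableT mf (fun x _ => f0 x) (x := x) I.
  by move/fine_cvg.
have ale n x : a n x <= f x.
  have nd : nondecreasing_seq (a ^~ x).
    by move=> i j ij; have /lefP := nd_nnsfun_approx measurableT mf ij; apply.
  have <- : limn (a ^~ x) = f x by apply/cvg_lim => //; exact: ac.
  by apply: nondecreasing_cvgn_le => //; apply/cvg_ex; exists (f x); exact: ac.
have a0 n x : 0 <= a n x by exact: fun_ge0.
apply: (@nul_dominated (fun n => cR (a n)) _ (cR f)) => // [n|n x|x].
- exact: nul_nnsfun.
- by rewrite !normc_real !ger0_norm.
- rewrite (_ : (fun k => _) = fun k => (f x - a k x) * (f x - a k x)); last first.
    by apply/funext => k; rewrite /cR -rmorphB normc_real real_normK ?num_real.
  exact: sqr_diff_cvg0.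
Qed.

Lemma nul_real (f : R -> R) : in_L2 mu (cR f) -> nul (cR f).
Proof.
move=> fL.
have mf : measurable_fun setT f by case: fL.
have mabs : measurable_fun setT (fun x => `|f x|) by exact: measurableT_comp.
pose p x := (`|f x| + f x) / 2; pose n x := (`|f x| - f x) / 2.
have part (g : R -> R) : measurable_fun setT g -> (forall x, 0 <= g x <= `|f x|) -> nul (cR g).
  move=> mg gf; apply: nul_nonneg => [x|]; first by have /andP[] := gf x.
  apply: (in_L2_le (K := 1) (cmeas_cR mg) fL) => x; rewrite mul1r !normc_real.
  by have /andP[h1 h2] := gf x; rewrite ler_pXn2r ?nnegrE// ger0_norm.
rewrite (_ : cR f = fun x => cR p x + -1 * cR n x); last first.
  by apply/funext => x; rewrite /cR mulN1r -rmorphB; congr (_%:C)%C; rewrite /p /n; field.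
apply: nulD; last apply: nulZ; apply: part => [|x]; rewrite /p /n.
- by apply: measurable_funM => //; exact: measurable_funD.
- by have := ler_norm (f x); have := ler_norm (- f x); rewrite normrN; lra.
- by apply: measurable_funM => //; exact: measurable_funB.
- by have := ler_norm (f x); have := ler_norm (- f x); rewrite normrN; lra.
Qed.

Lemma nul_in_L2 v : in_L2 mu v -> nul v.
Proof.
move=> vL; have [m1 m2] := in_L2_cmeas vL.
rewrite (_ : v = fun x => cR (fun x => complex.Re (v x)) x + 'i%C * cR (fun x => complex.Im (v x)) x).
  apply: nulD; last apply: nulZ; apply: nul_real.
    apply: (in_L2_le (K := 1) (cmeas_cR m1) vL) => x; rewrite mul1r.
    by rewrite normc_real real_normK ?num_real// sqr_normcE lerDl sqr_ge0.
  apply: (in_L2_le (K := 1) (cmeas_cR m2) vL) => x; rewrite mul1r.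
  by rewrite normc_real real_normK ?num_real// sqr_normcE lerDr sqr_ge0.
by apply/funext => x; rewrite [LHS]complexE.
Qed.

End Density.

                  

(** * Reduced words and the sum over Omega *)

Section Frame.
Variables (R : realType) (Rr : int) (B L : seq int) (mu : probability R R) (alpha : int -> R[i]).
Local Notation normc := (@Normc.normc R).
Hypothesis Rr2 : 2 <= `|Rr|.
Hypothesis uB : uniq B.
Hypothesis B0 : 0 \in B.
Hypothesis muI : is_invariant_measure Rr B mu.
Hypothesis uL : uniq L.
Hypothesis L0 : 0 \in L.
Hypothesis alpha0 : alpha 0 = 1.
Hypothesis ortho : orthonormal_columns Rr B L alpha.

Local Notation Rz := (Rr%:~R : R).
Local Notation frame := (frame_elt Rr alpha).
Local Notation wt := (@weight R Rr B alpha).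
Local Notation qs := (qsum Rr L mu alpha).
Local Notation dfc := (defect Rr L mu alpha).
Local Notation wrd := (words L).

Lemma mem_words n w : (w \in wrd n) = (size w == n) && all (fun l => l \in L) w.
Proof.
elim: n w => [|n IH] [|l w] //=.
  by apply/negbTE/negP => /allpairsP[[l' w'] /= [_ _]].
apply/allpairsP/andP => [[[l' w'] /= [lL ww [-> ->]]]|[/eqP[sw] /andP[lL wL]]].
  by move: ww; rewrite IH => /andP[/eqP -> ->]; rewrite eqxx lL.
by exists (l, w); split => //=; rewrite IH sw eqxx.
Qed.

Lemma words_uniq n : uniq (wrd n).
Proof.
elim: n => [//|n IH] /=; apply: allpairs_uniq => //.
by move=> [l w] [l' w'] _ _ [-> ->].
Qed.

(** Removes trailing zeros. Inverse to zero padding, it matches the words of length n with those of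
    Omega of length at most n, and it keeps the frame element because alpha_0 = 1. *)
Fixpoint strip (w : seq int) : seq int :=
  if w is l :: w' then if (l == 0) && (strip w' == [::]) then [::] else l :: strip w' else [::].

Lemma strip_pad w : strip w ++ nseq (size w - size (strip w)) 0 = w.
Proof.
elim: w => [//|l w IH] /=; case: ifPn => [/andP[/eqP -> /eqP E]|_] /=.
  by move: IH; rewrite E /= subn0 => {1}->.
by rewrite subSS IH.
Qed.

Lemma strip_inj w w' : size w = size w' -> strip w = strip w' -> w = w'.
Proof. by move=> sE E; rewrite -(strip_pad w) -(strip_pad w') sE E. Qed.

Lemma strip_nseq k : strip (nseq k 0) = [::].
Proof. by elim: k => [//|k IH] /=; rewrite IH eqxx. Qed.

Lemma pad_strip w k : w = [::] \/ last 0 w != 0 -> strip (w ++ nseq k 0) = w.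
Proof.
elim: w => [|l w IH] /=; first by rewrite strip_nseq.
case=> // lw; rewrite IH.
  case: w lw {IH} => [|l' w] /=; last by rewrite andbF.
  by move=> /negbTE ->.
by case: w lw {IH} => [|l' w] /= lw; [left|right].
Qed.

Lemma strip_Omega w : all (fun l => l \in L) w -> Omega L (strip w).
Proof.
elim: w => [|l w IH] /=; first by split => //; left.
move=> /andP[lL wL]; have [sL sl] := IH wL.
case: ifPn => [_|]; first by split => //; left.
rewrite negb_and => H; split; first by rewrite /= lL.
right; case: (strip w) sl H {sL} => [|l' w'] /= sl; first by rewrite orbF.
by case: sl.
Qed.

Lemma frame_strip w : frame (strip w) = frame w.
Proof.
suff [pE fE] : \prod_(l <- strip w) alpha l = \prod_(l <- w) alpha l /\
    word_freq Rr (strip w) = word_freq Rr w.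
  by apply/funext => x; rewrite /frame_elt pE fE.
elim: w => [//|l w [IHp IHf]] /=; case: ifPn => [/andP[/eqP -> /eqP E]|_].
  rewrite big_cons word_freq_cons -IHp -IHf E !big_nil alpha0 mulr1.
  by rewrite /word_freq big_ord0 mulr0 addr0.
by rewrite !big_cons !word_freq_cons IHp IHf.
Qed.

Lemma sum_le_subset (T : eqType) (s t : seq T) (a : T -> R) : uniq s -> uniq t ->
  {subset s <= t} -> (forall x, 0 <= a x) -> \sum_(x <- s) a x <= \sum_(x <- t) a x.
Proof.
move=> us ut st a0.
have pe : perm_eq s [seq x <- t | x \in s].
  apply: uniq_perm => //; first exact: filter_uniq.
  by move=> x; rewrite mem_filter andb_idr//; exact: st.
rewrite (perm_big _ pe) big_filter [leRHS](bigID (fun x => x \in s)) /= lerDl.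
by apply: sumr_ge0.
Qed.

(** A finite part of Omega, padded to a common length n, is bounded by Bessel's inequality;
    conversely the words of length n, stripped, form a finite part of Omega. So the sum over Omega
    is the limit of the frame sums, and vanishing defect identifies this limit. *)
Lemma esum_frame v : in_L2 mu v -> nul mu dfc v ->
  (\esum_(w in Omega L) (normc (l2inner mu v (frame w)) ^+ 2)%:E = \int[mu]_x (normc (v x) ^+ 2)%:E)%E.
Proof.
move=> vL [_ dv]; rewrite -norm2E//.
pose a w := normc (l2inner mu v (frame w)) ^+ 2.
have a0 w : 0 <= a w by exact: sqr_ge0.
have astrip w : a (strip w) = a w by rewrite /a frame_strip.
have qE n : qs n v = \sum_(w <- wrd n) a w by [].
have finE (A : set (seq int)) : finite_set A ->
    (\sum_(w \in A) (a w)%:E = (\sum_(w <- finmap.enum_fset (fset_set A)) a w)%:E)%E.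
  by move=> fA; rewrite fsbig_finite// sumEFin.
apply/eqP; rewrite eq_le; apply/andP; split.
  apply: ge_ereal_sup => _ [A [fA AO] <-]; rewrite finE// lee_fin.
  pose s := finmap.enum_fset (fset_set A).
  have sO w : w \in s -> Omega L w.
    by move=> ws; apply: AO; move: ws; rewrite in_fset_set// => /set_mem.
  have us : uniq s by exact: finmap.fset_uniq.
  pose n := \max_(w <- s) size w.
  have sn w : w \in s -> (size w <= n)%N by move=> ws; exact: leq_bigmax_seq.
  pose pad w := w ++ nseq (n - size w) (0 : int).
  apply: le_trans (bessel Rr2 uB B0 muI ortho n vL); rewrite qE.
  have -> : \sum_(w <- s) a w = \sum_(w <- map pad s) a w.
    rewrite big_map; apply: eq_big_seq => w ws; have [_ Ow] := sO _ ws.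
    by rewrite -(astrip (pad w)) pad_strip.
  apply: sum_le_subset => //.
  - rewrite map_inj_in_uniq// => w w' ws ws' E.
    have [_ Ow] := sO _ ws; have [_ Ow'] := sO _ ws'.
    by move: (congr1 strip E); rewrite /pad !pad_strip.
  - exact: words_uniq.
  - move=> _ /mapP[w ws ->]; have [Lw _] := sO _ ws.
    rewrite mem_words /pad size_cat size_nseq subnKC ?sn// eqxx all_cat Lw /=.
    by rewrite all_nseq L0 orbT.
have key n : ((qs n v)%:E <= \esum_(w in Omega L) (a w)%:E)%E.
  apply: esum_ge; pose s := map strip (wrd n).
  have us : uniq s.
    rewrite map_inj_in_uniq ?words_uniq// => w w'; rewrite !mem_words.
    by move=> /andP[/eqP sw _] /andP[/eqP sw' _]; apply: strip_inj; rewrite sw.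
  exists [set` s].
    split; first exact: finite_seq.
    by move=> _ /mapP[w + ->]; rewrite mem_words => /andP[_ /strip_Omega].
  rewrite finE; last exact: finite_seq.
  rewrite lee_fin qE.
  have -> : \sum_(w <- wrd n) a w = \sum_(w <- s) a w.
    by rewrite big_map; apply: eq_bigr => w _; rewrite astrip.
  apply: sum_le_subset => //; first exact: finmap.fset_uniq.
  by move=> w ws; rewrite in_fset_set; [exact/mem_set|exact: finite_seq].
have q_cvg : qs n v @[n --> \oo] --> norm2 mu v.
  rewrite (_ : (fun n => _) = fun n => norm2 mu v - dfc n v); last first.
    by apply/funext => n; rewrite /defect opprB addrC subrK.
  rewrite -[X in _ --> X](subr0 (norm2 mu v)); apply: cvgB => //; exact: cvg_cst.
have e_cvg : (qs n v)%:E @[n --> \oo] --> (norm2 mu v)%:E.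
  by apply/fine_cvgP; split; [exact: nearW|exact: q_cvg].
rewrite -(cvg_lim _ e_cvg)//; apply: lime_le; last exact: nearW.
by apply/cvg_ex; exists (norm2 mu v)%:E.
Qed.

(** * The Fourier transform of mu, the limit of the frame sums, and completeness *)

Definition phat (t : R) : R := normc (cintegral mu (ee t)) ^+ 2.

Lemma phat_refine t : phat t = normc (mB B (t / Rz)) ^+ 2 * phat (t / Rz).
Proof.
rewrite /phat -(cintegral_Vop0 Rr2 uB B0 muI alpha0 (in_L2_ee mu t)).
rewrite (_ : Vop _ _ _ _ _ = fun x => conjc (alpha 0) * mB B (gmap Rr 0 t) * ee (gmap Rr 0 t) x).
  rewrite cintegralZ; last exact: in_L2_ee.
  by rewrite alpha0 conjc1 mul1r Normc.normcM exprMn gmap0.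
by apply/funext => x; rewrite Vop_ee.
Qed.

Lemma cintegral1 : cintegral mu (ee 0) = 1.
Proof.
rewrite /cintegral (_ : (fun x => complex.Re _) = cst 1); last first.
  by apply/funext => x; rewrite /ee mul0r expi2pi0.
rewrite (_ : (fun x => complex.Im _) = cst 0); last first.
  by apply/funext => x; rewrite /ee mul0r expi2pi0.
by rewrite !Rintegral_cst// [X in fine X]probability_setT mul0r mulr1.
Qed.

Lemma expr_base_cvg0 t : t / Rz ^+ k @[k --> \oo] --> (0 : R).
Proof.
rewrite -[X in _ --> X](mulr0 t); apply: cvgM; first exact: cvg_cst.
rewrite (_ : (fun k => _) = fun k => Rz^-1 ^+ k); last by apply/funext => k; rewrite exprVn.
apply: cvg_expr; rewrite normfV; have := normr_base R Rr2 => h.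
by rewrite invf_lt1; lra.
Qed.

(** e_{t / R^k} tends to 1 pointwise and boundedly, hence in L^2, so its integral tends to 1. *)
Lemma phat_cvg t : phat (t / Rz ^+ k) @[k --> \oo] --> (1 : R).
Proof.
pose tk k := t / Rz ^+ k.
have z_cvg : norm2 mu (fun x => ee 0 x - ee (tk k) x) @[k --> \oo] --> (0 : R).
  apply: (@norm2_dominated R mu (fun k => ee (tk k)) (ee 0) (ee 0));
    try (by move=> *; exact: in_L2_ee); try (by move=> *; rewrite !normc_ee).
  move=> x.
  rewrite (_ : (fun k => _) = fun k => 2 - 2 * cos (2 * pi * (tk k * x))); last first.
    apply/funext => k; rewrite sqr_normcE /ee mul0r /expi2pi mulr0 cos0 sin0 /=.
    have := cos2Dsin2 (2 * pi * (tk k * x)); move: (cos _) (sin _) => c s cs.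
    by rewrite sub0r sqrrN sqrrB expr1n mul1r; lra.
  have c1 : cos (2 * pi * (tk k * x)) @[k --> \oo] --> (1 : R).
    have h : 2 * pi * (tk k * x) @[k --> \oo] --> (0 : R).
      have -> : (0 : R) = 2 * pi * (0 * x) by rewrite mul0r mulr0.
      apply: cvgM; first exact: cvg_cst.
      by apply: cvgM; [exact: expr_base_cvg0|exact: cvg_cst].
    have := @continuous_cos R 0; rewrite /continuous_at cos0; exact: cvg_comp h.
  have -> : (0 : R) = 2 - 2 * 1 by ring.
  by apply: cvgB; [exact: cvg_cst|apply: cvgM; [exact: cvg_cst|exact: c1]].
apply/cvgrPdist_le => e e0.
(* If the transform is 1 - z with |z| <= d <= 1, its squared modulus differs from 1 by at most 2 d +
   d^2 <= 3 d. *)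
pose d := Num.min 1 (e / 3).
have d0 : 0 < d by rewrite lt_min ltr01 divr_gt0.
have /cvgrPdist_le/(_ (d ^+ 2)) := z_cvg; rewrite exprn_gt0// => /(_ isT).
apply: filterS => k; rewrite sub0r normrN => hk.
pose z := cintegral mu (fun x => ee 0 x - ee (tk k) x).
have L2d : in_L2 mu (fun x => ee 0 x - ee (tk k) x) by apply: in_L2B; exact: in_L2_ee.
have zd : normc z <= d.
  rewrite -(@ler_pXn2r _ 2)// ?nnegrE ?normc_ge0 ?(ltW d0)//.
  apply: le_trans (normc_cintegral_le L2d) _; apply: le_trans hk; exact: ler_norm.
have zE : cintegral mu (ee (tk k)) = 1 - z.
  have -> : z = cintegral mu (ee 0) + -1 * cintegral mu (ee (tk k)).
    rewrite -cintegralZ; last exact: in_L2_ee.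
    rewrite -cintegralD; [|exact: in_L2_ee|apply: in_L2Z; exact: in_L2_ee].
    by congr cintegral; apply/funext => x; rewrite mulN1r.
  by rewrite cintegral1; ring.
rewrite /phat -/(tk k) zE.
have h1 := normc_subl 1 z; have h2 := le_normcD 1 (- z); rewrite normcN in h2.
rewrite (@Normc.normc1 R) in h1 h2.
have d1 : d <= 1 by rewrite ge_min lexx.
have de : 3 * d <= e.
  have : d <= e / 3 by rewrite ge_min lexx orbT.
  lra.
have z0 := normc_ge0 z.
move: h1 h2; move: (normc (1 - z)) (normc z) zd z0 => n m zd z0 h1 h2.
have s1 : (1 - m) ^+ 2 <= n ^+ 2 by rewrite ler_pXn2r// nnegrE; lra.
have s2 : n ^+ 2 <= (1 + m) ^+ 2 by rewrite ler_pXn2r// nnegrE; lra.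
have m2 : m ^+ 2 <= m by rewrite expr2 ler_piMr//; lra.
have m20 := sqr_ge0 m.
rewrite ler_norml; move: s1 s2; rewrite sqrrB sqrrD expr1n mul1r; lra.
Qed.

Lemma norm2_ee t : norm2 mu (ee t) = 1.
Proof.
apply: EFin_inj; rewrite norm2E; last exact: in_L2_ee.
under eq_integral do rewrite normc_ee expr1n.
by rewrite integral_cst// mul1e [LHS]probability_setT.
Qed.

(** The total frame energy of e_t, a fixed point of the transfer operator; Parseval's identity for
    e_t is [hlim t = 1]. *)
Definition hlim (t : R) : R := limn (fun n => qs n (ee t)).

Lemma hlim_cvg t : qs n (ee t) @[n --> \oo] --> hlim t.
Proof.
apply: nondecreasing_is_cvgn.
  apply/nondecreasing_seqP => n; apply: (qsum_mono Rr2 uB B0 muI uL L0 alpha0).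
  exact: in_L2_ee.
exists 1 => _ [n _ <-]; rewrite -(norm2_ee t).
exact: (bessel Rr2 uB B0 muI ortho n (in_L2_ee mu t)).
Qed.

Lemma hlim_le1 t : hlim t <= 1.
Proof.
apply: (cvgr_to_le (@hlim_cvg t)); apply: nearW => n; rewrite -(norm2_ee t).
exact: (bessel Rr2 uB B0 muI ortho n (in_L2_ee mu t)).
Qed.

Lemma hlim0 : hlim 0 = 1.
Proof.
apply/eqP; rewrite eq_le hlim_le1 /=.
apply: (cvgr_to_ge (@hlim_cvg 0)); apply: nearW => n.
elim: n => [|n IH]; first by rewrite qsum0 cintegral1 (@Normc.normc1 R) expr1n.
apply: le_trans IH _; apply: (qsum_mono Rr2 uB B0 muI uL L0 alpha0).
exact: in_L2_ee.
Qed.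

Lemma hlim_fixed : transfer_fixed Rr B L alpha hlim.
Proof.
move=> t; apply: (@cvg_unique _ _ (qs n.+1 (ee t) @[n --> \oo])) => //.
  rewrite (_ : (fun n => _) = fun n => \sum_(l <- L) wt l t * qs n (ee (gmap Rr l t))).
    apply: cvg_big => [|l _]; first exact: add_continuous.
    by apply: cvgM; [exact: cvg_cst|exact: hlim_cvg].
  by apply/funext => n; rewrite (qsum_ee _ _ Rr2 uB B0 muI).
by have := @hlim_cvg t; rewrite -(cvg_shiftS (fun n => qs n (ee t))).
Qed.

Lemma hlim_entire : entire_limit hlim.
Proof.
apply: (@entire_limit_transfer R Rr B L alpha Rr2 B0 uB ortho phat (fun n t => qs n (ee t))).
- exact: phat_refine.
- exact: phat_cvg.
- by move=> t; rewrite qsum0.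
- by move=> n t; rewrite (qsum_ee _ _ Rr2 uB B0 muI).
- exact: hlim_cvg.
Qed.

Lemma parseval_of_minimal :
  (forall M : set R, finite_minimal_invariant Rr B L alpha M -> M = [set 0]) ->
  parseval_frame mu (Omega L) frame.
Proof.
move=> minM v vL; apply: esum_frame => //.
have h1 t : hlim t = 1.
  exact: (transfer_fixed_eq1 Rr2 B0 uB uL ortho minM hlim_entire hlim_fixed hlim0 hlim_le1).
apply: (@nul_in_L2 R mu dfc) => //.
- by move=> n u uLL; exact: (defect_ge0 Rr2 uB B0 muI ortho n uLL).
- by move=> n u; exact: defect_le.
- by move=> n u w uLL wLL; exact: (defectD Rr2 uB B0 muI ortho n uLL wLL).
- by move=> n u c uLL; exact: defectZ.
move=> t; split; first exact: in_L2_ee.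
have -> : (0 : R) = 1 - hlim t by rewrite h1 subrr.
rewrite (_ : (fun n => _) = fun n => 1 - qs n (ee t)).
  by apply: cvgB; [exact: cvg_cst|exact: hlim_cvg].
by apply/funext => n; rewrite /defect norm2_ee.
Qed.

(** In the order on complex numbers, [0 <= h t] includes that h t is real, so u = Re h agrees with h
    on the real axis and the minimum principle applies to u. The identity theorem carries h = 1 from
    [-1, 1] to the plane. *)
Lemma entire_fixed_eq1 (h : R[i] -> R[i]) :
  (forall M : set R, finite_minimal_invariant Rr B L alpha M -> M = [set 0]) ->
  entire h -> (forall t : R, 0 <= h (t%:C)%C <= 1) -> h 0 = 1 ->
  (forall t : R, \sum_(l <- L) `|alpha l| ^+ 2 * `|mB B (gmap Rr l t)| ^+ 2
     * h ((gmap Rr l t)%:C)%C = h (t%:C)%C) -> h = fun=> 1.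
Proof.
move=> minM eh h01 h0 hT.
have dh z : cdiff h z by apply: derivable_cdiff; exact: eh.
pose u t := complex.Re (h t%:C%C).
have hu t : h t%:C%C = (u t)%:C%C.
  have /andP[h1 _] := h01 t; rewrite /u; move: h1; case: (h _) => a b.
  by rewrite lecE /= => /andP[/eqP -> _].
have u1 t : u t = 1.
  apply: (transfer_fixed_eq1 Rr2 B0 uB uL ortho minM).
  - exact: entire_limit_entire dh hu.
  - move=> {}t; apply: (@complexI R); rewrite -hu -hT rmorph_sum; apply: eq_bigr => l _.
    by rewrite /weight hu 2!rmorphM /= !rmorphXn.
  - by rewrite /u -[0%:C%C]/(0 : R[i]) h0.
  - by move=> {}t; have /andP[_] := h01 t; rewrite hu -(rmorph1 (real_complex R)) lecR.
apply/funext => z; apply/eqP; rewrite -subr_eq0; apply/eqP.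
apply: (@entire_zeros R (fun z => h z - 1) [set t | `|t| <= 1] 1).
- by move=> w; apply: cdiffD; [exact: dh|exact: cdiff_cst].
- exact: infinite_segment.
- by move=> t /= t1; split => //; rewrite hu u1 subrr.
Qed.

Lemma entire_fixed_cst1 : [/\ @entire R (fun=> 1), (forall t : R, 0 <= (1 : R[i]) <= 1),
  (1 : R[i]) = 1 & (forall t : R, \sum_(l <- L) `|alpha l| ^+ 2 * `|mB B (gmap Rr l t)| ^+ 2
     * 1 = (1 : R[i]))].
Proof.
split => //.
- by move=> t; rewrite ler01 lexx.
- move=> t; transitivity ((\sum_(l <- L) wt l t)%:C)%C; last by rewrite (sum_weight B0 uB ortho).
  by rewrite rmorph_sum; apply: eq_bigr => l _; rewrite mulr1 /weight rmorphM /= !rmorphXn.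
Qed.

(** * Finite invariant sets that avoid 0 *)

Lemma mB0 : mB B (0 : R) = 1.
Proof.
rewrite /mB (eq_bigr (fun=> 1)) => [|b _]; last by rewrite /ee mulr0 expi2pi0.
rewrite big_const_seq count_predT iter_addr_0 mulVf// pnatr_eq0 -lt0n.
by case: (B) B0.
Qed.

Lemma gmap00 : gmap Rr 0 (0 : R) = 0.
Proof. by rewrite gmap0 mul0r. Qed.

(** At t = 0 the letter 0 alone has weight 1; as the weights sum to 1, every other letter has weight
    0. *)
Lemma invariant_zero : invariant_set Rr B L alpha [set (0 : R)].
Proof.
move=> t l -> lL nz /=; have [->|l0] := eqVneq l 0; first exact: gmap00.
have w0 : wt 0 0 = 1 by rewrite /weight alpha0 gmap00 mB0 (@Normc.normc1 R) expr1n mulr1.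
have := sum_weight B0 uB ortho 0.
rewrite (bigD1_seq 0)//= w0 -[RHS]addr0 => /addrI/eqP.
rewrite psumr_eq0 => [/allP/(_ _ lL)|k _]; last exact: weight_ge0.
rewrite l0 /= /weight -exprMn -Normc.normcM sqrf_eq0 normc_eq0.
by rewrite (negbTE nz).
Qed.

Lemma minimal_neq0_notin0 M : finite_minimal_invariant Rr B L alpha M -> M <> [set 0] -> ~ M 0.
Proof.
move=> [_ _ _ minM] Mne M0; apply: Mne; apply/esym; apply: minM.
- by move=> _ ->.
- by exists 0.
- exact: invariant_zero.
Qed.

(** If [phat c] were nonzero, the refinement equation would make every m_B(c / R^k) with k >= 1
    nonzero, and the letter 0 would keep the orbit c / R^k in M. These points are distinct, since c
    is nonzero and |R| >= 2, but M is finite. *)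
Lemma invariant_phat_eq0 M c : finite_set M -> invariant_set Rr B L alpha M -> ~ M 0 -> M c ->
  phat c = 0.
Proof.
move=> fM iM M0 Mc; apply: contrapT => /eqP pc.
have orbit k : M (c / Rz ^+ k) /\ phat (c / Rz ^+ k) != 0.
  elim: k => [|k [IHM]]; first by rewrite expr0 divr1.
  rewrite phat_refine mulf_eq0 negb_or sqrf_eq0 normc_eq0 => /andP[m0 p0].
  rewrite exprSr invfM mulrA; split => //.
  rewrite -gmap0; apply: iM => //.
  by rewrite alpha0 mul1r gmap0.
apply: infinite_nat.
have -> : [set: nat] = (fun k => c / Rz ^+ k) @^-1` M.
  by apply/seteqP; split => // k _; case: (orbit k).
apply: finite_preimage fM => i j _ _ /= E.
have c0 : c != 0 by apply: contra_notN M0 => /eqP <-.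
have := mulfI c0 E => /invr_inj /(congr1 Num.norm); rewrite !normrX.
have R2 := normr_base R Rr2.
by apply: ieexprIn; [lra|rewrite gt_eqF; lra].
Qed.

(** For n = 0 this is the vanishing of [phat] on M. In the recursion [qsum_ee], the letters of
    nonzero weight stay inside M, so the vanishing propagates. *)
Lemma qsum_ee_eq0 M n c : finite_set M -> invariant_set Rr B L alpha M -> ~ M 0 -> M c ->
  qs n (ee c) = 0.
Proof.
move=> fM iM M0; elim: n c => [|n IH] c Mc.
  by rewrite qsum0 -[LHS]/(phat c) (invariant_phat_eq0 fM iM M0 Mc).
rewrite (qsum_ee _ _ Rr2 uB B0 muI) big1_seq// => l /andP[_ lL].
have [z|nz] := eqVneq (alpha l * mB B (gmap Rr l c)) 0; last first.
  by rewrite IH ?mulr0//; exact: iM.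
by rewrite /weight -exprMn -Normc.normcM z (@Normc.normc0 R) expr0n mul0r.
Qed.

Lemma invariant_orthogonal M c w : finite_set M -> invariant_set Rr B L alpha M -> ~ M 0 -> M c ->
  all (fun l => l \in L) w -> l2inner mu (ee c) (frame w) = 0.
Proof.
move=> fM iM M0 Mc wL.
have /eqP := qsum_ee_eq0 (size w) fM iM M0 Mc.
rewrite /qsum psumr_eq0 => [/allP/(_ w)|? _]; last exact: sqr_ge0.
by rewrite mem_words eqxx wL => /(_ isT)/implyP/(_ isT); rewrite sqrf_eq0 normc_eq0 => /eqP.
Qed.

End Frame.

Theorem theorem4p4 (R : realType) (Rr : int) (B L : seq int)
  (X : set R) (mu : probability R R) (alpha : int -> R[i]) :
  (2 <= `|Rr|)%R ->
  uniq B -> 0 \in B ->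
  is_attractor Rr B X ->
  is_invariant_measure Rr B mu ->
  no_overlap Rr B X mu ->
  uniq L -> 0 \in L -> alpha 0 = 1 ->
  orthonormal_columns Rr B L alpha ->
  ((forall M : set R, finite_minimal_invariant Rr B L alpha M -> M = [set 0]) ->
     (forall h : R[i] -> R[i],
        [/\ entire h,
            (forall t : R, 0 <= h (t%:C)%C <= 1),
            h 0 = 1 &
            (forall t : R,
               \sum_(l <- L) `|alpha l| ^+ 2 * `|mB B (gmap Rr l t)| ^+ 2
                               * h ((gmap Rr l t)%:C)%C = h (t%:C)%C)]
        <-> h = fun _ => 1)
     /\ parseval_frame mu (Omega L) (frame_elt Rr alpha))
  /\
  (forall M : set R, finite_minimal_invariant Rr B L alpha M -> M <> [set 0] ->
     forall c : R, M c ->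
       forall w, Omega L w -> l2inner mu (ee c) (frame_elt Rr alpha w) = 0).
Proof.
move=> Rr2 uB B0 _ muI _ uL L0 alpha0 ortho; split=> [minM|M mM Mne c Mc w [wL _]].
  split=> [h|]; last exact: (parseval_of_minimal Rr2 uB B0 muI uL L0 alpha0 ortho minM).
  split=> [[eh h01 h0 hT]|->]; last exact: entire_fixed_cst1.
  exact: (entire_fixed_eq1 Rr2 uB B0 uL ortho minM eh h01 h0 hT).
have M0 : ~ M 0 by apply: minimal_neq0_notin0 mM Mne.
by case: mM => _ fM iM _; apply: invariant_orthogonal iM M0 Mc wL.
Qed.
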